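(* Let $F$ be a Minkowski norm on $\mathbb{R}^n$ with $n>2$ induced by an isoparametric foliation $M_t$ on $(S^{n-1}(1),g^{\mathrm{st}})$. Suppose its Hessian metric $g$ is flat on $\mathbb{R}^n\setminus\{0\}$. Then $F$ is Euclidean, i.e. $F(x)=\sqrt{\langle x,x\rangle'}$ for some inner product $\langle\cdot,\cdot\rangle'$ on $\mathbb{R}^n$.
   Context: An isoparametric function on a Riemannian manifold $(M,g)$ is a smooth $p:M\to\mathbb{R}$, regular almost everywhere, with $g(\mathrm{grad}\,p,\mathrm{grad}\,p)=a\circ p$ and $\Delta p=b\circ p$ for some one-variable functions $a,b$; the family of its non-empty level sets is called an isoparametric foliation. $g^{\mathrm{st}}$ is the standard flat metric of $\mathbb{R}^n$ (also its restriction to submanifolds). An isoparametric foliation on $(S^{n-1}(1),g^{\mathrm{st}})$ with $d\in\{1,2,3,4,6\}$ principal curvatures is given by the level sets of an isoparametric function $p:S^{n-1}(1)\to[-1,1]$ which is the restriction of a homogeneous polynomial of degree $d$ on $\mathbb{R}^n$ and has $\pm1$ as its only critical values; each $p^{-1}(s)$, $-1<s<1$, is a closed connected hypersurface with exactly $d$ distinct principal curvatures, and $p^{-1}(\pm1)$ are the two focal submanifolds. It is parametrized as $M_t$, $t\in[0,\tfrac{\pi}d]$, so that $\mathrm{dist}_{S^{n-1}(1)}(x,M_0)=t$ for all $x\in M_t$, where $M_0$ and $M_{\pi/d}$ are the focal submanifolds. A Minkowski norm on $\mathbb{R}^n$ is a continuous function $F:\mathbb{R}^n\to\mathbb{R}_{\ge0}$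 which is positive and smooth on $\mathbb{R}^n\setminus\{0\}$, satisfies $F(\lambda x)=\lambda F(x)$ for all $\lambda\ge0$, and for which the Hessian matrix of $E=\tfrac12F^2$ is positive definite at every $x\neq0$. Its Hessian metric is the Riemannian metric $g=\mathrm{d}^2E$ on $\mathbb{R}^n\setminus\{0\}$ given by this Hessian matrix in linear coordinates. $F$ is induced by $M_t$ if it is constant on each $M_t$. *)

(* Defs.v *)
(* R^n is 'rV[R]_n.  Its Euclidean structure is [dotp]: the library norm is the
   sup norm, used only through its topology and its balls. *)
From mathcomp Require Import all_boot all_order all_algebra.
From mathcomp Require Import sesquilinear.
From mathcomp Require Import all_classical all_reals all_analysis.
From mathcomp Require mpoly.
Import (canonicals, coercions) mpoly.
Set Implicit Arguments.
Unset Strict Implicit.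
Unset Printing Implicit Defensive.
Import Order.TTheory GRing.Theory Num.Theory.
Import numFieldNormedType.Exports.
Local Open Scope classical_set_scope.
Local Open Scope ring_scope.

Section Calculus.
Variables (R : realType) (n : nat).
Local Notation V := 'rV[R]_n.
Implicit Types (f : V -> R) (x u v : V) (U : set V) (G : V -> 'M[R]_n).

Definition dotp u v : R := \sum_i u 0 i * v 0 i.

Definition pderive (i : 'I_n) f : V -> R := fun x => 'D_(delta_mx 0 i) f x.

Definition gradient f x : V := \row_i pderive i f x.

Fixpoint Ck (k : nat) U f : Prop :=
  (forall x, U x -> {for x, continuous f}) /\
  match k with
  | 0%N => True
  | k'.+1 => forall i : 'I_n, (forall x, U x -> derivable f x (delta_mx 0 i)) /\
                       Ck k' U (pderive i f)
  end.

Definition smooth_on U f : Prop := forall k, Ck k U f.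

Definition hessian f x : 'M[R]_n := \matrix_(i, j) pderive i (pderive j f) x.

Definition posdef_mx (A : 'M[R]_n) : Prop :=
  forall v, v != 0 -> 0 < (v *m A *m v^T) 0 0.

(* Gamma^k_{ij} of the Levi-Civita connection of the metric G *)
Definition christoffel G (k i j : 'I_n) x : R :=
  2^-1 * \sum_l invmx (G x) k l *
    (pderive i (fun y => G y j l) x + pderive j (fun y => G y i l) x
     - pderive l (fun y => G y i j) x).

(* dx^l (R(e_i, e_j) e_k) *)
Definition riemann G (l i j k : 'I_n) x : R :=
  pderive i (christoffel G l j k) x - pderive j (christoffel G l i k) x
  + \sum_m (christoffel G l i m x * christoffel G m j k x
            - christoffel G l j m x * christoffel G m i k x).

Definition flat_on U G : Prop :=
  forall x, U x -> forall l i j k, riemann G l i j k x = 0.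

End Calculus.

Section Minkowski.
Variables (R : realType) (n : nat).
Implicit Types F : 'rV[R]_n -> R.

Definition punctured : set 'rV[R]_n := [set x | x != 0].

Definition energy F : 'rV[R]_n -> R := fun x => 2^-1 * F x ^+ 2.

Definition hessian_metric F : 'rV[R]_n -> 'M[R]_n := hessian (energy F).

Record minkowski_norm F : Prop := MinkowskiNorm {
  mink_continuous : continuous F;
  mink_ge0 : forall x, 0 <= F x;
  mink_gt0 : forall x : 'rV[R]_n, x != 0 -> 0 < F x;
  mink_smooth : smooth_on punctured F;
  mink_homog : forall (l : R) (x : 'rV[R]_n), 0 <= l -> F (l *: x) = l * F x;
  mink_posdef : forall x : 'rV[R]_n, x != 0 -> posdef_mx (hessian_metric F x)
}.

Definition euclidean_norm F : Prop :=
  exists ip : {dot 'rV[R]_n for idfun}, forall x, F x = Num.sqrt (ip x x).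

End Minkowski.

Arguments punctured R n : clear implicits.

(* Functions and vector fields on the sphere are given by ambient ones.  At
   points of the sphere the operators below depend only on their restriction to
   it: only derivatives along tangent vectors remain after projection. *)
Section Sphere.
Variables (R : realType) (n : nat).
Local Notation V := 'rV[R]_n.
Implicit Types (p : V -> R) (X : V -> V) (x u v : V) (A : set V).

Definition usphere : set V := [set x | dotp x x = 1].

Definition tangent_proj x v : V := v - dotp v x *: x.

Definition sphere_grad p x : V := tangent_proj x (gradient p x).

(* Divergence for the Levi-Civita connection tangent_proj x ('D_v X x):
   the trace of v |-> tangent_proj x ('D_v X x) on the tangent space at x. *)
Definition sphere_div X x : R :=
  \sum_(i < n) dotp ('D_(tangent_proj x (delta_mx 0 i)) X x)
                    (tangent_proj x (delta_mx 0 i)).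

Definition sphere_laplacian p : V -> R := sphere_div (sphere_grad p).

Definition sphere_critical p : set V :=
  [set x | usphere x /\ sphere_grad p x = 0].

(* Null sets of the (n-1)-dimensional measure, by coverings with balls;
   sup-norm balls are comparable to Euclidean ones. *)
Definition sphere_null A : Prop :=
  forall e : R, 0 < e -> exists (c : nat -> V) (r : nat -> R),
    [/\ forall i, 0 <= r i,
        A `<=` \bigcup_i ball (c i) (r i) &
        (\sum_(0 <= i <oo) (r i ^+ n.-1)%:E <= e%:E)%E].

Definition level_set p (s : R) : set V := [set x | usphere x /\ p x = s].

Definition unit_normal p x : V :=
  (Num.sqrt (dotp (sphere_grad p x) (sphere_grad p x)))^-1 *: sphere_grad p x.

(* Shape operator v |-> - (D_v N)^T of the level set of p through x *)
Definition shape_operator p x v : V :=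
  let N := unit_normal p in
  let w := - 'D_v N x in w - dotp w x *: x - dotp w (N x) *: N x.

Definition principal_curvature p x (k : R) : Prop :=
  exists v, [/\ v != 0, dotp v x = 0, dotp v (unit_normal p x) = 0 &
                shape_operator p x v = k *: v].

Definition sphere_dist x u : R := acos (dotp x u).

Definition sphere_dist_to A x : R := inf [set sphere_dist x u | u in A].

Definition homogeneous_poly (d : nat) p : Prop :=
  exists P : mpoly.mpoly n R,
    P \is mpoly.ishomog1 d (@mpoly.mdeg n) /\
    forall x, p x = mpoly.meval (fun i => x 0 i) P.

(* Smoothness of p is not required here: it is applied to polynomials. *)
Record isoparametric_on_sphere p : Prop := IsoparametricOnSphere {
  isop_regular_ae : sphere_null (sphere_critical p);
  isop_grad : exists a : R -> R, forall x, usphere x ->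
    dotp (sphere_grad p x) (sphere_grad p x) = a (p x);
  isop_laplacian : exists b : R -> R, forall x, usphere x ->
    sphere_laplacian p x = b (p x)
}.

Record isoparametric_polynomial (d : nat) p : Prop := IsoparametricPolynomial {
  isopoly_homog : homogeneous_poly d p;
  isopoly_isop : isoparametric_on_sphere p;
  isopoly_range : forall x, usphere x -> -1 <= p x <= 1;
  isopoly_critical : p @` sphere_critical p = [set -1; 1];
  isopoly_levels : forall s : R, -1 < s < 1 ->
    [/\ compact (level_set p s), connected (level_set p s) &
        forall x, level_set p s x ->
          ([set k | principal_curvature p x k] #= `I_d)%card]
}.

Definition isoparametric_foliation (d : nat) (M : R -> set V) : Prop :=
  d \in [:: 1; 2; 3; 4; 6]%N /\
  exists p, [/\ isoparametric_polynomial d p,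
    [set M t | t in `[0, pi / d%:R]] = [set level_set p s | s in p @` usphere],
    (M 0 = level_set p 1 /\ M (pi / d%:R) = level_set p (-1)) \/
      (M 0 = level_set p (-1) /\ M (pi / d%:R) = level_set p 1) &
    forall (t : R) (x : V), t \in `[0, pi / d%:R] ->
      M t x -> sphere_dist_to (M 0) x = t].

Definition induced_by (F : V -> R) (d : nat) (M : R -> set V) : Prop :=
  forall t : R, t \in `[0, pi / d%:R] ->
    forall x y : V, M t x -> M t y -> F x = F y.

End Sphere.

(* Main.v *)
From HB Require Import structures.
Require Import Defs.
From mathcomp Require Import all_boot all_order all_algebra.
From mathcomp Require Import sesquilinear ring lra.
From mathcomp Require Import all_classical all_reals all_analysis.
From mathcomp Require mpoly.
Import (canonicals, coercions) mpoly.

(** Let [E] be half the square of the norm, [tau] the spherical distance to the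
    focal set [M 0] and [L = pi / d].  The distance is 1-Lipschitz, and every point
    of the sphere is joined to [M 0] by a great circle arc along which [tau] is the
    length.  On the sphere both the polynomial [p] and [E] are functions of [tau], so
    their gradients on the sphere are tangent to these arcs ([diff1_split]).  Fix one
    arc [g] of length [L], with velocity [nu], and put [h t = E (g t)].

    Focusing directions.  The normals of the level sets are the velocities of the
    arcs, so a principal direction is constant along an arc and its curvature is
    the cotangent of a shifted angle ([outer_normal_flow],
    [douter_normal_flow]).  Inserting this into the second derivative of the
    homogeneous polynomial [p] shows that every principal curvature at a point of
    [g] is a root of a polynomial of degree at most [d] which, up to a power of the
    sine, is the derivative of [p] along [g] ([principal_root]).  There are [d]
    distinct principal curvatures, so they are all its roots.  As [p] is critical at
    both ends of [g], some direction [e] focuses at [M 0] and some direction focuses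
    at [M L] ([focusing_directions]).

    Flatness.  In the curvature tensor of a Hessian metric the fourth derivatives
    cancel, and flatness says that the third derivatives, as operators for the
    metric, commute ([flat_third_comm]).  Along [g] the directions [e] and [nu] are,
    up to multiples of [g], eigenvectors of the second and third derivatives of [E].
    With [lam = 2 h + h' cot t] the Hessian of [E] in the direction [e], [kp] the
    third derivative in the direction [nu], and [G > 0] the squared length of the
    part of [nu] orthogonal to [g], flatness becomes [lam' ^ 2 / lam = kp lam' / G]
    ([flatness_equation]).  For [m = lam' sin t] the quantity [m ^ 2 / (lam G)] is then
    constant, and it vanishes at the focal point [t = 0].  Hence [lam' = 0], which
    means [h = B + A cos ^ 2 t] ([profile_ode]), and [E = B + A cos ^ 2 tau] on the
    sphere ([energy_sphere]).

    Conclusion.  If [d > 2], the Hessian of [E] in the direction focusing at [M L]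
    contains [h' cot (t - L)] and is bounded, so [h' L = 0]
    ([profile_critical_end]); since [sin (2 L)] is not zero, [A = 0].  If [d = 1],
    then [p] is linear and [cos ^ 2 tau = p ^ 2]; if [d = 2], then [p] is quadratic
    and [cos ^ 2 tau = (1 + p) / 2] up to the sign of [p].  In all cases [E] is a
    quadratic form on the sphere, hence everywhere, and it is positive definite. *)

Set Implicit Arguments.
Unset Strict Implicit.
Unset Printing Implicit Defensive.
Import Order.TTheory GRing.Theory Num.Theory.
Import numFieldNormedType.Exports.
Local Open Scope classical_set_scope.
Local Open Scope ring_scope.

(** * Functions with continuous partial derivatives *)

Section CalculusTheory.
Variables (R : realType) (n : nat).
Local Notation V := 'rV[R]_n.
Local Notation e_ i := (delta_mx 0 i : V).
Implicit Types (f g : V -> R) (x y u v : V) (U : set V).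

Lemma is_derive_along_line f y v (t : R) :
  derivable f (y + t *: v) v ->
  is_derive t 1 (fun s : R => f (y + s *: v)) ('D_v f (y + t *: v)).
Proof.
have E : (fun h : R => h^-1 *: (f (y + (h *: (1:R) + t) *: v) - f (y + t *: v)))
   = (fun h => h^-1 *: (f (h *: v + (y + t *: v)) - f (y + t *: v))).
  apply: funext => h; rewrite (_ : h *: (1 : R) = h); last exact: mulr1.
  by rewrite scalerDl addrCA.
move=> df; split.
  by rewrite /derivable /= E.
by rewrite /derive /= E.
Qed.

Lemma mvt_coord f y (i : 'I_n) (s : R) :
  (forall t : R, `|t| <= `|s| -> derivable f (y + t *: e_ i) (e_ i)) ->
  exists t : R, `|t| <= `|s| /\
    f (y + s *: e_ i) - f y = pderive i f (y + t *: e_ i) * s.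
Proof.
move=> df.
pose g (r : R) := f (y + r *: e_ i).
have dg (t : R) : `|t| <= `|s| -> is_derive t 1 g (pderive i f (y + t *: e_ i)).
  by move=> ts; apply: is_derive_along_line; exact: df.
have cg (a b : R) : (forall t : R, a <= t <= b -> `|t| <= `|s|) -> {within `[a, b], continuous g}.
  move=> ab; apply: derivable_within_continuous => t; rewrite in_itv /= => /ab /dg.
  by move=> H; apply: ex_derive.
have [s0|s0|<-] := ltgtP 0 s; last first.
- exists 0; split => //.
  by rewrite scale0r addr0 subrr mulr0.
- have ab (t : R) : s <= t <= 0 -> `|t| <= `|s|.
    by move=> /andP[st t0]; rewrite !ler0_norm ?lerN2 // ltW.
  have [|c + E] := @MVT R g (fun t => pderive i f (y + t *: e_ i)) _ _ s0 _ (cg _ _ ab).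
    by move=> t; rewrite in_itv /= => /andP[/ltW a1 /ltW a2]; apply: dg; apply: ab; rewrite a1.
  rewrite in_itv /= => /andP[/ltW a1 /ltW a2]; exists c; split; first by apply: ab; rewrite a1.
  move: E; rewrite /g scale0r addr0 sub0r mulrN => /eqP.
  by rewrite -eqr_oppLR opprB => /eqP ->.
- have ab (t : R) : 0 <= t <= s -> `|t| <= `|s|.
    by move=> /andP[t0 st]; rewrite !ger0_norm // (le_trans t0).
  have [|c + E] := @MVT R g (fun t => pderive i f (y + t *: e_ i)) _ _ s0 _ (cg _ _ ab).
    by move=> t; rewrite in_itv /= => /andP[/ltW a1 /ltW a2]; apply: dg; apply: ab; rewrite a1.
  rewrite in_itv /= => /andP[/ltW a1 /ltW a2]; exists c; split; first by apply: ab; rewrite a1.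
  by move: E; rewrite /g scale0r addr0 subr0.
Qed.

Lemma coord_le_norm v (i : 'I_n) : `|v 0 i| <= `|v|.
Proof. by rewrite [leRHS]/Num.Def.normr/= mx_normrE; exact: (le_bigmax _ _ (0, i)). Qed.

Lemma norm_le_coord v (e : R) : 0 <= e -> (forall i, `|v 0 i| <= e) -> `|v| <= e.
Proof.
move=> e0 H; rewrite [leLHS]/Num.Def.normr/= mx_normrE bigmax_le // => -[i j] _ /=.
by rewrite ord1.
Qed.

Lemma dotpZr u v (k : R) : dotp u (k *: v) = k * dotp u v.
Proof. by rewrite /dotp mulr_sumr; apply: eq_bigr => i _; rewrite mxE mulrCA. Qed.
Lemma dotpDr u v w : dotp u (v + w) = dotp u v + dotp u w.
Proof. by rewrite /dotp -big_split /=; apply: eq_bigr => i _; rewrite mxE mulrDr. Qed.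

Lemma dotp_continuous u : continuous (dotp u).
Proof.
apply: (@continuous_big _ _ _ _ _ _ V) => [|i _ v]; first exact: add_continuous.
apply: (@continuousM _ _ (fun=> u 0 i) (fun v : V => v 0 i)); first exact: cst_continuous.
exact: coord_continuous.
Qed.

(** The increment is telescoped along the coordinate axes, and the mean value
    theorem applies to each leg. *)
Lemma differentiable_of_partials U f x : open U -> U x ->
  (forall i y, U y -> derivable f y (e_ i)) ->
  (forall i, {for x, continuous (pderive i f)}) ->
  differentiable f x /\ forall v, 'd f x v = dotp (gradient f x) v.
Proof.
move=> oU Ux df cf.
have lin : linear (dotp (gradient f x)).
  by move=> k u v; rewrite dotpDr dotpZr.
pose dfM := GRing.isLinear.Build _ _ _ _ _ lin.
pose df' : {linear V -> R} := HB.pack (dotp (gradient f x)) dfM.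
have cdf : continuous df' by exact: dotp_continuous.
have H : f \o shift x = cst (f x) + df' +o_ (0 : V) (id : V -> V).
  apply/eqaddoP => e e0 /=.
  have n0 : 0 < (n.+1)%:R :> R by rewrite ltr0n.
  have : \forall y \near x, U y /\ forall i, `|pderive i f x - pderive i f y| <= e / n.+1%:R.
    near=> y; split; first by near: y; exact: open_nbhs_nbhs.
    near: y; apply: filter_forall => i.
    by move: (cf i) => /cvgrPdist_le /(_ _ (divr_gt0 e0 n0)).
  move=> /nbhs_ballP [r /= r0 br].
  have N0 : \forall h \near (0 : V), `|h| < r by exact: nbhs0_lt.
  apply: filterS N0 => h hr.
  rewrite !fctE /=.
  (* the leg number [k] goes from [x + hk k] to [x + hk k.+1] *)
  pose hk (k : nat) : V := \row_(i < n) (if (i < k)%N then h 0 i else 0).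
  have hkn : hk n = h by apply/rowP => i; rewrite mxE ltn_ord.
  have hk0 : hk 0%N = 0 by apply/rowP => i; rewrite !mxE.
  have hkS (k : 'I_n) : hk k.+1 = hk k + h 0 k *: e_ k.
    apply/rowP => i; rewrite !mxE /= ltnS leq_eqVlt.
    have [/val_inj ->|ik] := eqVneq (val i) (val k); first by rewrite ltnn eqxx mulr1 add0r.
    by rewrite (negbTE (ik : i != k)) mulr0 addr0.
  have tele : f (h + x) - f x = \sum_(k < n) (f (x + hk k.+1) - f (x + hk k)).
    have := @telescope_sumr_eq _ 0%N n (fun k => f (x + hk k))
      (fun k => f (x + hk k.+1) - f (x + hk k)) (leq0n n) (fun k _ => erefl).
    by rewrite big_mkord hkn hk0 addr0 [h + x]addrC => ->.
  rewrite opprD addrA tele /dotp -sumrB.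
  apply: le_trans (ler_norm_sum _ _ _) _.
  apply: (@le_trans _ _ (\sum_(i < n) (e / n.+1%:R * `|h|))); last first.
    rewrite sumr_const card_ord -[leLHS]mulr_natr mulrAC.
    apply: ler_wpM2r => //.
    by rewrite mulrAC ler_pdivrMr // ler_wpM2l ?ltW // ltr_nat.
  apply: ler_sum => k _.
  have bk (t : R) : `|t| <= `|h 0 k| -> ball x r (x + hk k + t *: e_ k).
    move=> th; rewrite -ball_normE /= -addrA opprD addNKr normrN.
    apply: le_lt_trans hr; apply: norm_le_coord => // i.
    rewrite !mxE /=; case: ltngtP => [ik|ik|/val_inj ->].
    - by rewrite (_ : (i == k) = false) ?mulr0 ?addr0 ?coord_le_norm // -val_eqE /= ltn_eqF.
    - by rewrite (_ : (i == k) = false) ?mulr0 ?addr0 ?normr0 // -val_eqE /= gtn_eqF.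
    - by rewrite eqxx mulr1 add0r (le_trans th) // coord_le_norm.
  rewrite hkS addrA.
  have [t [th ->]] : exists t : R, `|t| <= `|h 0 k| /\
      f (x + hk k + h 0 k *: e_ k) - f (x + hk k) = pderive k f (x + hk k + t *: e_ k) * h 0 k.
    by apply: mvt_coord => t th; apply: df; case: (br _ (bk _ th)).
  rewrite [gradient _ _ _ _]mxE -mulrBl normrM ler_pM //; last exact: coord_le_norm.
  by rewrite distrC; case: (br _ (bk _ th)).
have dE : 'd f x = df' :> (V -> R) by apply: diff_unique.
split; last by move=> v; rewrite dE.
by apply/diff_locallyP; rewrite dE.
Unshelve. all: by end_near. Qed.

Lemma smooth_pderive U f i : smooth_on U f -> smooth_on U (pderive i f).
Proof. by move=> sf k; have [_ /(_ i)[]] := sf k.+1. Qed.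

Lemma smooth_derivable U f i x : smooth_on U f -> U x -> derivable f x (e_ i).
Proof. by move=> sf Ux; have [_ /(_ i)[/(_ _ Ux)]] := sf 1%N. Qed.

Lemma smooth_continuous U f x : smooth_on U f -> U x -> {for x, continuous f}.
Proof. by move=> sf; have [+ _] := sf 0%N; apply. Qed.

Lemma smooth_differentiable U f x : open U -> smooth_on U f -> U x ->
  differentiable f x.
Proof.
move=> oU sf Ux; apply: (proj1 (@differentiable_of_partials U f x oU Ux _ _)).
  by move=> i y; exact: smooth_derivable.
by move=> i; apply: smooth_continuous Ux; apply: smooth_pderive.
Qed.

Lemma smooth_diffE U f x v : open U -> smooth_on U f -> U x ->
  'd f x v = dotp (gradient f x) v.
Proof.
move=> oU sf Ux; apply: (proj2 (@differentiable_of_partials U f x oU Ux _ _)).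
  by move=> i y; exact: smooth_derivable.
by move=> i; apply: smooth_continuous Ux; apply: smooth_pderive.
Qed.

Lemma is_derive_translate f v w x : derivable f (x + w) v ->
  is_derive x v (fun y => f (y + w)) ('D_v f (x + w)).
Proof.
have E : (fun h : R => h^-1 *: (f (h *: v + x + w) - f (x + w)))
   = (fun h => h^-1 *: (f (h *: v + (x + w)) - f (x + w))).
  by apply: funext => h; rewrite addrA.
move=> df; split.
  by rewrite /derivable /= E.
by rewrite /derive /= E.
Qed.

Lemma norm_axis (a : R) (i : 'I_n) : `|a *: e_ i| <= `|a|.
Proof.
apply: norm_le_coord => // k; rewrite !mxE eqxx /= normrM.
by case: eqP => _; rewrite ?normr1 ?normr0 ?mulr1 ?mulr0.
Qed.

(** Two applications of the mean value theorem, the first one to the increment in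
    the direction [j].  The left-hand side is symmetric in [i] and [j]. *)
Lemma second_difference U f (i j : 'I_n) x (s r : R) :
  ball x r `<=` U -> smooth_on U f -> `|s| + `|s| < r ->
  exists y, `|x - y| <= `|s| + `|s| /\
   f (x + s *: e_ i + s *: e_ j) - f (x + s *: e_ i) - f (x + s *: e_ j) + f x
   = pderive j (pderive i f) y * (s * s).
Proof.
move=> bU sf sr.
have inU (a b : R) : `|a| <= `|s| -> `|b| <= `|s| ->
    `|x - (x + a *: e_ i + b *: e_ j)| <= `|s| + `|s|.
  move=> a1 b1; rewrite -addrA opprD addNKr normrN.
  apply: le_trans (ler_normD _ _) _.
  by apply: lerD; [apply: le_trans a1|apply: le_trans b1]; exact: norm_axis.
have inU2 (a b : R) : `|a| <= `|s| -> `|b| <= `|s| -> U (x + a *: e_ i + b *: e_ j).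
  move=> a1 b1; apply: bU; rewrite -ball_normE /=.
  exact: le_lt_trans (inU _ _ a1 b1) sr.
have inU3 (a : R) : `|a| <= `|s| -> U (x + a *: e_ i).
  by move=> a1; have := @inU2 a 0 a1; rewrite scale0r addr0 normr0; apply.
pose g y := f (y + s *: e_ j) - f y.
have dg (a : R) : `|a| <= `|s| ->
    is_derive (x + a *: e_ i) (e_ i) g
      (pderive i f (x + a *: e_ i + s *: e_ j) - pderive i f (x + a *: e_ i)).
  move=> a1.
  have H1 := is_derive_translate (smooth_derivable (i := i) sf (inU2 _ _ a1 (lexx _))).
  have H2 := derivableP (smooth_derivable (i := i) sf (inU3 _ a1)).
  exact: is_deriveB.
have [a [a1 Ea]] := @mvt_coord g x i s (fun a a1 => @ex_derive _ _ _ _ _ _ _ (dg _ a1)).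
move: Ea; rewrite /(pderive i g) (@derive_val _ _ _ _ _ _ _ (dg _ a1)) /g => Ea.
have [b [b1 Eb]] := @mvt_coord (pderive i f) (x + a *: e_ i) j s
   (fun b b1 => smooth_derivable (i := j) (smooth_pderive i sf) (inU2 _ _ a1 b1)).
exists (x + a *: e_ i + b *: e_ j); split; first exact: inU.
move: Ea; rewrite Eb -mulrA => <-.
by rewrite opprB addrA addrAC.
Qed.

Lemma continuous_near_eq f g x :
  (\forall y \near x, f y = g y) -> {for x, continuous f} -> {for x, continuous g}.
Proof.
move=> fg cf; have E : f x = g x := nbhs_singleton fg.
rewrite /prop_for /continuous_at -E; apply: cvg_trans cf.
by apply: (@near_eq_cvg _ _ (nbhs x) (nbhs_filter x)); apply: filterS fg => y ->.
Qed.

(** The derivative of a sum or a product is given by its rule on [U] only, so the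
    rules for [Ck] need this transfer. *)
Lemma Ck_ext k U f g : open U -> (forall x, U x -> f x = g x) ->
  Ck k U f -> Ck k U g.
Proof.
move=> oU; elim: k f g => [|k IH] f g fg.
all: have nfg x : U x -> \forall y \near x, f y = g y
  by move=> Ux; apply: filterS fg _; exact: open_nbhs_nbhs.
all: have cfg : (forall x, U x -> {for x, continuous f}) -> forall x, U x -> {for x, continuous g}
  by move=> cf x Ux; apply: continuous_near_eq (nfg _ Ux) (cf _ Ux).
  by case=> /cfg.
case=> cf df; split; first exact: cfg.
move=> i; have [dfi Cfi] := df i; split.
  by move=> x Ux; apply: near_eq_derivable (dfi _ Ux); exact: nfg.
by apply: IH Cfi => x Ux; apply: near_eq_derive; exact: nfg.
Qed.

Lemma CkS k U f : Ck k.+1 U f -> Ck k U f.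
Proof.
elim: k f => [|k IH] f [cf df]; split => // i.
by have [dfi Cfi] := df i; split => //; exact: IH.
Qed.

Lemma CkD k U f g : open U -> Ck k U f -> Ck k U g -> Ck k U (fun x => f x + g x).
Proof.
move=> oU; elim: k f g => [|k IH] f g [cf df] [cg dg]; split => //.
1,2: by move=> x Ux; apply: continuousD; [exact: cf|exact: cg].
move=> i; have [dfi Cfi] := df i; have [dgi Cgi] := dg i; split.
  by move=> x Ux; apply: derivableD; [exact: dfi|exact: dgi].
apply: Ck_ext (IH _ _ Cfi Cgi) => // x Ux.
by rewrite /pderive deriveD //; [exact: dfi|exact: dgi].
Qed.

Lemma CkM k U f g : open U -> Ck k U f -> Ck k U g -> Ck k U (fun x => f x * g x).
Proof.
move=> oU; elim: k f g => [|k IH] f g Cf Cg; have [cf df] := Cf; have [cg dg] := Cg; split => //.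
1,2: by move=> x Ux; apply: continuousM; [exact: cf|exact: cg].
move=> i; have [dfi Cfi] := df i; have [dgi Cgi] := dg i; split.
  by move=> x Ux; apply: derivableM; [exact: dfi|exact: dgi].
apply: Ck_ext (CkD oU (IH _ _ (CkS Cf) Cgi) (IH _ _ (CkS Cg) Cfi)) => // x Ux.
by rewrite /pderive deriveM //; [exact: dfi|exact: dgi].
Qed.

Lemma Ck_cst k U (c : R) : Ck k U (fun=> c).
Proof.
elim: k c => [|k IH] c; split => //.
1,2: by move=> x _; exact: cst_continuous.
move=> i; split; first by move=> x _; exact: derivable_cst.
suff -> : pderive i (fun=> c) = (fun=> 0) by exact: IH.
by apply: funext => x; exact: derive_cst.
Qed.

(** Schwarz: both mixed partials are limits of the same second difference
    quotient. *)
Lemma pderiveC U f (i j : 'I_n) x : open U -> smooth_on U f -> U x ->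
  pderive i (pderive j f) x = pderive j (pderive i f) x.
Proof.
move=> oU sf Ux; apply/eqP; rewrite -subr_eq0 -normr_le0; apply/ler_addgt0Pl => e e0.
rewrite addr0.
have cont k l : \forall y \near x, `|pderive k (pderive l f) x - pderive k (pderive l f) y| <= e / 2.
  have := smooth_continuous (smooth_pderive k (smooth_pderive l sf)) Ux.
  by move=> /cvgrPdist_le /(_ (e / 2)); apply; rewrite divr_gt0.
have NU : nbhs x U by exact: open_nbhs_nbhs.
have FF := @nbhs_filter _ x.
have := @filterI _ _ FF _ _ NU (@filterI _ _ FF _ _ (cont i j) (cont j i)).
move=> /nbhs_ballP [r /= r0 br].
pose s := r / 3.
have s0 : 0 < s by rewrite divr_gt0.
have sr : `|s| + `|s| < r by rewrite gtr0_norm // /s; lra.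
have bU : ball x r `<=` U by move=> y /br [].
have [y [xy Ey]] := second_difference i j bU sf sr.
have [z [xz Ez]] := second_difference j i bU sf sr.
have yz : pderive i (pderive j f) z = pderive j (pderive i f) y.
  apply: (@mulIf _ (s * s)); first by rewrite mulf_neq0 ?gt_eqF.
  apply: etrans (esym Ez) _; apply: etrans _ Ey.
  have -> : x + s *: e_ j + s *: e_ i = x + s *: e_ i + s *: e_ j by rewrite addrAC.
  by rewrite -[LHS]addrA -[RHS]addrA -addrA -[in RHS]addrA; congr (_ + _); rewrite addrCA.
have inball w : `|x - w| <= `|s| + `|s| -> ball x r w.
  by move=> xw; rewrite -ball_normE /=; exact: le_lt_trans xw sr.
have [_ [H1 _]] := br z (inball _ xz).
have [_ [_ H2]] := br y (inball _ xy).
rewrite -(subrKA (pderive i (pderive j f) z)) [leRHS](splitr e).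
apply: le_trans (ler_normD _ _) _; apply: lerD; first exact: H1.
by rewrite yz distrC; exact: H2.
Qed.

End CalculusTheory.

(** * Derivatives as symmetric multilinear forms *)

Section Multilinear.
Variables (R : realType) (n : nat).
Local Notation V := 'rV[R]_n.
Implicit Types (f g : V -> R) (x y u v w z a b : V) (U : set V) (k : R).

Lemma dotpC u v : dotp u v = dotp v u.
Proof. by apply: eq_bigr => i _; rewrite mulrC. Qed.
Lemma dotpZl u v k : dotp (k *: u) v = k * dotp u v.
Proof. by rewrite dotpC dotpZr dotpC. Qed.
Lemma dotpDl u v w : dotp (u + v) w = dotp u w + dotp v w.
Proof. by rewrite dotpC dotpDr !(dotpC w). Qed.
Lemma dotpNl u v : dotp (- u) v = - dotp u v.
Proof. by rewrite -scaleN1r dotpZl mulN1r. Qed.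
Lemma dotpNr u v : dotp u (- v) = - dotp u v.
Proof. by rewrite dotpC dotpNl dotpC. Qed.
Lemma dotpBl u v w : dotp (u - v) w = dotp u w - dotp v w.
Proof. by rewrite dotpDl dotpNl. Qed.
Lemma dotpBr u v w : dotp u (v - w) = dotp u v - dotp u w.
Proof. by rewrite dotpDr dotpNr. Qed.
Lemma dotp_ge0 u : 0 <= dotp u u.
Proof. by apply: sumr_ge0 => i _; rewrite -expr2 sqr_ge0. Qed.
Lemma dotp_eq0 u : (dotp u u == 0) = (u == 0).
Proof.
apply/idP/eqP => [|->]; last by rewrite -(scale0r u) dotpZl mul0r.
rewrite psumr_eq0 => [/allP H|i _]; last by rewrite -expr2 sqr_ge0.
apply/rowP => i; rewrite mxE; apply/eqP.
by have /implyP/(_ isT) := H i (mem_index_enum i); rewrite -expr2 sqrf_eq0.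
Qed.
Lemma dotp_gt0 u : u != 0 -> 0 < dotp u u.
Proof. by move=> u0; rewrite lt_def dotp_eq0 u0 dotp_ge0. Qed.
Lemma dotp_normalize u : u != 0 ->
  dotp ((Num.sqrt (dotp u u))^-1 *: u) ((Num.sqrt (dotp u u))^-1 *: u) = 1.
Proof.
move=> u0; have uu := dotp_gt0 u0; set m := dotp u u in uu *.
rewrite dotpZl dotpZr -/m mulrA -[X in _ * X](sqr_sqrtr (ltW uu)) -expr2 -exprMn.
by rewrite mulVf ?expr1n // gt_eqF ?sqrtr_gt0.
Qed.

(** Iterated derivatives contracted with fixed vectors; the first vector is the
    direction of the innermost derivative. *)
Definition diff1 f x v : R := dotp (gradient f x) v.
Definition diff2 f x v w : R := \sum_i diff1 (pderive i f) x w * v 0 i.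
Definition diff3 f x u v w : R := \sum_i diff2 (pderive i f) x v w * u 0 i.

Lemma diff1D f x u v : diff1 f x (u + v) = diff1 f x u + diff1 f x v.
Proof. exact: dotpDr. Qed.
Lemma diff1Z f x k v : diff1 f x (k *: v) = k * diff1 f x v.
Proof. exact: dotpZr. Qed.
Lemma diff1N f x v : diff1 f x (- v) = - diff1 f x v.
Proof. exact: dotpNr. Qed.
Lemma diff1E f x v : diff1 f x v = \sum_i pderive i f x * v 0 i.
Proof. by apply: eq_bigr => i _; rewrite mxE. Qed.

Lemma eq_diff1 f g x v : (forall i, pderive i f x = pderive i g x) ->
  diff1 f x v = diff1 g x v.
Proof. by move=> fg; rewrite !diff1E; apply: eq_bigr => i _; rewrite fg. Qed.

Lemma diff2Dl f x u v w : diff2 f x (u + v) w = diff2 f x u w + diff2 f x v w.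
Proof. by rewrite -big_split /=; apply: eq_bigr => i _; rewrite mxE mulrDr. Qed.
Lemma diff2Zl f x k v w : diff2 f x (k *: v) w = k * diff2 f x v w.
Proof. by rewrite mulr_sumr; apply: eq_bigr => i _; rewrite mxE mulrCA. Qed.
Lemma diff2Nl f x v w : diff2 f x (- v) w = - diff2 f x v w.
Proof. by rewrite -scaleN1r diff2Zl mulN1r. Qed.
Lemma diff2Dr f x u v w : diff2 f x u (v + w) = diff2 f x u v + diff2 f x u w.
Proof. by rewrite -big_split /=; apply: eq_bigr => i _; rewrite diff1D mulrDl. Qed.
Lemma diff2Zr f x k v w : diff2 f x v (k *: w) = k * diff2 f x v w.
Proof. by rewrite mulr_sumr; apply: eq_bigr => i _; rewrite diff1Z mulrA. Qed.
Lemma diff2Nr f x v w : diff2 f x v (- w) = - diff2 f x v w.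
Proof. by rewrite -scaleN1r diff2Zr mulN1r. Qed.

Lemma diff2E f x v w : diff2 f x v w = \sum_i \sum_j v 0 i * pderive j (pderive i f) x * w 0 j.
Proof.
apply: eq_bigr => i _; rewrite diff1E mulr_suml; apply: eq_bigr => j _.
by rewrite mulrAC (mulrC (v 0 i)).
Qed.

Variables (U : set V) (oU : open U).

Lemma diff2C f x v w : smooth_on U f -> U x -> diff2 f x v w = diff2 f x w v.
Proof.
move=> sf Ux; rewrite !diff2E exchange_big /=; apply: eq_bigr => i _.
apply: eq_bigr => j _; rewrite (pderiveC i j oU sf Ux).
by rewrite mulrC (mulrC (v 0 j)) mulrA.
Qed.

Lemma diff3C23 f x u v w : smooth_on U f -> U x -> diff3 f x u v w = diff3 f x u w v.
Proof. by move=> sf Ux; apply: eq_bigr => i _; rewrite diff2C //; exact: smooth_pderive. Qed.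

Lemma diff3C12 f x u v w : smooth_on U f -> U x -> diff3 f x u v w = diff3 f x v u w.
Proof.
move=> sf Ux; rewrite /diff3 /diff2.
under eq_bigr do rewrite mulr_suml.
under [RHS]eq_bigr do rewrite mulr_suml.
rewrite exchange_big /=; apply: eq_bigr => i _; apply: eq_bigr => j _.
have oUx : \forall y \near x, U y by exact: open_nbhs_nbhs.
have E : diff1 (pderive i (pderive j f)) x w = diff1 (pderive j (pderive i f)) x w.
  have E (k : 'I_n) : pderive k (pderive i (pderive j f)) x = pderive k (pderive j (pderive i f)) x.
    apply: near_eq_derive; apply: filterS oUx => y Uy; exact: (pderiveC _ _ oU sf Uy).
  exact: eq_diff1.
apply: etrans (congr1 (fun r => r * v 0 i * u 0 j) E) _; exact: mulrAC.
Qed.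

(** * Derivatives along curves *)

Lemma is_derive_coord (c : R -> V) (t : R) v i :
  is_derive t 1 c v -> is_derive t 1 (fun s => c s 0 i) (v 0 i).
Proof.
move=> [dc <-]; have dci := (derivable_mxP _ _ _).1 dc 0 i.
by split => //; rewrite derive_mx // mxE.
Qed.

Lemma is_derive_row (c : R -> V) (t : R) v :
  (forall i, is_derive t 1 (fun s => c s 0 i) (v 0 i)) -> is_derive t 1 c v.
Proof.
move=> H; have dc : derivable c t 1.
  by apply/derivable_mxP => i j; rewrite (ord1 i); have [] := H j.
split => //; rewrite derive_mx //; apply/rowP => i; rewrite mxE.
by have [_ ->] := H i.
Qed.

Lemma is_derive_comp_curve f (c : R -> V) (t : R) v :
  smooth_on U f -> U (c t) -> is_derive t 1 c v ->
  is_derive t 1 (fun s => f (c s)) (diff1 f (c t) v).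
Proof.
move=> sf Uc [dc <-].
have dc' : differentiable c t by apply/derivable1_diffP.
have df := smooth_differentiable oU sf Uc.
have dfc : differentiable (f \o c) t by exact: differentiable_comp.
split; first exact: diff_derivable.
rewrite (_ : (fun s => f (c s)) = f \o c) // deriveE // diff_comp //=.
by rewrite (smooth_diffE _ oU sf Uc) deriveE.
Qed.

Lemma is_derive_bigsum (W : normedModType R) (I : Type) (r : seq I) (h : I -> W -> R)
    (dh : I -> R) (x v : W) :
  (forall i, is_derive x v (h i) (dh i)) ->
  is_derive x v (fun s => \sum_(i <- r) h i s) (\sum_(i <- r) dh i).
Proof.
move=> H; elim: r => [|i r IH].
  rewrite big_nil (_ : (fun _ => _) = cst 0); first exact: is_derive_cst.
  by apply: funext => s; rewrite big_nil.
rewrite big_cons (_ : (fun _ => _) = (h i + (fun s => \sum_(j <- r) h j s))).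
  exact: is_deriveD.
by apply: funext => s; rewrite big_cons.
Qed.

Lemma is_derive_dotp (c1 c2 : R -> V) (t : R) v1 v2 :
  is_derive t 1 c1 v1 -> is_derive t 1 c2 v2 ->
  is_derive t 1 (fun s => dotp (c1 s) (c2 s)) (dotp v1 (c2 t) + dotp (c1 t) v2).
Proof.
move=> d1 d2; rewrite /dotp -big_split /=; apply: is_derive_bigsum => i.
have D1 := is_derive_coord i d1; have D2 := is_derive_coord i d2.
apply: (@is_derive_eq _ _ _ _ _ _ _ _ (is_deriveM D1 D2)).
by rewrite addrC; congr (_ + _); rewrite [LHS]mulrC.
Qed.

Lemma is_derive_gradient f (c : R -> V) (t : R) v :
  smooth_on U f -> U (c t) -> is_derive t 1 c v ->
  is_derive t 1 (fun s => gradient f (c s)) (\row_i diff1 (pderive i f) (c t) v).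
Proof.
move=> sf Uc dc; apply: is_derive_row => i; rewrite mxE.
rewrite (_ : (fun s => _) = (fun s => pderive i f (c s))).
  by apply: is_derive_comp_curve => //; exact: smooth_pderive.
by apply: funext => s; rewrite mxE.
Qed.

Lemma is_derive_diff1 f (c w : R -> V) (t : R) v w' :
  smooth_on U f -> U (c t) -> is_derive t 1 c v -> is_derive t 1 w w' ->
  is_derive t 1 (fun s => diff1 f (c s) (w s)) (diff2 f (c t) (w t) v + diff1 f (c t) w').
Proof.
move=> sf Uc dc dw.
apply: (@is_derive_eq _ _ _ _ _ _ _ _ (is_derive_dotp (is_derive_gradient sf Uc dc) dw)).
by congr (_ + _); apply: eq_bigr => i _; rewrite mxE.
Qed.

Lemma is_derive_diff2 f (c w z : R -> V) (t : R) v w' z' :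
  smooth_on U f -> U (c t) -> is_derive t 1 c v -> is_derive t 1 w w' ->
  is_derive t 1 z z' ->
  is_derive t 1 (fun s => diff2 f (c s) (w s) (z s))
    (diff3 f (c t) (w t) (z t) v + diff2 f (c t) w' (z t) + diff2 f (c t) (w t) z').
Proof.
move=> sf Uc dc dw dz; rewrite /diff2 /diff3 -!big_split /=.
apply: is_derive_bigsum => i.
have D1 := is_derive_diff1 (smooth_pderive i sf) Uc dc dz.
have D2 := is_derive_coord i dw.
apply: (@is_derive_eq _ _ _ _ _ _ _ _ (is_deriveM D1 D2)).
rewrite /GRing.scale /=; ring.
Qed.

End Multilinear.

(** * Great circles and the distance to a subset of the sphere *)

Section SphericalGeometry.
Variables (R : realType) (n : nat).
Local Notation V := 'rV[R]_n.
Implicit Types (x y u v w a b : V) (A : set V) (s t r : R).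

Definition arc a b t : V := cos t *: a + sin t *: b.

Definition ortho2 a b := [/\ dotp a a = 1, dotp b b = 1 & dotp a b = 0].

Lemma dotp_arc a b s t : ortho2 a b -> dotp (arc a b s) (arc a b t) = cos (s - t).
Proof.
case=> aa bb ab; rewrite /arc !(dotpDl, dotpDr, dotpZl, dotpZr) (dotpC b) aa bb ab cosB.
ring.
Qed.

Lemma ortho2_rot a b : ortho2 a b -> ortho2 b (- a).
Proof. by case=> aa bb ab; split; rewrite ?dotpNl ?dotpNr ?opprK // dotpC ab oppr0. Qed.

Lemma ortho2_arc a b t : ortho2 a b -> ortho2 (arc a b t) (arc b (- a) t).
Proof.
move=> ab; split; rewrite ?dotp_arc ?subrr ?cos0 //; first exact: ortho2_rot.
case: ab => aa bb ab.
rewrite /arc !(dotpDl, dotpDr, dotpZl, dotpZr, dotpNr) (dotpC b) aa bb ab; ring.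
Qed.

Lemma arcD a b s t : arc (arc a b s) (arc b (- a) s) t = arc a b (s + t).
Proof.
apply/rowP => i; rewrite /arc !mxE cosD sinD; ring.
Qed.

Lemma arcN a b t : arc (- a) (- b) t = - arc a b t.
Proof. by rewrite /arc !scalerN opprD. Qed.

Lemma arcD_tangent a b s t :
  arc (arc b (- a) s) (- arc a b s) t = arc b (- a) (s + t).
Proof. by rewrite -arcD arcN. Qed.

Lemma arc0 a b : arc a b 0 = a.
Proof. by rewrite /arc cos0 sin0 scale1r scale0r addr0. Qed.

Lemma is_derive_arc a b t : is_derive t 1 (arc a b) (arc b (- a) t).
Proof.
apply: is_derive_row => i.
rewrite (_ : (fun s => _) = (fun s => cos s * a 0 i + sin s * b 0 i)); last first.
  by apply: funext => s; rewrite !mxE.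
have D1 := is_deriveM (is_derive_cos t) (is_derive_cst (a 0 i) t (1 : R)).
have D2 := is_deriveM (is_derive_sin t) (is_derive_cst (b 0 i) t (1 : R)).
apply: (@is_derive_eq _ _ _ _ _ _ _ _ (is_deriveD D1 D2)).
rewrite /arc !mxE /GRing.scale /= /cst; ring.
Qed.

Lemma cauchy_schwarz u v : dotp u v ^+ 2 <= dotp u u * dotp v v.
Proof.
have [->|v0] := eqVneq v 0.
  by rewrite -(scale0r u) !dotpZr !mul0r mulr0 expr0n.
have vv := dotp_gt0 v0.
have := dotp_ge0 (dotp v v *: u - dotp u v *: v).
rewrite !(dotpBl, dotpBr, dotpZl, dotpZr) (dotpC v u).
rewrite (_ : _ - _ = dotp v v * (dotp u u * dotp v v - dotp u v ^+ 2)); last ring.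
by rewrite pmulr_rge0 // subr_ge0.
Qed.

Lemma usphere_neq0 x : usphere x -> x != 0.
Proof. by rewrite /usphere /= => xx; rewrite -dotp_eq0 xx oner_neq0. Qed.

Lemma dotp_usphere x y : usphere x -> usphere y -> -1 <= dotp x y <= 1.
Proof.
rewrite /usphere /= => xx yy; have := cauchy_schwarz x y.
by rewrite xx yy mulr1 => H; rewrite -ler_norml -(@ler_pXn2r _ 2%N) ?nnegrE // expr1n real_normK ?num_real.
Qed.

Lemma sphere_distC x y : sphere_dist x y = sphere_dist y x.
Proof. by rewrite /sphere_dist dotpC. Qed.

Lemma cos_sphere_dist x y : usphere x -> usphere y -> cos (sphere_dist x y) = dotp x y.
Proof. by move=> xx yy; rewrite acosK // in_itv /= dotp_usphere. Qed.

Lemma sphere_dist_bounds x y : usphere x -> usphere y -> 0 <= sphere_dist x y <= pi.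
Proof. by move=> xx yy; rewrite acos_ge0 ?acos_lepi // dotp_usphere. Qed.

Lemma le_cosE s t : 0 <= s <= pi -> 0 <= t <= pi -> (cos s <= cos t) = (t <= s).
Proof.
move=> s1 t1; rewrite !leNgt ltr_cos //.
Qed.

(** Cauchy-Schwarz for the components of [x] and [z] orthogonal to [y], whose
    lengths are the sines of the two distances. *)
Lemma sphere_dist_triangle x y z : usphere x -> usphere y -> usphere z ->
  sphere_dist x z <= sphere_dist x y + sphere_dist y z.
Proof.
move=> xx yy zz.
have a1 := sphere_dist_bounds xx yy; have b1 := sphere_dist_bounds yy zz.
have c1 := sphere_dist_bounds xx zz.
set al := sphere_dist x y in a1 *; set be := sphere_dist y z in b1 *.
have [abpi|abpi] := leP (al + be) pi; last first.
  by case/andP: c1 => _ c1; apply: le_trans c1 (ltW abpi).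
rewrite -le_cosE //; last by rewrite abpi andbT addr_ge0; [|case/andP: a1|case/andP: b1].
rewrite cos_sphere_dist // cosD.
have ca : cos al = dotp x y by rewrite cos_sphere_dist.
have cb : cos be = dotp y z by rewrite cos_sphere_dist.
have sa : 0 <= sin al by rewrite sin_ge0_pi.
have sb : 0 <= sin be by rewrite sin_ge0_pi.
have := cauchy_schwarz (x - cos al *: y) (z - cos be *: y).
have E1 : dotp (x - cos al *: y) (x - cos al *: y) = sin al ^+ 2.
  rewrite !(dotpBl, dotpBr, dotpZl, dotpZr) (dotpC y x) -ca xx yy sin2cos2; ring.
have E2 : dotp (z - cos be *: y) (z - cos be *: y) = sin be ^+ 2.
  rewrite !(dotpBl, dotpBr, dotpZl, dotpZr) (dotpC z y) -cb zz yy sin2cos2; ring.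
have E3 : dotp (x - cos al *: y) (z - cos be *: y) = dotp x z - cos al * cos be.
  rewrite !(dotpBl, dotpBr, dotpZl, dotpZr) -cb -ca yy; ring.
rewrite E1 E2 E3 -exprMn => H.
have : `|dotp x z - cos al * cos be| <= sin al * sin be.
  by rewrite -(@ler_pXn2r _ 2%N) ?nnegrE ?mulr_ge0 // real_normK ?num_real.
by rewrite ler_norml => /andP[+ _]; rewrite lerBrDl.
Qed.

Lemma exists_unit_orthogonal x : (1 < n)%N -> usphere x -> exists b, ortho2 x b.
Proof.
move=> n1 xx.
have [i [j ij]] : exists i j : 'I_n, i != j.
  by exists (Ordinal (ltnW n1)), (Ordinal n1).
have [v v0 xv] : exists2 v, v != 0 & dotp x v = 0.
  have [xi|xi] := eqVneq (x 0 i) 0.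
    exists (delta_mx 0 i).
      by apply/eqP => /rowP/(_ i)/eqP; rewrite !mxE !eqxx oner_eq0.
    by apply: big1 => k _; rewrite mxE eqxx /=; case: eqP => [->|_]; rewrite ?xi ?mul0r ?mulr0.
  exists (x 0 j *: delta_mx 0 i - x 0 i *: delta_mx 0 j).
    apply/eqP => /rowP/(_ j)/eqP; rewrite !mxE !eqxx /= [j == i]eq_sym (negbTE ij) mulr0 mulr1 sub0r.
    by rewrite oppr_eq0 (negbTE xi).
  have D k : dotp x (delta_mx 0 k) = x 0 k.
    rewrite /dotp (bigD1 k) //= mxE !eqxx mulr1 big1 ?addr0 // => l lk.
    by rewrite mxE (negbTE lk) andbF mulr0.
  by rewrite dotpBr !dotpZr !D mulrC subrr.
exists ((Num.sqrt (dotp v v))^-1 *: v); split => //; first exact: dotp_normalize.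
by rewrite dotpZr xv mulr0.
Qed.

Lemma exists_arc x y t : (1 < n)%N -> usphere x -> usphere y -> 0 < t <= pi ->
  dotp x y = cos t -> exists2 b, ortho2 x b & arc x b t = y.
Proof.
move=> n1 xx yy /andP[t0]; rewrite le_eqVlt => /orP[/eqP ->|tpi].
  (* antipodal points are joined by every great half-circle from [x] *)
  rewrite cospi => xy; have [b xb] := exists_unit_orthogonal n1 xx; exists b => //.
  rewrite /arc cospi sinpi scale0r addr0 scaleN1r.
  apply/eqP; rewrite -subr_eq0 -dotp_eq0 !(dotpBl, dotpBr, dotpNl, dotpNr) xx yy (dotpC y) xy.
  by apply/eqP; ring.
move=> xy; have st : sin t != 0 by rewrite gt_eqF // sin_gt0_pi // t0.
exists ((sin t)^-1 *: (y - cos t *: x)).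
  split => //.
    rewrite dotpZl dotpZr !(dotpBl, dotpBr, dotpZl, dotpZr) xx yy (dotpC y) xy mulrA -expr2.
    rewrite (_ : _ - _ = sin t ^+ 2); last by rewrite sin2cos2; ring.
    by rewrite -exprMn mulVf // expr1n.
  by rewrite dotpZr dotpBr dotpZr xx xy mulr1 subrr mulr0.
by rewrite /arc scalerA divff // scale1r addrC subrK.
Qed.

Lemma sphere_dist_arc a b s t : ortho2 a b -> 0 <= t - s <= pi ->
  sphere_dist (arc a b s) (arc a b t) = t - s.
Proof.
move=> ab st; rewrite sphere_distC /sphere_dist dotp_arc //.
by rewrite cosK.
Qed.

Section DistanceToSet.
Variables (A : set V) (A0 : A !=set0) (AS : A `<=` @usphere R n) (cA : compact A).

Lemma sphere_dist_to_attained x : usphere x ->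
  exists2 w, A w & sphere_dist_to A x = sphere_dist x w /\
    forall v, A v -> sphere_dist x w <= sphere_dist x v.
Proof.
move=> xx.
have [|w /set_mem Aw wmax] := @EVT_max_rV R n (dotp x) A A0 cA.
  exact/continuous_subspaceT/dotp_continuous.
have wmin v : A v -> sphere_dist x w <= sphere_dist x v.
  move=> Av; rewrite -le_cosE ?sphere_dist_bounds ?cos_sphere_dist //; try exact: AS.
  by apply: wmax; exact: mem_set.
exists w => //; split => //.
apply/eqP; rewrite eq_le; apply/andP; split.
  apply: ge_inf; last by exists w.
  by exists 0 => _ [v Av <-]; case/andP: (sphere_dist_bounds xx (AS Av)).
by apply: lb_le_inf; [exists (sphere_dist x w), w|move=> _ [v Av <-]; exact: wmin].
Qed.

Lemma sphere_dist_to_lip x y : usphere x -> usphere y ->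
  sphere_dist_to A x <= sphere_dist x y + sphere_dist_to A y.
Proof.
move=> xx yy.
have [w Aw [-> wm]] := sphere_dist_to_attained xx.
have [v Av [-> _]] := sphere_dist_to_attained yy.
by apply: le_trans (wm _ Av) _; apply: sphere_dist_triangle => //; exact: AS.
Qed.

(** The arc starts at a point of [A] nearest to [x].  If its point at time [s] were
    closer to [A] than [s], the triangle inequality would bring [x] closer too. *)
Lemma sphere_dist_to_arc x : (1 < n)%N -> usphere x -> 0 < sphere_dist_to A x ->
  exists a b, [/\ ortho2 a b, A a, arc a b (sphere_dist_to A x) = x &
    forall s, 0 <= s <= sphere_dist_to A x -> sphere_dist_to A (arc a b s) = s].
Proof.
move=> n1 xx t0.
have [w Aw [tE wm]] := sphere_dist_to_attained xx.
have wS := AS Aw; set t := sphere_dist_to A x in t0 tE *.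
have tpi : t <= pi by rewrite tE; case/andP: (sphere_dist_bounds xx wS).
have [||b wb xE] := @exists_arc w x t n1 wS xx.
- by rewrite t0.
- by rewrite tE cos_sphere_dist // dotpC.
exists w, b; split => // s /andP[s0 st].
have aS r : usphere (arc w b r) by have [] := ortho2_arc r wb.
apply/eqP; rewrite eq_le; apply/andP; split.
  have [v Av [-> vm]] := sphere_dist_to_attained (aS s).
  apply: le_trans (vm _ Aw) _.
  rewrite sphere_distC -{1}(arc0 w b) sphere_dist_arc ?subr0 //.
  by rewrite s0 (le_trans st).
have := sphere_dist_to_lip xx (aS s); rewrite -/t -{1}xE sphere_distC sphere_dist_arc //.
  by rewrite -lerBlDl opprB addrC subrK.
by rewrite subr_ge0 st lerBlDr (le_trans tpi) // lerDl.
Qed.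

End DistanceToSet.

Lemma usphere_bounded x : usphere x -> forall i, -1 <= x 0 i <= 1.
Proof.
rewrite /usphere /= => xx i; rewrite -ler_norml -(@ler_pXn2r _ 2%N) ?nnegrE //.
rewrite expr1n real_normK ?num_real // -xx /dotp (bigD1 i) //= expr2 lerDl.
by apply: sumr_ge0 => j _; rewrite -expr2 sqr_ge0.
Qed.

Lemma dotp_self_continuous : continuous (fun x : V => dotp x x).
Proof.
apply: (@continuous_big _ _ _ _ _ _ V) => [|i _ v]; first exact: add_continuous.
by apply: (@continuousM _ _ (fun v : V => v 0 i) (fun v : V => v 0 i)); exact: coord_continuous.
Qed.

Lemma compact_level_set (p : V -> R) r : continuous p -> compact (level_set p r).
Proof.
move=> cp.
have cB : compact [set v : V | forall i, `[-1, 1]%classic (v 0 i)].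
  by apply: (@rV_compact R n (fun=> `[-1, 1]%classic)) => i; exact: segment_compact.
apply: subclosed_compact cB _.
  rewrite (_ : level_set p r = (fun x => dotp x x) @^-1` [set 1] `&` p @^-1` [set r]) //.
  by apply: closedI; apply: preimage_closed; try exact: closed_eq;
    move=> x _; [exact: dotp_self_continuous|exact: cp].
by move=> x [xx _] i /=; rewrite in_itv /=; exact: usphere_bounded.
Qed.

End SphericalGeometry.

(** * Polynomial functions *)

Section Polynomials.
Variables (R : realType) (n : nat).
Local Notation V := 'rV[R]_n.
Local Notation e_ i := (delta_mx 0 i : V).
Implicit Types (p f g : V -> R) (x y v w e : V).

(** Given by closure properties, so that derivatives and restrictions to lines are
    handled by induction. *)
Inductive polyfun : (V -> R) -> Prop :=
| polyfun_cst (c : R) : polyfun (fun=> c)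
| polyfun_coord (i : 'I_n) : polyfun (fun x => x 0 i)
| polyfunD f g : polyfun f -> polyfun g -> polyfun (fun x => f x + g x)
| polyfunM f g : polyfun f -> polyfun g -> polyfun (fun x => f x * g x).

Lemma pderive_coord (i j : 'I_n) x : is_derive x (e_ i) (fun x : V => x 0 j) ((j == i)%:R).
Proof.
have dc := differentiable_coord x 0 j.
split; first exact: diff_derivable.
rewrite /derive; apply: cvg_lim => //.
apply: (@cvg_trans _ (cst ((j == i)%:R : R) @ 0^')); last exact: cvg_cst.
apply: near_eq_cvg; near=> h.
rewrite /cst /= !mxE eqxx /= addrK /GRing.scale /= mulrA mulVf ?mul1r //.
by near: h; exact: nbhs_dnbhs_neq.
Unshelve. all: by end_near. Qed.

Lemma polyfun_derivable f : polyfun f -> forall i x, derivable f x (e_ i).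
Proof.
elim=> [c|j|g h _ IHg _ IHh|g h _ IHg _ IHh] i x.
- exact: derivable_cst.
- by have [] := pderive_coord i j x.
- exact: derivableD.
- exact: derivableM.
Qed.

Lemma polyfun_pderive f i : polyfun f -> polyfun (pderive i f).
Proof.
elim=> [c|j|g h pg IHg ph IHh|g h pg IHg ph IHh].
- rewrite (_ : pderive _ _ = fun=> 0); first exact: polyfun_cst.
  by apply: funext => x; exact: derive_cst.
- rewrite (_ : pderive _ _ = fun=> (j == i)%:R); first exact: polyfun_cst.
  by apply: funext => x; have [] := pderive_coord i j x.
- rewrite (_ : pderive _ _ = fun x => pderive i g x + pderive i h x); first exact: polyfunD.
  by apply: funext => x; apply: deriveD; exact: polyfun_derivable.
- rewrite (_ : pderive _ _ = fun x => g x * pderive i h x + h x * pderive i g x).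
    by apply: polyfunD; exact: polyfunM.
  by apply: funext => x; apply: deriveM; exact: polyfun_derivable.
Qed.

Lemma polyfun_continuous f : polyfun f -> continuous f.
Proof.
elim=> [c|j|g h _ IHg _ IHh|g h _ IHg _ IHh] x.
- exact: cst_continuous.
- exact: coord_continuous.
- by apply: continuousD; [exact: IHg|exact: IHh].
- by apply: continuousM; [exact: IHg|exact: IHh].
Qed.

Lemma polyfun_smooth f U : polyfun f -> smooth_on U f.
Proof.
move=> + k; elim: k f => [|k IH] f pf; split => //.
1,2: by move=> x _; exact: polyfun_continuous.
move=> i; split; first by move=> x _; exact: polyfun_derivable.
exact/IH/polyfun_pderive.
Qed.

Lemma polyfun_sum (I : Type) (r : seq I) (F : I -> V -> R) :
  (forall i, polyfun (F i)) -> polyfun (fun x => \sum_(i <- r) F i x).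
Proof.
move=> pF; elim: r => [|i r IH].
  rewrite (_ : (fun _ => _) = fun=> 0); first exact: polyfun_cst.
  by apply: funext => x; rewrite big_nil.
rewrite (_ : (fun _ => _) = fun x => F i x + \sum_(i <- r) F i x); first exact: polyfunD.
by apply: funext => x; rewrite big_cons.
Qed.

Lemma polyfun_prod (I : Type) (r : seq I) (F : I -> V -> R) :
  (forall i, polyfun (F i)) -> polyfun (fun x => \prod_(i <- r) F i x).
Proof.
move=> pF; elim: r => [|i r IH].
  rewrite (_ : (fun _ => _) = fun=> 1); first exact: polyfun_cst.
  by apply: funext => x; rewrite big_nil.
rewrite (_ : (fun _ => _) = fun x => F i x * \prod_(i <- r) F i x); first exact: polyfunM.
by apply: funext => x; rewrite big_cons.
Qed.

Lemma polyfunX f k : polyfun f -> polyfun (fun x => f x ^+ k).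
Proof.
move=> pf; elim: k => [|k IH].
  by rewrite (_ : (fun _ => _) = fun=> 1); [exact: polyfun_cst|apply: funext => x; rewrite expr0].
rewrite (_ : (fun _ => _) = fun x => f x * f x ^+ k); first exact: polyfunM.
by apply: funext => x; rewrite exprS.
Qed.

Lemma polyfun_line f x y : polyfun f ->
  exists q : {poly R}, forall z, f (z *: x + y) = q.[z].
Proof.
elim=> [c|j|g h _ [q1 E1] _ [q2 E2]|g h _ [q1 E1] _ [q2 E2]].
- by exists c%:P => z; rewrite hornerC.
- exists (x 0 j *: 'X + (y 0 j)%:P) => z.
  by rewrite !mxE hornerD hornerZ hornerX hornerC mulrC.
- by exists (q1 + q2) => z; rewrite hornerD E1 E2.
- by exists (q1 * q2) => z; rewrite hornerM E1 E2.
Qed.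

Lemma homogeneous_polyfun d p : homogeneous_poly d p -> polyfun p.
Proof.
case=> P [_ pE].
rewrite (_ : p = fun x => \sum_(m <- mpoly.msupp P) (mpoly.mcoeff m P * \prod_(i < n) x 0 i ^+ m i)).
  apply: polyfun_sum => m; apply: polyfunM; first exact: polyfun_cst.
  by apply: polyfun_prod => i; apply: polyfunX; exact: polyfun_coord.
by apply: funext => x; rewrite pE mpoly.mevalE.
Qed.

Lemma homogeneous_polyZ d p (k : R) x : homogeneous_poly d p -> p (k *: x) = k ^+ d * p x.
Proof.
case=> P [hP pE]; rewrite !pE !mpoly.mevalE mulr_sumr !big_seq; apply: eq_bigr => m mP.
have md : mpoly.mdeg m = d by move: hP => /mpoly.dhomogP /(_ m mP).
rewrite mulrCA; congr (_ * _); under eq_bigr do rewrite mxE exprMn.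
by rewrite big_split /= prodrXr -mpoly.mdegE md.
Qed.

Lemma size_prod_line x y (I : eqType) (r : seq I) (h : I -> 'I_n) (k : I -> nat) :
  (size (\prod_(i <- r) (x 0 (h i) *: 'X + (y 0 (h i))%:P) ^+ k i)%R <= (\sum_(i <- r) k i).+1)%N.
Proof.
elim: r => [|i r IH]; first by rewrite !big_nil size_poly1.
rewrite !big_cons; apply: leq_trans (size_polyMleq _ _) _.
have H : (size ((x 0 (h i) *: 'X + (y 0 (h i))%:P) ^+ k i)%R <= (k i).+1)%N.
  apply: leq_trans (size_poly_exp_leq _ _) _; rewrite ltnS -[leqRHS]mul1n leq_mul2r.
  apply/orP; right; rewrite -subn1 leq_subLR.
  apply: leq_trans (size_polyD _ _) _; rewrite geq_max.
  rewrite (leq_trans (size_scale_leq _ _)) ?size_polyX //=.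
  by rewrite (leq_trans (size_polyC_leq1 _)).
by rewrite -subn1 leq_subLR add1n -addSn -addnS leq_add.
Qed.

Lemma homogeneous_poly_line d p x y : homogeneous_poly d p ->
  exists2 q : {poly R}, (size q <= d.+1)%N & forall z, p (z *: x + y) = q.[z].
Proof.
case=> P [hP pE].
exists (\sum_(m <- mpoly.msupp P) (mpoly.mcoeff m P *: \prod_(i < n) (x 0 i *: 'X + (y 0 i)%:P) ^+ m i)).
  apply: (leq_trans (size_sum _ _ _)); rewrite big_seq; apply/bigmax_leqP_seq => m mP _.
  have md : mpoly.mdeg m = d by move: hP => /mpoly.dhomogP /(_ m mP).
  apply: leq_trans (size_scale_leq _ _) _.
  by rewrite -md mpoly.mdegE; exact: size_prod_line.
move=> z; rewrite pE mpoly.mevalE horner_sum; apply: eq_bigr => m _.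
rewrite hornerZ horner_prod; congr (_ * _); apply: eq_bigr => i _.
by rewrite horner_exp !mxE hornerD hornerZ hornerX hornerC mulrC.
Qed.

Lemma diff2_line d p x y e : homogeneous_poly d p ->
  exists q : {poly R}, forall z, diff2 p (z *: x + y) e e = q.[z].
Proof.
move=> hp; have pp := homogeneous_polyfun hp.
have : polyfun (fun w => diff2 p w e e).
  rewrite (_ : (fun _ => _) = fun w => \sum_i (\sum_j pderive j (pderive i p) w * e 0 j) * e 0 i).
    apply: polyfun_sum => i; apply: polyfunM; last exact: polyfun_cst.
    apply: polyfun_sum => j; apply: polyfunM; last exact: polyfun_cst.
    by do 2![apply: polyfun_pderive].
  by apply: funext => w; apply: eq_bigr => i _; rewrite diff1E.
exact: polyfun_line.
Qed.

End Polynomials.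

(** * Comparing derivatives of functions of one variable *)

Section RealDerivatives.
Variable R : realType.
Implicit Types (g h : R -> R) (s t l : R).

Lemma is_derive_bound g t l (e : R) : is_derive t 1 g l -> 0 < e ->
  exists2 r : R, 0 < r & forall s, `|s| < r -> `|g (t + s) - g t - l * s| <= e * `|s|.
Proof.
move=> [dg gl] e0.
have /cvgrPdist_le /(_ _ e0) : (fun s => s^-1 *: (g (s *: (1 : R) + t) - g t)) @ 0^' --> l.
  by rewrite -gl; exact: dg.
move=> /nbhs_ballP [r /= r0 br]; exists r => // s sr.
have [->|s0] := eqVneq s 0; first by rewrite addr0 subrr sub0r mulr0 oppr0 normr0 mulr0.
have := br s; rewrite /ball /= sub0r normrN => /(_ sr s0).
rewrite (_ : s *: (1 : R) = s); last exact: mulr1.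
rewrite /GRing.scale /= => H.
rewrite (_ : _ - _ = - (s * (l - s^-1 * (g (s + t) - g t)))).
  by rewrite normrN normrM mulrC ler_wpM2r.
by rewrite mulrBr mulrA divff // mul1r opprB (addrC s) (mulrC s).
Qed.

Lemma is_derive_unique g t l1 l2 : is_derive t 1 g l1 -> is_derive t 1 g l2 -> l1 = l2.
Proof. by move=> [_ <-] [_ <-]. Qed.

Lemma near_is_derive_eq g h t l1 l2 : is_derive t 1 g l1 -> is_derive t 1 h l2 ->
  (\forall s \near t, g s = h s) -> l1 = l2.
Proof.
move=> dg dh gh; apply: is_derive_unique dh.
exact: near_eq_is_derive gh dg.
Qed.

(** Only a one-sided comparison is available at the end of a minimizing arc. *)
Lemma left_eq_derive g h t l1 l2 : is_derive t 1 g l1 -> is_derive t 1 h l2 ->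
  (exists2 r : R, 0 < r & forall s, t - r <= s <= t -> g s = h s) -> l1 = l2.
Proof.
move=> dg dh [r r0 gh]; apply/eqP; rewrite -subr_eq0 -normr_le0.
apply/ler_addgt0Pl => e e0; rewrite addr0.
have e2 : 0 < e / 2 by rewrite divr_gt0.
have [r1 r10 H1] := is_derive_bound dg e2.
have [r2 r20 H2] := is_derive_bound dh e2.
pose m := Num.min r (Num.min r1 r2).
have m0 : 0 < m by rewrite !lt_min r0 r10.
pose s := m / 2; have s0 : 0 < s by rewrite divr_gt0.
have sm : s < m by rewrite /s; lra.
have [sr [s1 s2]] : s < r /\ s < r1 /\ s < r2.
  by move: sm; rewrite !lt_min => /and3P[].
have sN : `|- s| = s by rewrite normrN gtr0_norm.
have := H1 (- s); rewrite sN => /(_ s1) B1.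
have := H2 (- s); rewrite sN => /(_ s2) B2.
have E1 : g (t - s) = h (t - s) by apply: gh; rewrite gerBl lerD2l lerN2 !ltW.
have E2 : g t = h t by apply: gh; rewrite lexx gerBl ltW.
rewrite -E1 -E2 in B2.
rewrite -(@ler_pM2r _ s) // -[X in _ * X](gtr0_norm s0) -normrM.
rewrite (_ : (l1 - l2) * s = (g (t - s) - g t - l2 * - s) * -1 + (g (t - s) - g t - l1 * - s)); last ring.
apply: le_trans (ler_normD _ _) _; rewrite normrM normrN1 mulr1.
by rewrite [e]splitr mulrDl lerD.
Qed.

(** The chain rule as an inequality: the inner function [th] is 1-Lipschitz at [0]
    but need not be differentiable. *)
Lemma derive_comp_lip (g h th : R -> R) t l1 l2 : is_derive (0 : R) 1 g l1 -> is_derive t 1 h l2 ->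
  (exists2 r : R, 0 < r & forall s, `|s| < r -> g s = h (th s) /\ `|th s - t| <= `|s|) ->
  `|l1| <= `|l2|.
Proof.
move=> dg dh [r r0 gh].
apply/ler_addgt0Pr => e e0.
have e2 : 0 < e / 2 by rewrite divr_gt0.
have [r1 r10 H1] := is_derive_bound dg e2.
have [r2 r20 H2] := is_derive_bound dh e2.
pose m := Num.min r (Num.min r1 r2).
have m0 : 0 < m by rewrite !lt_min r0 r10.
pose s := m / 2; have s0 : 0 < s by rewrite divr_gt0.
have sm : s < m by rewrite /s; lra.
have [sr [s1 s2]] : s < r /\ s < r1 /\ s < r2.
  by move: sm; rewrite !lt_min => /and3P[].
have sN : `|s| = s by rewrite gtr0_norm.
have := H1 s; rewrite sN add0r => /(_ s1) B1.
have [g0 th0] : g 0 = h (th 0) /\ `|th 0 - t| <= `|0 : R| by apply: gh; rewrite normr0.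
have {}th0 : th 0 = t by apply/eqP; rewrite -subr_eq0 -normr_le0 (le_trans th0) // normr0.
rewrite th0 in g0.
have [gs ths] : g s = h (th s) /\ `|th s - t| <= `|s| by apply: gh; rewrite sN.
rewrite sN in ths.
have := H2 (th s - t) (le_lt_trans ths s2); rewrite [t + _]addrC subrK => B2.
rewrite -gs -g0 in B2.
rewrite -(@ler_pM2r _ s) // -[X in _ * X <= _]sN -normrM.
rewrite (_ : l1 * s = - (g s - g 0 - l1 * s)
  + ((g s - g 0 - l2 * (th s - t)) + l2 * (th s - t))); last ring.
apply: le_trans (ler_normD _ _) _; rewrite normrN.
have B3 : `|(g s - g 0 - l2 * (th s - t)) + l2 * (th s - t)| <= e / 2 * s + `|l2| * s.
  apply: le_trans (ler_normD _ _) _; apply: lerD.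
    by apply: le_trans B2 _; rewrite ler_wpM2l // ltW.
  by rewrite normrM ler_wpM2l.
apply: le_trans (lerD B1 B3) _.
by rewrite le_eqVlt; apply/orP; left; apply/eqP; field.
Qed.

Lemma near_between (a b t : R) : a < t < b -> \forall s \near t, a < s < b.
Proof.
move=> tab; have tab' : t \in `]a, b[ by rewrite in_itv.
by apply: filterS (near_in_itvoo tab') => s; rewrite in_itv.
Qed.

End RealDerivatives.

(** * Functions of the distance to a focal set *)

Section Transnormal.
Variables (R : realType) (n : nat).
Local Notation V := 'rV[R]_n.
Implicit Types (x y u v w a b e : V) (s t r k : R).

(** The distance [tau] to a focal set, reduced to what the proof uses of it. *)
Record distance_like (tau : V -> R) (L : R) : Prop := DistanceLike {
  dl_gt0 : 0 < L;
  dl_lepi : L <= pi;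
  dl_range : forall x, usphere x -> 0 <= tau x <= L;
  dl_lip : forall x y, usphere x -> usphere y -> tau x <= sphere_dist x y + tau y;
  dl_arc : forall x, usphere x -> 0 < tau x -> exists a b,
    [/\ ortho2 a b, arc a b (tau x) = x & forall s, 0 <= s <= tau x -> tau (arc a b s) = s]
}.

Definition minimal_arc (tau : V -> R) a b t :=
  ortho2 a b /\ forall s, 0 <= s <= t -> tau (arc a b s) = s.

Variables (tau : V -> R) (L : R) (dl : distance_like tau L).
Variables (a0 b0 : V) (m0 : minimal_arc tau a0 b0 L).

Lemma arc_usphere a b t : ortho2 a b -> usphere (arc a b t).
Proof. by move=> /(ortho2_arc t) []. Qed.

Lemma tau_lip_abs x y : usphere x -> usphere y -> `|tau x - tau y| <= sphere_dist x y.
Proof.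
move=> xx yy; rewrite ler_norml lerBlDr (dl_lip dl) // andbT lerBrDl lerBlDr.
by rewrite addrC sphere_distC (dl_lip dl).
Qed.

Lemma sphere_dist_arc_abs a b t : ortho2 a b -> `|t| <= pi -> sphere_dist a (arc a b t) = `|t|.
Proof.
move=> ab tp; rewrite /sphere_dist -{1}(arc0 a b) dotp_arc // sub0r cosN -cos_norm cosK //.
by rewrite in_itv /= normr_ge0.
Qed.

Lemma tau_arc_near x v r : ortho2 x v -> `|r| <= pi -> `|tau (arc x v r) - tau x| <= `|r|.
Proof.
move=> xv rp; have [xx _ _] := xv.
rewrite -(sphere_dist_arc_abs xv rp) distrC; apply: tau_lip_abs => //.
exact: arc_usphere.
Qed.

Section TauFunction.
Variables (U : set V) (oU : open U) (SU : @usphere R n `<=` U).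
Variables (f : V -> R) (sf : smooth_on U f).
Variable ftau : forall x y, usphere x -> usphere y -> tau x = tau y -> f x = f y.

Lemma is_derive_along_arc a b t : ortho2 a b ->
  is_derive t 1 (fun s => f (arc a b s)) (diff1 f (arc a b t) (arc b (- a) t)).
Proof.
move=> ab; apply: (is_derive_comp_curve oU sf); last exact: is_derive_arc.
by apply: SU; exact: arc_usphere.
Qed.

Let df t := diff1 f (arc a0 b0 t) (arc b0 (- a0) t).

(** First variation: the distance grows at unit speed along a minimizing arc and
    is 1-Lipschitz, so a function of it varies in no other tangent direction.
    The arc may be any minimizing one; the rate is that of the reference arc. *)
Lemma diff1_tangent a b t v : minimal_arc tau a b t -> 0 < t -> t < L ->
  dotp v (arc a b t) = 0 -> diff1 f (arc a b t) v = df t * dotp (arc b (- a) t) v.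
Proof.
move=> [ab mab] t0 tL vx.
have ab0 := m0.1.
set x := arc a b t in vx *; set nu := arc b (- a) t.
have [xx nn xn] : ortho2 x nu by exact: ortho2_arc.
have tx : tau x = t by rewrite mab // lexx ltW.
have Enu : diff1 f x nu = df t.
  apply: left_eq_derive (is_derive_along_arc t ab) (is_derive_along_arc t ab0) _.
  exists t => // s; rewrite subrr => /andP[s0 st].
  apply: ftau; try exact: arc_usphere.
  by rewrite mab ?s0 // m0.2 // s0 (le_trans st) // ltW.
have bound w : dotp w w = 1 -> dotp x w = 0 -> `|diff1 f x w| <= `|df t|.
  move=> ww xw; have xw2 : ortho2 x w by [].
  have D := is_derive_along_arc 0 xw2; rewrite !arc0 in D.
  apply: (derive_comp_lip (th := fun s => tau (arc x w s)) D (is_derive_along_arc t ab0)).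
  exists pi; first exact: pi_gt0.
  move=> s /ltW sp; split; last by rewrite -[X in _ - X]tx tau_arc_near.
  have xS := arc_usphere s xw2; have /andP[tl tu] := dl_range dl xS.
  apply: ftau => //; first exact: arc_usphere.
  by rewrite m0.2 // tl.
pose w := gradient f x - dotp (gradient f x) x *: x.
have wx : dotp w x = 0 by rewrite dotpBl dotpZl xx mulr1 subrr.
have wE u : dotp u x = 0 -> diff1 f x u = dotp w u.
  by move=> ux; rewrite dotpBl dotpZl (dotpC x) ux mulr0 subr0.
have wnu : dotp w nu = df t by rewrite -wE // dotpC.
(* the derivative of [f] in the direction of its own tangential gradient *)
have ww : dotp w w <= df t ^+ 2.
  have [->|w0] := eqVneq w 0; first by rewrite -(scale0r x) dotpZl mul0r sqr_ge0.
  have wpos := dotp_gt0 w0; set m := dotp w w in wpos *.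
  have sm0 : Num.sqrt m != 0 by rewrite gt_eqF ?sqrtr_gt0.
  have := bound ((Num.sqrt m)^-1 *: w).
  rewrite dotpZl !dotpZr -/m (dotpC x) wx mulr0 diff1Z wE // -/m.
  have ms : m = Num.sqrt m * Num.sqrt m by rewrite -expr2 sqr_sqrtr // ltW.
  have im : (Num.sqrt m)^-1 * m = Num.sqrt m by rewrite [X in _ * X]ms mulKf.
  rewrite !im mulVf // => /(_ erefl erefl).
  rewrite ger0_norm ?sqrtr_ge0 // => H.
  by rewrite ms -expr2 -[leRHS]real_normK ?num_real // ler_pXn2r ?nnegrE ?sqrtr_ge0.
move: w wx wE wnu ww => w wx wE wnu ww.
(* a vector no longer than its component along the unit vector [nu] *)
have w_eq : w = df t *: nu.
  apply/eqP; rewrite -subr_eq0 -dotp_eq0; apply/eqP/le_anti; rewrite dotp_ge0 andbT.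
  rewrite !(dotpBl, dotpBr, dotpZl, dotpZr) (dotpC nu w) wnu nn.
  by move: ww; rewrite expr2 => ww; lra.
by rewrite wE // w_eq dotpZl.
Qed.

(** The gradient identity on the regular part of the sphere, in a form that can
    be differentiated: it only mentions [f], the point and the unit normal. *)
Lemma diff1_split a b t v : minimal_arc tau a b t -> 0 < t -> t < L ->
  diff1 f (arc a b t) v = diff1 f (arc a b t) (arc a b t) * dotp (arc a b t) v
    + diff1 f (arc a b t) (arc b (- a) t) * dotp (arc b (- a) t) v.
Proof.
move=> mab t0 tL; have [xx nn xn] := ortho2_arc t mab.1.
set x := arc a b t in xx xn *; set nu := arc b (- a) t in nn xn *.
rewrite -{1}(subrK (dotp x v *: x) v) addrC diff1D diff1Z mulrC; congr (_ + _).
have A := @diff1_tangent a b t (v - dotp x v *: x) mab t0 tL.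
have B := @diff1_tangent a b t nu mab t0 tL.
rewrite -/x -/nu in A B; rewrite A ?B ?nn ?mulr1 1?dotpC //.
  by rewrite dotpC dotpBr dotpZr (dotpC nu x) xn mulr0 subr0.
by rewrite dotpBr dotpZr xx mulr1 subrr.
Qed.

End TauFunction.

End Transnormal.

(** * The unit normal of the level sets *)

Section NormalField.
Variables (R : realType) (n : nat).
Local Notation V := 'rV[R]_n.
Implicit Types (x y u v w a b e : V) (s t r k : R).
Variables (tau : V -> R) (L : R) (dl : distance_like tau L).
Variables (a0 b0 : V) (m0 : minimal_arc tau a0 b0 L).
Variables (p : V -> R) (sp : smooth_on setT p).
Hypothesis ptau : forall x y, usphere x -> usphere y -> tau x = tau y -> p x = p y.
Hypothesis preg : forall x, usphere x -> 0 < tau x < L -> sphere_grad p x != 0.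

Let dq t := diff1 p (arc a0 b0 t) (arc b0 (- a0) t).

Lemma sphere_grad_arc a b t : minimal_arc tau a b t -> 0 < t -> t < L ->
  sphere_grad p (arc a b t) = dq t *: arc b (- a) t.
Proof.
move=> mab t0 tL; have [xx nn xn] := ortho2_arc t mab.1.
have H := @diff1_tangent _ _ _ _ dl _ _ m0 _ openT (@subsetT _ _) _ sp ptau a b t _ mab t0 tL.
move: H xx nn xn; set x := arc a b t; set nu := arc b (- a) t => H xx nn xn.
have Gx : dotp (sphere_grad p x) x = 0.
  by rewrite /sphere_grad /tangent_proj dotpBl dotpZl xx mulr1 subrr.
have Gv v : dotp v x = 0 -> dotp (sphere_grad p x) v = dq t * dotp nu v.
  move=> vx; rewrite -H // /sphere_grad /tangent_proj dotpBl dotpZl (dotpC x) vx mulr0.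
  by rewrite subr0.
apply/eqP; rewrite -subr_eq0 -dotp_eq0; apply/eqP.
rewrite dotpBl dotpZl Gv ?subrr //.
by rewrite dotpBl dotpZl Gx (dotpC nu) xn mulr0 subrr.
Qed.

Lemma dq_neq0 t : 0 < t < L -> dq t != 0.
Proof.
move=> /andP[tp tL].
have mab : minimal_arc tau a0 b0 t.
  by split; [exact: m0.1|move=> s /andP[s1 s2]; apply: m0.2; rewrite s1 (le_trans s2) // ltW].
have := @preg (arc a0 b0 t) (arc_usphere t m0.1).
rewrite m0.2 ?ltW // tp tL => /(_ isT).
by rewrite (sphere_grad_arc mab) //; apply: contra => /eqP ->; rewrite scale0r.
Qed.

Lemma is_derive_dq t : is_derive t 1 dq
  (diff2 p (arc a0 b0 t) (arc b0 (- a0) t) (arc b0 (- a0) t) - diff1 p (arc a0 b0 t) (arc a0 b0 t)).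
Proof.
apply: is_derive_eq.
  apply: (is_derive_diff1 openT sp) => //; exact: is_derive_arc.
by rewrite arcN diff1N.
Qed.

(** The derivative along the reference arc has no zero, so it keeps its sign; [sg]
    records whether [p] increases with the distance. *)
Lemma dq_sign : exists sg : R, (sg = 1 \/ sg = -1) /\ forall t, 0 < t < L -> 0 < sg * dq t.
Proof.
have cq (s t : R) : {within `[s, t], continuous dq}.
  by apply: derivable_within_continuous => r _; have [] := is_derive_dq r.
have same s t : 0 < s -> s <= t -> t < L -> 0 < dq s * dq t.
  move=> s0 st tL; rewrite lt_def mulf_neq0 ?dq_neq0 ?s0 ?(le_lt_trans st) ?(lt_le_trans s0) //=.
  rewrite leNgt; apply/negP => neg.
  have [] := @IVT R dq s t 0 st (cq s t).
    rewrite ge_min le_max; have [h1|h1] := lerP (dq s) 0; have [h2|h2] := lerP (dq t) 0 => /=.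
    - by nra.
    - by rewrite (ltW h2) orbT.
    - by rewrite (ltW h1).
    - by nra.
  move=> c; rewrite in_itv /= => /andP[sc ct] /eqP; apply/negP; apply: dq_neq0.
  by rewrite (lt_le_trans s0) ?(le_lt_trans ct).
have L0 := dl_gt0 dl; pose c := L / 2.
have c0 : 0 < c by rewrite /c; lra.
have cL : c < L by rewrite /c; lra.
have H t : 0 < t < L -> 0 < dq c * dq t.
  move=> /andP[tp tL]; have [ct|tc] := leP c t; first exact: same.
  by rewrite mulrC same // ltW.
have [d0|d0] := ltP 0 (dq c).
  by exists 1; split => [|t /H]; [left|rewrite mul1r pmulr_rgt0].
exists (-1); split => [|t /H]; first by right.
by rewrite mulN1r oppr_gt0 nmulr_rgt0 // lt_def d0 eq_sym dq_neq0 // c0.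
Qed.

Lemma unit_normal_arc (sg : R) a b t : (sg = 1 \/ sg = -1) ->
  (forall t, 0 < t < L -> 0 < sg * dq t) ->
  minimal_arc tau a b t -> 0 < t -> t < L ->
  unit_normal p (arc a b t) = sg *: arc b (- a) t.
Proof.
move=> sg1 sgdq mab t0 tL; rewrite /unit_normal (sphere_grad_arc mab) //.
have [_ nn _] := ortho2_arc t mab.1.
rewrite dotpZl dotpZr nn mulr1 -expr2 sqrtr_sqr scalerA; congr (_ *: _).
have : 0 < sg * dq t by apply: sgdq; rewrite t0.
case: sg1 => ->; rewrite ?mul1r ?mulN1r => dp.
  by rewrite gtr0_norm // mulVf // gt_eqF.
rewrite ltr0_norm; last by rewrite -oppr_gt0.
by rewrite invrN mulNr mulVf // -oppr_eq0 gt_eqF.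
Qed.

(** Assembled from the differentials of the entries, hence linear in [v] at every
    [x]. *)
Definition dnormal x v : V := \row_i 'd (fun y => unit_normal p y 0 i) x v.

Lemma dnormalZ x k v : dnormal x (k *: v) = k *: dnormal x v.
Proof. by apply/rowP => i; rewrite !mxE linearZ. Qed.

Lemma differentiable_sphere_grad x i : differentiable (fun y => sphere_grad p y 0 i) x.
Proof.
have dg j : differentiable (pderive j p) x.
  by apply: (smooth_differentiable openT (smooth_pderive j sp)).
have dc j : differentiable (fun y : V => y 0 j) x by exact: differentiable_coord.
rewrite (_ : (fun y => _) =
    pderive i p - (\sum_j (pderive j p * (fun y : V => y 0 j))) * (fun y : V => y 0 i)).
  apply: differentiableB => //; apply: differentiableM => //.
  by apply: differentiable_sum => j; exact: differentiableM.
apply: funext => y; rewrite /sphere_grad /tangent_proj /dotp !mxE !fctE; congr (_ - _ * _).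
by rewrite fct_sumE; apply: eq_bigr => j _; rewrite mxE.
Qed.

Lemma differentiable_normal x i : sphere_grad p x != 0 ->
  differentiable (fun y => unit_normal p y 0 i) x.
Proof.
move=> G0; have G1 := dotp_gt0 G0.
pose h y := dotp (sphere_grad p y) (sphere_grad p y).
have dh : differentiable h x.
  rewrite (_ : h = \sum_j ((fun y => sphere_grad p y 0 j) * (fun y => sphere_grad p y 0 j))).
    by apply: differentiable_sum => j; apply: differentiableM; exact: differentiable_sphere_grad.
  by apply: funext => y; rewrite fct_sumE.
have ds : differentiable (@Num.sqrt R) (h x).
  apply/derivable1_diffP; have [//] := is_derive1_sqrt G1.
rewrite (_ : (fun y => _) = (fun y => (Num.sqrt (h y))^-1) * (fun y => sphere_grad p y 0 i)).
  apply: differentiableM; last exact: differentiable_sphere_grad.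
  apply: differentiableV; first exact: differentiable_comp.
  by rewrite gt_eqF ?sqrtr_gt0.
by apply: funext => y; rewrite /unit_normal mxE.
Qed.

Lemma is_derive_normal (c : R -> V) t v : sphere_grad p (c t) != 0 ->
  is_derive t 1 c v -> is_derive t 1 (fun s => unit_normal p (c s)) (dnormal (c t) v).
Proof.
move=> G0 [dc <-]; apply: is_derive_row => i; rewrite mxE.
have dc' : differentiable c t by apply/derivable1_diffP.
have df := differentiable_normal i G0.
split; first by apply: diff_derivable; exact: (differentiable_comp dc' df).
rewrite (_ : (fun s => _) = (fun y => unit_normal p y 0 i) \o c) //.
rewrite deriveE; last exact: differentiable_comp.
by rewrite diff_comp //= deriveE.
Qed.

Lemma derive_normal x v : sphere_grad p x != 0 -> 'D_v (unit_normal p) x = dnormal x v.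
Proof.
move=> G0; have dN i : differentiable (fun y => unit_normal p y 0 i) x by exact: differentiable_normal.
rewrite derive_mx; last first.
  by apply/derivable_mxP => i j; rewrite (ord1 i); exact: diff_derivable.
by apply/rowP => i; rewrite !mxE deriveE.
Qed.

End NormalField.

(** * The flow along the normals *)

Section NormalFlow.
Variables (R : realType) (n : nat).
Local Notation V := 'rV[R]_n.
Implicit Types (x y u v w a b e : V) (s t r k : R).
Variables (tau : V -> R) (L : R) (dl : distance_like tau L).
Variables (a0 b0 : V) (m0 : minimal_arc tau a0 b0 L).
Variables (p : V -> R) (sp : smooth_on setT p).
Hypothesis ptau : forall x y, usphere x -> usphere y -> tau x = tau y -> p x = p y.
Hypothesis preg : forall x, usphere x -> 0 < tau x < L -> sphere_grad p x != 0.
Variables (sg : R) (sg1 : sg = 1 \/ sg = -1).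
Hypothesis sgdq : forall t, 0 < t < L -> 0 < sg * diff1 p (arc a0 b0 t) (arc b0 (- a0) t).

(** Pointing away from the focal set, this is the gradient of the distance. *)
Definition outer_normal y : V := sg *: unit_normal p y.
Definition douter_normal x v : V := sg *: dnormal p x v.

Lemma douter_normalZ x k v : douter_normal x (k *: v) = k *: douter_normal x v.
Proof. by rewrite /douter_normal dnormalZ scalerA mulrC -scalerA. Qed.

Lemma sg_sq : sg * sg = 1.
Proof. by case: sg1 => ->; rewrite ?mulr1 // mulrNN mulr1. Qed.

Lemma outer_normal_arc a b t : minimal_arc tau a b t -> 0 < t -> t < L ->
  outer_normal (arc a b t) = arc b (- a) t.
Proof.
move=> mab t0 tL; rewrite /outer_normal (unit_normal_arc dl m0 sp ptau sg1 sgdq mab) //.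
by rewrite scalerA sg_sq scale1r.
Qed.

Lemma is_derive_outer_normal (c : R -> V) t v : usphere (c t) -> 0 < tau (c t) < L ->
  is_derive t 1 c v -> is_derive t 1 (fun s => outer_normal (c s)) (douter_normal (c t) v).
Proof.
move=> cS ct dc; have D := is_derive_normal sp (preg cS ct) dc.
exact: is_deriveZ.
Qed.

Lemma minimal_arc_le a b s t : s <= t -> minimal_arc tau a b t -> minimal_arc tau a b s.
Proof. by move=> st [ab H]; split=> // r /andP[r0 rs]; apply: H; rewrite r0 (le_trans rs). Qed.

Lemma regular_near x v : ortho2 x v -> 0 < tau x < L -> forall s, s < tau x ->
  \forall r \near 0, s < tau (arc x v r) /\ 0 < tau (arc x v r) < L.
Proof.
move=> xv /andP[x0 xL] s sx.
pose m := Num.min pi (Num.min (tau x - s) (Num.min (tau x) (L - tau x))).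
have mpos : 0 < m by rewrite !lt_min pi_gt0 x0 !subr_gt0 sx xL.
have N : \forall r \near (0 : R), `|r| < m by exact: nbhs0_lt.
apply: filterS N => r; rewrite !lt_min => /and4P[r1 r2 r3 r4].
have := tau_arc_near dl xv (ltW r1); rewrite ler_norml => /andP[h1 h2].
by split; [|apply/andP; split]; lra.
Qed.

(** Through [x] passes a minimizing arc, whose velocity is the normal at each of
    its points; [s] is the length travelled back towards the focal set. *)
Lemma outer_normal_flow x s : usphere x -> 0 < tau x < L -> 0 <= s -> s < tau x ->
  outer_normal (cos s *: x - sin s *: outer_normal x) = cos s *: outer_normal x + sin s *: x.
Proof.
move=> xx /andP[x0 xL] s0 sx.
have [a [b [ab ax H]]] := dl_arc dl xx x0.
have mab : minimal_arc tau a b (tau x) by [].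
have nx : outer_normal x = arc b (- a) (tau x) by rewrite -{1}ax; apply: outer_normal_arc.
have E : arc a b (tau x - s) = cos s *: x - sin s *: outer_normal x.
  by rewrite nx -{2}ax -arcD /arc cosN sinN scaleNr.
rewrite -E outer_normal_arc ?subr_gt0 //.
- rewrite -arcD_tangent ax -nx {1}/arc cosN sinN scaleNr scalerN opprK //.
- by apply: minimal_arc_le mab; rewrite gerBl.
- by apply: le_lt_trans xL; rewrite gerBl.
Qed.

Lemma is_derive_lin2 (c1 c2 : R -> V) (k1 k2 : R) t v1 v2 :
  is_derive t 1 c1 v1 -> is_derive t 1 c2 v2 ->
  is_derive t 1 (fun s => k1 *: c1 s + k2 *: c2 s) (k1 *: v1 + k2 *: v2).
Proof. by move=> d1 d2; apply: is_deriveD. Qed.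

(** Differentiating [outer_normal_flow] in the direction [e]: principal directions
    are constant along the arc, and principal curvatures follow the addition law
    of the cotangent. *)
Lemma douter_normal_flow a b t s e k : minimal_arc tau a b t -> 0 < t -> t < L ->
  0 <= s -> s < t -> dotp e e = 1 -> dotp (arc a b t) e = 0 ->
  douter_normal (arc a b t) e = k *: e ->
  (cos s - k * sin s) *: douter_normal (arc a b (t - s)) e = (k * cos s + sin s) *: e.
Proof.
move=> mab t0 tL s0 st ee xe ke.
have [xx nn xn] := ortho2_arc t mab.1; set x := arc a b t in xe ke xx nn xn *.
have tx : tau x = t by rewrite mab.2 // lexx ltW.
have xe2 : ortho2 x e by [].
have xr : 0 < tau x < L by rewrite tx t0.
have nx : outer_normal x = arc b (- a) t by rewrite outer_normal_arc.
have Dc := is_derive_arc x e 0; rewrite arc0 in Dc.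
have Dn : is_derive (0 : R) 1 (fun r => outer_normal (arc x e r)) (k *: e).
  by rewrite -ke -[in douter_normal x e](arc0 x e); apply: is_derive_outer_normal; rewrite ?arc0.
have DL : is_derive (0 : R) 1 (fun r => cos s *: arc x e r + (- sin s) *: outer_normal (arc x e r))
   (cos s *: e + (- sin s) *: (k *: e)) by exact: is_derive_lin2.
have DR : is_derive (0 : R) 1 (fun r => cos s *: outer_normal (arc x e r) + sin s *: arc x e r)
   (cos s *: (k *: e) + sin s *: e) by exact: is_derive_lin2.
pose y := arc a b (t - s).
have Ey : cos s *: arc x e 0 + (- sin s) *: outer_normal (arc x e 0) = y.
  by rewrite arc0 nx /y -arcD /arc cosN sinN.
have my : minimal_arc tau a b (t - s) by apply: minimal_arc_le mab; rewrite gerBl.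
have ty : tau y = t - s by rewrite mab.2 // subr_ge0 (ltW st) gerBl.
have DN : is_derive (0 : R) 1 (fun r => outer_normal (cos s *: arc x e r + (- sin s) *: outer_normal (arc x e r)))
   (douter_normal y (cos s *: e + (- sin s) *: (k *: e))).
  rewrite -Ey; apply: is_derive_outer_normal => //; rewrite Ey; first by apply: arc_usphere; exact: mab.1.
  by rewrite ty subr_gt0 st (le_lt_trans _ tL) // gerBl.
have EV : douter_normal y (cos s *: e + (- sin s) *: (k *: e)) = cos s *: (k *: e) + sin s *: e.
  have sx : s < tau x by rewrite tx.
  have NE : \forall r \near (0 : R),
      outer_normal (cos s *: arc x e r + (- sin s) *: outer_normal (arc x e r))
      = cos s *: outer_normal (arc x e r) + sin s *: arc x e r.
    apply: filterS (regular_near xe2 xr sx) => r [r1 r2].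
    by rewrite scaleNr outer_normal_flow //; exact: arc_usphere.
  have [_ <-] := near_eq_is_derive NE DN.
  by have [_ <-] := DR.
rewrite -douter_normalZ (_ : (cos s - k * sin s) *: e = cos s *: e + (- sin s) *: (k *: e)).
  by rewrite EV scalerA -scalerDl mulrC.
by rewrite scalerA -scalerDl mulNr (mulrC k).
Qed.

Section HessianOnPrincipal.
Variables (U : set V) (oU : open U) (SU : @usphere R n `<=` U).
Variables (f : V -> R) (sf : smooth_on U f).
Hypothesis ftau : forall x y, usphere x -> usphere y -> tau x = tau y -> f x = f y.

(** The splitting [diff1_split] of the gradient, differentiated in a principal
    direction. *)
Lemma diff2_principal a b t e k v : minimal_arc tau a b t -> 0 < t -> t < L ->
  dotp e e = 1 -> dotp (arc a b t) e = 0 -> dotp (arc b (- a) t) e = 0 ->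
  douter_normal (arc a b t) e = k *: e ->
  let x := arc a b t in let nu := arc b (- a) t in
  diff2 f x v e = diff2 f x x e * dotp x v + diff2 f x nu e * dotp nu v
    + (diff1 f x x + k * diff1 f x nu) * dotp e v.
Proof.
move=> mab t0 tL ee xe ne ke x nu.
have [xx nn xn] := ortho2_arc t mab.1; rewrite -/x -/nu in xe ne ke xx nn xn *.
have tx : tau x = t by rewrite mab.2 // lexx ltW.
have xe2 : ortho2 x e by [].
have xr : 0 < tau x < L by rewrite tx t0.
have nx : outer_normal x = nu by rewrite outer_normal_arc.
have fe : diff1 f x e = 0.
  by rewrite (diff1_split dl m0 oU SU sf ftau e mab) // -/x -/nu xe ne !mulr0 addr0.
have Dc := is_derive_arc x e 0; rewrite arc0 in Dc.
have Dn : is_derive (0 : R) 1 (fun r => outer_normal (arc x e r)) (k *: e).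
  by rewrite -ke -[in douter_normal x e](arc0 x e); apply: is_derive_outer_normal; rewrite ?arc0.
have Dv := is_derive_cst v (0 : R) (1 : R).
have Ux : U (arc x e 0) by apply: SU; rewrite arc0.
have D0 := is_derive_diff1 oU sf Ux Dc Dv.
have D1 := is_derive_diff1 oU sf Ux Dc Dc.
have D2 := is_derive_diff1 oU sf Ux Dc Dn.
have P1 := is_derive_dotp Dc Dv.
have P2 := is_derive_dotp Dn Dv.
have DR := is_deriveD (is_deriveM D1 P1) (is_deriveM D2 P2).
have NE : \forall r \near (0 : R), diff1 f (arc x e r) v =
    diff1 f (arc x e r) (arc x e r) * dotp (arc x e r) v +
    diff1 f (arc x e r) (outer_normal (arc x e r)) * dotp (outer_normal (arc x e r)) v.
  apply: filterS (regular_near xe2 xr (le_lt_trans (lexx 0) (andP xr).1)) => r [r1 /andP[r2 r3]].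
  have yS := arc_usphere r xe2.
  have [a' [b' [ab' ay H]]] := dl_arc dl yS r2.
  have mab' : minimal_arc tau a' b' (tau (arc x e r)) by [].
  have := diff1_split dl m0 oU SU sf ftau v mab' r2 r3.
  by rewrite -(outer_normal_arc mab') // ay.
have E := near_is_derive_eq D0 DR NE.
move: E; rewrite !arc0 nx /cst -/x fe /GRing.scale /= diff1Z fe.
have z0 w : dotp w 0 = 0 by rewrite -(scale0r w) dotpZr mul0r.
have z1 : diff1 f x 0 = 0 by exact: z0.
by rewrite !z0 z1 !addr0 dotpZl => ->; ring.
Qed.

End HessianOnPrincipal.
End NormalFlow.

(** * Homogeneous polynomials along a great circle *)

Section HomogeneousCalculus.
Variables (R : realType) (n : nat).
Local Notation V := 'rV[R]_n.
Implicit Types (x y u v w : V) (s t k z : R).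

Lemma poly_eq0_large (P : {poly R}) (z0 : R) : (forall z, z0 < z -> P.[z] = 0) -> P = 0.
Proof.
move=> H; apply/eqP/negPn/negP => P0.
pose rs := [seq z0 + 1 + i%:R | i <- iota 0 (size P)].
have rr : all (root P) rs.
  apply/allP => _ /mapP [i _ ->]; apply/eqP/H.
  by rewrite -addrA ltrDl ltr_wpDr // ler0n.
have ru : uniq rs.
  by rewrite map_inj_uniq ?iota_uniq // => i j /addrI /eqP; rewrite eqr_nat => /eqP.
by have := max_poly_roots P0 rr ru; rewrite size_map size_iota ltnn.
Qed.

Lemma is_derive_line x v t : is_derive t 1 (fun s => x + s *: v) v.
Proof.
apply: is_derive_row => i.
rewrite (_ : (fun s => _) = (fun s => x 0 i + s * v 0 i)); last first.
  by apply: funext => s; rewrite !mxE.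
have D1 := is_derive_cst (x 0 i) t (1 : R).
have D2 := is_deriveM (is_derive_id t (1 : R)) (is_derive_cst (v 0 i) t (1 : R)).
apply: (@is_derive_eq _ _ _ _ _ _ _ _ (is_deriveD D1 D2)).
by rewrite /GRing.scale /= /cst; ring.
Qed.

Variables (d : nat) (p : V -> R) (hp : homogeneous_poly d p).
Let sp : smooth_on setT p := @polyfun_smooth R n p setT (homogeneous_polyfun hp).

Lemma homogeneous_diff1Z k y v : diff1 p (k *: y) (k *: v) = k ^+ d * diff1 p y v.
Proof.
have D1 : is_derive (0 : R) 1 (fun s => k *: (y + s *: v)) (k *: v).
  by apply: is_deriveZ; exact: is_derive_line.
have D2 := is_derive_comp_curve openT sp I D1.
have D3 := is_deriveZ (k ^+ d) (is_derive_comp_curve openT sp I (is_derive_line y v 0)).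
rewrite scale0r addr0 in D2 D3.
apply: near_is_derive_eq D2 D3 _; near=> s.
by rewrite (homogeneous_polyZ k _ hp).
Unshelve. all: by end_near. Qed.

Lemma homogeneous_diff2Z k y v w :
  diff2 p (k *: y) (k *: v) (k *: w) = k ^+ d * diff2 p y v w.
Proof.
have D1 : is_derive (0 : R) 1 (fun s => k *: (y + s *: w)) (k *: w).
  by apply: is_deriveZ; exact: is_derive_line.
have Dk := is_derive_cst (k *: v) (0 : R) (1 : R).
have Dv := is_derive_cst v (0 : R) (1 : R).
have D2 := is_derive_diff1 openT sp I D1 Dk.
have D3 := is_deriveZ (k ^+ d) (is_derive_diff1 openT sp I (is_derive_line y w 0) Dv).
rewrite scale0r addr0 in D2 D3.
have z1 x : diff1 p x 0 = 0 by rewrite -(scale0r x) diff1Z mul0r.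
rewrite !z1 !addr0 in D2 D3.
apply: near_is_derive_eq D2 D3 _; near=> s.
by rewrite /cst homogeneous_diff1Z.
Unshelve. all: by end_near. Qed.

Lemma homogeneous_euler y : diff1 p y y = d%:R * p y.
Proof.
have D1 := is_derive_comp_curve openT sp I (is_derive_line 0 y 1).
have D2 := is_deriveM (is_deriveX d (is_derive_id (1 : R) (1 : R))) (is_derive_cst (p y) (1 : R) (1 : R)).
rewrite scale1r add0r in D1.
rewrite (near_is_derive_eq D1 D2 _).
  by rewrite scaler0 add0r /cst expr1n mulr1 /GRing.scale /= mulr1 mulrC.
near=> s.
by rewrite add0r (homogeneous_polyZ s y hp) !fctE.
Unshelve. all: by end_near. Qed.

Variables (x0 n0 : V) (f1 : {poly R}).
Hypothesis f1s : (size f1 <= d.+1)%N.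
Hypothesis f1E : forall z, p (z *: x0 + - n0) = f1.[z].

(** Up to the factor [sin s ^+ d], the derivative of [p] along the great circle with
    position [x0] and velocity [n0], at time [- s], as a polynomial in the
    cotangent of [s]. *)
Definition rot_poly : {poly R} := (1 + 'X^2) * f1^`() - d%:R *: ('X * f1).

(** The terms of degree [d.+1] cancel. *)
Lemma size_rot_poly : (size rot_poly <= d.+1)%N.
Proof.
have f0 i : (d < i)%N -> f1`_i = 0 by move=> di; rewrite nth_default // (leq_trans f1s).
apply/leq_sizeP => j dj.
rewrite coefB coefZ coefXM mulrDl mul1r coefD coefXnM !coef_deriv.
case: j dj => // j; rewrite ltnS => dj /=.
rewrite (f0 j.+2) ?mul0rn ?add0r; last by rewrite ltnS ltnW // ltnS.
have [jd|jd] := eqVneq j d.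
  rewrite {}jd in dj *; have [->|d0] := posnP d; first by rewrite mul0r subrr.
  have -> : (d.+1 - 2).+1 = d by rewrite subSS subn1 prednK.
  by rewrite !ltnS leqNgt d0 /= mulr_natl subrr.
have dj' : (d < j)%N by rewrite ltn_neqAle eq_sym jd.
have j0 : (0 < j)%N by exact: leq_trans dj'.
have -> : (j.+1 - 2).+1 = j by rewrite subSS subn1 prednK.
by rewrite (f0 j) // mulr0 mul0rn subr0; case: ifP.
Qed.

Lemma rot_polyE z : rot_poly.[z] = diff1 p (z *: x0 - n0) (x0 + z *: n0).
Proof.
have Df : f1^`().[z] = diff1 p (z *: x0 - n0) x0.
  have D1 := is_derive_comp_curve openT sp I (is_derive_line (- n0) x0 z).
  have D2 : is_derive z 1 (horner f1) f1^`().[z].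
    rewrite derivE derive1E; apply/derivableP; exact: derivable_horner.
  rewrite addrC; apply: near_is_derive_eq D2 D1 _; near=> s.
  by rewrite addrC f1E.
have := homogeneous_euler (z *: x0 - n0).
rewrite {2}/(_ - _) [in X in X = _ -> _]diff1D diff1Z diff1N f1E -Df => E.
rewrite /rot_poly hornerD hornerN hornerZ !hornerM !hornerD hornerX hornerXn hornerC diff1D diff1Z -Df.
have -> : diff1 p (z *: x0 - n0) n0 = z * f1^`().[z] - d%:R * f1.[z] by rewrite -E; ring.
by ring.
Unshelve. all: by end_near. Qed.

End HomogeneousCalculus.

(** * Counting principal curvatures *)

Section PrincipalCurvatures.
Variables (R : realType) (n : nat).
Local Notation V := 'rV[R]_n.
Implicit Types (x y u v w a b e : V) (s t r k : R).
Variables (tau : V -> R) (L : R) (dl : distance_like tau L).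
Variables (a0 b0 : V) (m0 : minimal_arc tau a0 b0 L).
Variables (d : nat) (p : V -> R) (hp : homogeneous_poly d p).
Let sp : smooth_on setT p := @polyfun_smooth R n p setT (homogeneous_polyfun hp).
Hypothesis ptau : forall x y, usphere x -> usphere y -> tau x = tau y -> p x = p y.
Hypothesis preg : forall x, usphere x -> 0 < tau x < L -> sphere_grad p x != 0.
Variables (sg : R) (sg1 : sg = 1 \/ sg = -1).
Let dq t := diff1 p (arc a0 b0 t) (arc b0 (- a0) t).
Hypothesis sgdq : forall t, 0 < t < L -> 0 < sg * dq t.
Variables (t0 : R) (t0L : 0 < t0 < L).
Let x0 := arc a0 b0 t0.
Let n0 := arc b0 (- a0) t0.

Definition principal_direction k e :=
  [/\ dotp e e = 1, dotp x0 e = 0, dotp n0 e = 0 & douter_normal p sg x0 e = k *: e].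

Let on0 : ortho2 x0 n0. Proof. exact: ortho2_arc m0.1. Qed.

Lemma arc_back s : arc a0 b0 (t0 - s) = cos s *: x0 - sin s *: n0.
Proof. by rewrite -arcD /arc cosN sinN scaleNr. Qed.

Lemma arc_back_tangent s : arc b0 (- a0) (t0 - s) = cos s *: n0 + sin s *: x0.
Proof. by rewrite -arcD_tangent {1}/arc cosN sinN scaleNr scalerN opprK. Qed.

Variables (f1 : {poly R}) (f1s : (size f1 <= d.+1)%N).
Hypothesis f1E : forall z, p (z *: x0 + - n0) = f1.[z].
Let r := rot_poly d f1.

Lemma dq_rot_poly s : sin s != 0 ->
  dq (t0 - s) = sin s ^+ d * r.[cos s / sin s].
Proof.
move=> ss; have zE : sin s * (cos s / sin s) = cos s by rewrite mulrC divfK.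
rewrite /r (rot_polyE hp f1E) -(homogeneous_diff1Z hp) /dq; congr diff1.
  by rewrite arc_back scalerBr scalerA zE.
by rewrite arc_back_tangent [RHS]scalerDr scalerA zE addrC.
Qed.

Lemma rot_poly_neq0 : r != 0.
Proof.
have /andP[t00 t0L'] := t0L.
have t0pi : t0 < pi by apply: lt_le_trans (dl_lepi dl).
pose s := t0 / 2; have s0 : 0 < s by rewrite /s; lra.
have ss : sin s != 0 by rewrite gt_eqF // sin_gt0_pi // s0 /s; lra.
have q0 : dq (t0 - s) != 0.
  have : 0 < sg * dq (t0 - s) by apply: sgdq; rewrite /s; apply/andP; split; lra.
  by apply: contraTneq => ->; rewrite mulr0 ltxx.
by apply: contraNneq q0 => r0; rewrite dq_rot_poly // r0 horner0 mulr0.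
Qed.

(** Both sides of [diff2_principal] for [p], at the point of the arc with cotangent
    [z], are polynomial in [z] by homogeneity.  They agree for large [z], so they
    agree at [z = k], where the term with the second derivative drops out. *)
Lemma principal_root k e : principal_direction k e -> root r k.
Proof.
case=> ee xe ne ke.
have /andP[t00 t0L'] := t0L; have Lpi := dl_lepi dl.
have m1 : minimal_arc tau a0 b0 t0 by apply: minimal_arc_le m0; exact: ltW.
have [g2 g2E] := @diff2_line R n d p x0 (- n0) e hp.
pose P := ('X - k%:P) * (g2 * (1 + 'X^2) - d%:R *: f1) - (k *: 'X + 1) * r.
have PE z : P.[z] = (z - k) * (g2.[z] * (1 + z ^+ 2) - d%:R * f1.[z]) - (k * z + 1) * r.[z].
  by rewrite /P !(hornerE, hornerXn).
(* [k * k + 1] does not vanish over the reals *)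
suff P0 : P = 0.
  have := PE k; rewrite P0 horner0 subrr mul0r sub0r => /esym/eqP.
  rewrite oppr_eq0 mulf_eq0 => /orP[|//]; rewrite -expr2 => /eqP kk.
  by have := sqr_ge0 k; have := @ltr01 R; move: kk; lra.
apply: (@poly_eq0_large _ _ (cos t0 / sin t0)) => z zt.
have st0 : 0 < sin t0 by rewrite sin_gt0_pi // t00 (lt_le_trans t0L').
(* the angle in ]0, pi[ with cotangent [z] *)
pose s := pi / 2 - atan z.
have ss : sin s = cos (atan z) by rewrite /s sinB sin_pihalf cos_pihalf; ring.
have cs : cos s = sin (atan z) by rewrite /s cosB sin_pihalf cos_pihalf; ring.
have s_gt0 : 0 < s by rewrite subr_gt0 atan_ltpi2.
have s_ltpi : s < pi by have := @atan_gtNpi2 R z; rewrite /s; lra.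
have sin_s : 0 < sin s by rewrite sin_gt0_pi // s_gt0.
have sn0 : sin s != 0 by rewrite gt_eqF.
have zE : z = cos s / sin s by rewrite cs ss -[LHS]atanK.
have st : s < t0.
  have H : 0 < sin (t0 - s).
    rewrite sinB; have -> : cos s = z * sin s by rewrite zE divfK.
    have -> : sin t0 * (z * sin s) - cos t0 * sin s = sin s * (z * sin t0 - cos t0) by ring.
    by rewrite pmulr_rgt0 // subr_gt0 -ltr_pdivrMr.
  rewrite ltNge; apply/negP => ts; move: H; rewrite -opprB sinN oppr_gt0 ltNge.
  by rewrite sin_ge0_pi // subr_ge0 ts; apply: le_trans (ltW s_ltpi); rewrite gerBl ltW.
have F := douter_normal_flow dl m0 sp ptau preg sg1 sgdq m1 t00 t0L' (ltW s_gt0) st ee xe ke.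
set D := cos s - k * sin s in F; set y := arc a0 b0 (t0 - s) in F.
have e0 : e != 0 by rewrite -dotp_eq0 ee oner_neq0.
have D0 : D != 0.
  apply/eqP => D0; move/eqP: F; rewrite D0 scale0r eq_sym scaler_eq0 (negbTE e0) orbF => /eqP F.
  have := cos2Dsin2 s; have -> : cos s = k * sin s by apply/eqP; rewrite -subr_eq0; apply/eqP.
  have : sin s * (k * (k * sin s) + sin s) = 0.
    by rewrite (_ : k * sin s = cos s) ?F ?mulr0 //; apply/esym/eqP; rewrite -subr_eq0; apply/eqP.
  by move=> h1 h2; have := @oner_neq0 R; rewrite -h2 => /eqP; apply; rewrite -h1; ring.
pose k' := (k * cos s + sin s) / D.
have ke' : douter_normal p sg y e = k' *: e.
  by rewrite /k' mulrC -scalerA -F scalerA mulVf // scale1r.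
have m2 : minimal_arc tau a0 b0 (t0 - s) by apply: minimal_arc_le m1; rewrite gerBl ltW.
have ye : dotp y e = 0 by rewrite /y arc_back dotpBl !dotpZl xe ne !mulr0 subrr.
have nye : dotp (arc b0 (- a0) (t0 - s)) e = 0.
  by rewrite arc_back_tangent dotpDl !dotpZl xe ne !mulr0 addr0.
have ts0 : 0 < t0 - s by rewrite subr_gt0.
have tsL : t0 - s < L by apply: le_lt_trans t0L'; rewrite gerBl ltW.
have := diff2_principal dl m0 sp ptau preg sg1 sgdq openT (@subsetT _ _) sp ptau e m2 ts0 tsL ee ye nye ke'.
rewrite /= -/y ye nye !mulr0 !add0r ee mulr1 (homogeneous_euler hp) -/(dq _) => H.
have zs : sin s * z = cos s by rewrite zE mulrC divfK.
have yE : y = sin s *: (z *: x0 - n0) by rewrite /y arc_back [RHS]scalerBr scalerA zs.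
have py : p y = sin s ^+ d * f1.[z] by rewrite -f1E -(homogeneous_polyZ _ _ hp) -yE.
have gy : sin s ^+ 2 * diff2 p y e e = sin s ^+ d * g2.[z].
  by rewrite -g2E -(homogeneous_diff2Z hp) -yE diff2Zl diff2Zr mulrA -expr2.
have qy : dq (t0 - s) = sin s ^+ d * r.[z] by rewrite dq_rot_poly // zE.
have DE : D = sin s * (z - k) by rewrite /D zE; field.
have ksE : k * cos s + sin s = sin s * (k * z + 1) by rewrite zE; field.
have z2 : sin s ^+ 2 * (1 + z ^+ 2) = 1.
  by rewrite -[RHS](cos2Dsin2 s) zE; field.
rewrite PE; apply: (mulfI (expf_neq0 d.+1 sn0)); rewrite mulr0.
have H1 : D * diff2 p y e e = D * (d%:R * p y) + (k * cos s + sin s) * dq (t0 - s).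
  by rewrite H /k'; field.
have H2 : D * (sin s ^+ d * g2.[z])
    = sin s ^+ 2 * (D * (d%:R * (sin s ^+ d * f1.[z])) + (k * cos s + sin s) * (sin s ^+ d * r.[z])).
  by rewrite -gy -py -qy -H1; ring.
have H3 : (1 + z ^+ 2) * (D * (sin s ^+ d * g2.[z]))
    = (D * (d%:R * (sin s ^+ d * f1.[z])) + (k * cos s + sin s) * (sin s ^+ d * r.[z])).
  by rewrite H2 mulrA (mulrC (1 + _)) z2 mul1r.
move/eqP: H3; rewrite -subr_eq0 DE ksE => /eqP <-; rewrite exprS; ring.
Qed.

(** The normal keeps unit length and stays tangent to the sphere. *)
Lemma douter_normal_tangent e : dotp e e = 1 -> dotp x0 e = 0 -> dotp n0 e = 0 ->
  dotp (douter_normal p sg x0 e) x0 = 0 /\ dotp (douter_normal p sg x0 e) n0 = 0.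
Proof.
move=> ee xe ne; have [xx nn xn] := on0; have /andP[t00 t0L'] := t0L.
have m1 : minimal_arc tau a0 b0 t0 by apply: minimal_arc_le m0; exact: ltW.
have tx : tau x0 = t0 by rewrite m1.2 // lexx ltW.
have xr : 0 < tau x0 < L by rewrite tx.
have xe2 : ortho2 x0 e by [].
have nx : outer_normal p sg x0 = n0 by rewrite (outer_normal_arc dl m0 sp ptau sg1 sgdq m1).
have Dc := is_derive_arc x0 e 0; rewrite arc0 in Dc.
have Dn : is_derive (0 : R) 1 (fun r => outer_normal p sg (arc x0 e r)) (douter_normal p sg x0 e).
  by rewrite -[in douter_normal _ _ x0 e](arc0 x0 e); apply: (is_derive_outer_normal sp preg); rewrite ?arc0.
have N : \forall r \near (0 : R), dotp (outer_normal p sg (arc x0 e r)) (arc x0 e r) = 0 /\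
    dotp (outer_normal p sg (arc x0 e r)) (outer_normal p sg (arc x0 e r)) = 1.
  apply: filterS (regular_near dl xe2 xr (andP xr).1) => h [_ /andP[r2 r3]].
  have yS := arc_usphere h xe2.
  have [a' [b' [ab' ay H]]] := dl_arc dl yS r2.
  have mab' : minimal_arc tau a' b' (tau (arc x0 e h)) by [].
  have := outer_normal_arc dl m0 sp ptau sg1 sgdq mab' r2 r3; rewrite ay => ->.
  have [_ nn' xn'] := ortho2_arc (tau (arc x0 e h)) ab'.
  by split=> //; rewrite dotpC -{1}ay.
have C0 := is_derive_cst (0 : R) (0 : R) (1 : R).
have C1 := is_derive_cst (1 : R) (0 : R) (1 : R).
have N1 : \forall h \near (0 : R), dotp (outer_normal p sg (arc x0 e h)) (arc x0 e h) = 0.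
  by apply: filterS N => h [].
have N2 : \forall h \near (0 : R), dotp (outer_normal p sg (arc x0 e h)) (outer_normal p sg (arc x0 e h)) = 1.
  by apply: filterS N => h [].
have E1 := near_is_derive_eq (is_derive_dotp Dn Dc) C0 N1.
have E2 := near_is_derive_eq (is_derive_dotp Dn Dn) C1 N2.
move: E1 E2; rewrite arc0 nx ne addr0 => -> E2; split => //.
by move: E2; rewrite (dotpC n0) => E2; lra.
Qed.

Lemma principal_curvature_direction k : principal_curvature p x0 k ->
  exists e, principal_direction (- (sg * k)) e.
Proof.
have [xx nn xn] := on0; have /andP[t00 t0L'] := t0L.
have m1 : minimal_arc tau a0 b0 t0 by apply: minimal_arc_le m0; exact: ltW.
have tx : tau x0 = t0 by rewrite m1.2 // lexx ltW.
have G0 : sphere_grad p x0 != 0 by apply: preg; rewrite ?tx //; exact: arc_usphere m0.1.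
have Nx : unit_normal p x0 = sg *: n0 by rewrite (unit_normal_arc dl m0 sp ptau sg1 sgdq m1).
have sgs := sg_sq sg1.
case=> v [v0 vx vN]; rewrite /shape_operator (derive_normal sp v G0) => vk.
have vn : dotp n0 v = 0.
  by move: vN; rewrite Nx dotpZr => H; rewrite -[LHS]mul1r -sgs -mulrA dotpC H mulr0.
have vv := dotp_gt0 v0; set m := dotp v v in vv.
have sm0 : Num.sqrt m != 0 by rewrite gt_eqF ?sqrtr_gt0.
pose e := (Num.sqrt m)^-1 *: v.
have ee : dotp e e = 1 by exact: dotp_normalize.
have xe : dotp x0 e = 0 by rewrite dotpZr dotpC vx mulr0.
have ne : dotp n0 e = 0 by rewrite dotpZr vn mulr0.
exists e; split => //.
(* the tangential projection in the shape operator does nothing *)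
have [d1 d2] := douter_normal_tangent ee xe ne.
have dvE : dnormal p x0 v = (Num.sqrt m * sg) *: douter_normal p sg x0 e.
  rewrite /douter_normal scalerA -mulrA sgs mulr1 /e dnormalZ scalerA divff // scale1r.
  by [].
have d1' : dotp (dnormal p x0 v) x0 = 0 by rewrite dvE dotpZl d1 mulr0.
have d2' : dotp (dnormal p x0 v) (sg *: n0) = 0 by rewrite dotpZr dvE dotpZl d2 !mulr0.
have H : - dnormal p x0 v = k *: v.
  by rewrite -vk Nx /= !dotpNl d1' d2' !oppr0 !scale0r !subr0.
rewrite /douter_normal /e dnormalZ -[dnormal p x0 v]opprK H !scalerN scaleNr; congr (- _).
by rewrite !scalerA mulrAC.
Qed.

(** The [d] distinct principal curvatures already exhaust the roots of a nonzero
    polynomial of degree at most [d]. *)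
Lemma realized_root c : ([set k | principal_curvature p x0 k] #= `I_d)%card ->
  root r c -> exists e, principal_direction c e.
Proof.
rewrite card_eq_sym => /card_set_bijP [f [fK finj fsurj]] rc.
apply: contrapT => nc.
pose rs := c :: [seq - (sg * f i) | i <- iota 0 d].
have sg0 : sg != 0 by case: sg1 => ->; rewrite ?oppr_eq0 oner_neq0.
have dirs i : (i < d)%N -> exists e, principal_direction (- (sg * f i)) e.
  by move=> id; apply: principal_curvature_direction; apply: fK.
have rr : all (root r) rs.
  rewrite /= rc; apply/allP => z /mapP [i]; rewrite mem_iota add0n => /andP[_ id] ->.
  by have [e /principal_root] := dirs i id.
have ru : uniq rs.
  rewrite /= map_inj_in_uniq ?iota_uniq ?andbT.
    apply/mapP => -[i]; rewrite mem_iota add0n => /andP[_ id] cE.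
    by apply: nc; rewrite cE; exact: dirs.
  move=> i j; rewrite !mem_iota !add0n => /andP[_ id] /andP[_ jd] /oppr_inj /(mulfI sg0).
  by apply: finj; rewrite inE.
have := max_poly_roots rot_poly_neq0 rr ru.
rewrite /= size_map size_iota ltnNge.
by rewrite (size_rot_poly f1s).
Qed.

End PrincipalCurvatures.

(** * Curvature of a Hessian metric *)

Section HessianCurvature.
Variables (R : realType) (n : nat).
Local Notation V := 'rV[R]_n.
Local Notation e_ i := (delta_mx 0 i : V).
Implicit Types (f g : V -> R) (x y u v w : V).

Lemma derivable_bigsum (I : Type) (r : seq I) (P : pred I) (F : I -> V -> R) x v :
  (forall i, derivable (F i) x v) -> derivable (fun y => \sum_(i <- r | P i) F i y) x v.
Proof.
move=> dF; elim: r => [|i r IH].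
  rewrite (_ : (fun _ => _) = fun=> 0); first exact: derivable_cst.
  by apply: funext => y; rewrite big_nil.
case: (boolP (P i)) => Pi.
  rewrite (_ : (fun _ => _) = F i + (fun y => \sum_(i <- r | P i) F i y)); first exact: derivableD.
  by apply: funext => y; rewrite big_cons Pi.
rewrite (_ : (fun _ => _) = (fun y => \sum_(i <- r | P i) F i y)) //.
by apply: funext => y; rewrite big_cons (negbTE Pi).
Qed.

Lemma derivable_bigprod (I : Type) (r : seq I) (F : I -> V -> R) x v :
  (forall i, derivable (F i) x v) -> derivable (fun y => \prod_(i <- r) F i y) x v.
Proof.
move=> dF; elim: r => [|i r IH].
  rewrite (_ : (fun _ => _) = fun=> 1); first exact: derivable_cst.
  by apply: funext => y; rewrite big_nil.
rewrite (_ : (fun _ => _) = F i * (fun y => \prod_(i <- r) F i y)); first exact: derivableM.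
by apply: funext => y; rewrite big_cons.
Qed.

Lemma mulmxD_entries m (A B C D E : 'M[R]_m) (c : R) :
  (forall k l, \sum_j (A k j * B j l + C k j * D j l) = c * E k l) ->
  A *m B + C *m D = c *: E.
Proof. by move=> H; apply/matrixP => k l; rewrite !mxE -big_split H. Qed.

Lemma mulmx_entry m (A B : 'M[R]_m) k l : (A *m B) k l = \sum_j A k j * B j l.
Proof. by rewrite mxE. Qed.

Lemma mx_entry4 m (A B C D : 'M[R]_m) k l :
  (A - B + (C - D)) k l = A k l - B k l + (C k l - D k l).
Proof. by rewrite !mxE. Qed.

(** The linear algebra of [flat_third_comm]: [Gi] stands for the Christoffel symbols,
    [Dij] for their derivatives and [E4] for the fourth derivatives.  Multiplying
    the curvature by [H] makes the latter cancel. *)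
Lemma flat_algebra m (H Ti Tj Gi Gj Dij Dji E4 : 'M[R]_m) :
  Dij - Dji + (Gi *m Gj - Gj *m Gi) = 0 ->
  Ti *m Gj + H *m Dij = 2^-1 *: E4 -> Tj *m Gi + H *m Dji = 2^-1 *: E4 ->
  Gi = 2^-1 *: (invmx H *m Ti) -> Gj = 2^-1 *: (invmx H *m Tj) ->
  H *m Gi = 2^-1 *: Ti -> H *m Gj = 2^-1 *: Tj ->
  Ti *m invmx H *m Tj = Tj *m invmx H *m Ti.
Proof.
move=> R0 P1 P2 C1 C2 Q1 Q2.
have := congr1 (mulmx H) R0; rewrite mulmx0 mulmxDr !mulmxBr !mulmxA Q1 Q2.
have -> : H *m Dij = 2^-1 *: E4 - Ti *m Gj by rewrite -P1 addrC addKr.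
have -> : H *m Dji = 2^-1 *: E4 - Tj *m Gi by rewrite -P2 addrC addKr.
have TG (T G : 'M[R]_m) K : G = 2^-1 *: (invmx H *m K) -> T *m G = 2^-1 *: (T *m invmx H *m K).
  by move=> ->; rewrite -scalemxAr mulmxA.
rewrite -!scalemxAl (TG Ti _ _ C2) (TG Tj _ _ C1).
move: (Ti *m invmx H *m Tj) (Tj *m invmx H *m Ti) => X Y.
move=> E; apply/matrixP => k l; move/matrixP/(_ k l): E; rewrite !mxE => E; lra.
Qed.

Lemma sub_congr4 (a b c e a' b' c' e' : R) : a = a' -> b = b' -> c = c' -> e = e' ->
  a - b + (c - e) = a' - b' + (c' - e').
Proof. by move=> -> -> -> ->. Qed.

Lemma derivable_cstM (c : R) f x v : derivable f x v -> derivable (fun y => c * f y) x v.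
Proof. exact: derivableZ. Qed.

Lemma derivable_det m (M : V -> 'M[R]_m) x v :
  (forall i j, derivable (fun y => M y i j) x v) -> derivable (fun y => \det (M y)) x v.
Proof.
move=> dM; rewrite /determinant; apply: derivable_bigsum => s.
by apply: derivable_cstM; exact: derivable_bigprod.
Qed.

Lemma derivable_invmx m (M : V -> 'M[R]_m) x v k l :
  (\forall y \near x, M y \in unitmx) ->
  (forall i j, derivable (fun y => M y i j) x v) ->
  derivable (fun y => invmx (M y) k l) x v.
Proof.
move=> uM dM.
have dd : derivable (fun y => (\det (M y))^-1) x v.
  apply: derivableV; last exact: derivable_det.
  by rewrite -unitfE -unitmxE; exact: nbhs_singleton uM.
have da : derivable (fun y => \adj (M y) k l) x v.
  rewrite (_ : (fun y => _) = (fun y => cofactor (M y) l k)); last first.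
    by apply: funext => y; rewrite mxE.
  apply: derivable_cstM; apply: derivable_det => i j.
  rewrite (_ : (fun y => _) = (fun y => M y (lift l i) (lift k j))) //.
  by apply: funext => y; rewrite !mxE.
apply: (@near_eq_derivable _ _ _ ((fun y => (\det (M y))^-1) * (fun y => \adj (M y) k l))).
  apply: filterS uM => y uMy; rewrite /invmx uMy mxE //.
exact: derivableM.
Qed.

Variables (U : set V) (oU : open U) (f : V -> R) (sf : smooth_on U f).
Hypothesis uH : forall y, U y -> hessian f y \in unitmx.

Definition third f (i : 'I_n) x : 'M[R]_n :=
  \matrix_(k, l) pderive i (pderive k (pderive l f)) x.

Let Gam (i : 'I_n) y : 'M[R]_n := \matrix_(k, j) christoffel (hessian f) k i j y.

Lemma hessian_fun (j l : 'I_n) : (fun y => hessian f y j l) = pderive j (pderive l f).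
Proof. by apply: funext => y; rewrite mxE. Qed.

Lemma third_sym i x : U x -> (third f i x)^T = third f i x.
Proof.
move=> Ux; apply/matrixP => k l; rewrite !mxE.
have oUx : \forall y \near x, U y by exact: open_nbhs_nbhs.
by apply: near_eq_derive; apply: filterS oUx => y Uy; exact: (pderiveC _ _ oU sf Uy).
Qed.

Lemma pderive3_rot (i j l : 'I_n) x : U x ->
  pderive j (pderive i (pderive l f)) x = pderive i (pderive j (pderive l f)) x.
Proof. by move=> Ux; apply: (pderiveC j i oU (smooth_pderive l sf) Ux). Qed.

(** For a Hessian metric the three derivatives in a Christoffel symbol are equal. *)
Lemma christoffel_hessian i y : U y ->
  Gam i y = 2^-1 *: (invmx (hessian f y) *m third f i y).
Proof.
move=> Uy; apply/matrixP => k j; rewrite !mxE /christoffel; congr (_ * _).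
apply: eq_bigr => l _; congr (_ * _); rewrite !hessian_fun mxE.
have E1 : pderive i (pderive j (pderive l f)) y = pderive i (pderive l (pderive j f)) y.
  by have /matrixP/(_ l j) := third_sym i Uy; rewrite !mxE.
have E2 : pderive j (pderive i (pderive l f)) y = pderive i (pderive l (pderive j f)) y.
 exact: (eq_trans (pderive3_rot i j l Uy) E1).
have E3 : pderive l (pderive i (pderive j f)) y = pderive i (pderive l (pderive j f)) y.
  exact: pderive3_rot.
have collapse (a b c e : R) : a = e -> b = e -> c = e -> a + b - c = e.
  by move=> -> -> ->; ring.
exact: collapse E1 E2 E3.
Qed.

Lemma hessian_christoffel i y : U y ->
  hessian f y *m Gam i y = 2^-1 *: third f i y.
Proof.
by move=> Uy; rewrite christoffel_hessian // -scalemxAr mulmxA mulmxV ?mul1mx // uH.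
Qed.

Definition fourth (i j : 'I_n) x : 'M[R]_n :=
  \matrix_(k, l) pderive i (pderive j (pderive k (pderive l f))) x.

Definition dGam (i j : 'I_n) x : 'M[R]_n :=
  \matrix_(k, l) pderive i (christoffel (hessian f) k j l) x.

Lemma dGamE i j x k l : dGam i j x k l = pderive i (christoffel (hessian f) k j l) x.
Proof. by rewrite mxE. Qed.

Lemma GamE i x k l : Gam i x k l = christoffel (hessian f) k i l x.
Proof. by rewrite mxE. Qed.

Lemma fourthE i j x k l :
  fourth i j x k l = pderive i (pderive j (pderive k (pderive l f))) x.
Proof. by rewrite mxE. Qed.

Lemma derivable_christoffel (i k j l : 'I_n) x : U x -> derivable (christoffel (hessian f) k j l) x (e_ i).
Proof.
move=> Ux; have oUx : \forall y \near x, U y by exact: open_nbhs_nbhs.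
apply: (@near_eq_derivable _ _ _ (fun y =>
  2^-1 * \sum_m invmx (hessian f y) k m * pderive j (pderive m (pderive l f)) y)).
  apply: filterS oUx => y Uy.
  have /matrixP/(_ k l) := christoffel_hessian j Uy.
  rewrite !mxE => ->; congr (_ * _); apply: eq_bigr => m _; by rewrite mxE.
apply: derivable_cstM.
apply: derivable_bigsum => m; apply: derivableM.
  apply: derivable_invmx => [|a b]; first by apply: filterS oUx; exact: uH.
  rewrite hessian_fun; apply: smooth_derivable Ux.
  by do 2![apply: smooth_pderive].
apply: smooth_derivable Ux; by do 3![apply: smooth_pderive].
Qed.

(** The product rule for [hessian_christoffel], which dispenses with a formula for
    the derivative of an inverse matrix. *)
Lemma pderive_hessian_christoffel i j x : U x ->
  third f i x *m Gam j x + hessian f x *m dGam i j x = 2^-1 *: fourth i j x.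
Proof.
move=> Ux; apply: mulmxD_entries => k l.
have F4 : fourth i j x k l = pderive i (pderive j (pderive k (pderive l f))) x by rewrite mxE.
have oUx : \forall y \near x, U y by exact: open_nbhs_nbhs.
have D m : is_derive x (e_ i) (fun y => hessian f y k m * christoffel (hessian f) m j l y)
   (third f i x k m * Gam j x m l + hessian f x k m * dGam i j x m l).
  have D1 : is_derive x (e_ i) (fun y => hessian f y k m) (third f i x k m).
    rewrite hessian_fun mxE; apply/derivableP; apply: smooth_derivable Ux.
    by do 2![apply: smooth_pderive].
  have D2 : is_derive x (e_ i) (christoffel (hessian f) m j l) (dGam i j x m l).
    by rewrite mxE; apply/derivableP; exact: derivable_christoffel.
  have G0 : Gam j x m l = christoffel (hessian f) m j l x by rewrite mxE.
  apply: (@is_derive_eq _ _ _ _ _ _ _ _ (is_deriveM D1 D2)).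
  have aux (A B C D B' : R) : B' = B -> C *: D + B *: A = A * B' + C * D.
    by move=> ->; rewrite /GRing.scale /= addrC (mulrC B).
  exact: aux G0.
have DS : is_derive x (e_ i) (fun y => \sum_m hessian f y k m * christoffel (hessian f) m j l y)
    (\sum_m (third f i x k m * Gam j x m l + hessian f x k m * dGam i j x m l)) by exact: is_derive_bigsum.
have DR : is_derive x (e_ i) (fun y => 2^-1 * pderive j (pderive k (pderive l f)) y)
     (2^-1 * pderive i (pderive j (pderive k (pderive l f))) x).
  apply: is_deriveZ; apply/derivableP; apply: smooth_derivable Ux.
  by do 3![apply: smooth_pderive].
have NE : \forall y \near x, \sum_m hessian f y k m * christoffel (hessian f) m j l y
    = 2^-1 * pderive j (pderive k (pderive l f)) y.
  apply: filterS oUx => y Uy.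
  have /matrixP/(_ k l) := hessian_christoffel j Uy.
  have T3 : (2^-1 *: third f j y) k l = 2^-1 * pderive j (pderive k (pderive l f)) y.
    by rewrite !mxE.
  have HG : (hessian f y *m Gam j y) k l
     = \sum_m hessian f y k m * christoffel (hessian f) m j l y.
    have G1 m : Gam j y m l = christoffel (hessian f) m j l y by rewrite mxE.
    by rewrite mulmx_entry; apply: eq_bigr => m _; rewrite G1.
  by move=> E; exact: (eq_trans (esym HG) (eq_trans E T3)).
have [_ E1] := DR; have [_ E2] := near_eq_is_derive NE DS.
apply: (eq_trans (esym E2)); apply: (eq_trans E1).
exact: (congr1 (fun z => 2^-1 * z) (esym F4)).
Qed.

(** The fourth derivatives cancel in the curvature of a Hessian metric, which is
    thus a commutator of cubic forms. *)
Lemma flat_third_comm i j x : U x -> flat_on U (hessian f) ->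
  third f i x *m invmx (hessian f x) *m third f j x
  = third f j x *m invmx (hessian f x) *m third f i x.
Proof.
move=> Ux flat; have uHx := uH Ux.
have R0 : dGam i j x - dGam j i x + (Gam i x *m Gam j x - Gam j x *m Gam i x) = 0.
  apply/matrixP => l k; have := flat x Ux l i j k; rewrite /riemann => R0.
  have D1 : dGam i j x l k = pderive i (christoffel (hessian f) l j k) x by exact: dGamE.
  have D2 : dGam j i x l k = pderive j (christoffel (hessian f) l i k) x by exact: dGamE.
  have G a b c : Gam a x b c = christoffel (hessian f) b a c x by exact: GamE.
  have GG a b : (Gam a x *m Gam b x) l k
      = \sum_m christoffel (hessian f) l a m x * christoffel (hessian f) m b k x.
    by rewrite mulmx_entry; apply: eq_bigr => m _; rewrite !G.
  have S : (dGam i j x - dGam j i x + (Gam i x *m Gam j x - Gam j x *m Gam i x)) l k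
     = dGam i j x l k - dGam j i x l k + ((Gam i x *m Gam j x) l k - (Gam j x *m Gam i x) l k).
    exact: mx_entry4.
  apply: (eq_trans S); apply: (eq_trans (sub_congr4 D1 D2 (GG i j) (GG j i))).
  apply: (eq_trans _ (esym (mxE _ _ _ _))); apply: (eq_trans _ R0).
  exact: (congr1 (fun z => _ + z) (esym (sumrB _ _ _ _))).
have F : fourth i j x = fourth j i x.
  apply/matrixP => k l.
  have F1 := fourthE i j x k l.
  have F2 := fourthE j i x k l.
  apply: (eq_trans F1); apply: eq_trans (esym F2).
  exact: (pderiveC i j oU (smooth_pderive k (smooth_pderive l sf)) Ux).
have P1 := pderive_hessian_christoffel i j Ux.
have P2 := pderive_hessian_christoffel j i Ux.
have C1 := christoffel_hessian i Ux; have C2 := christoffel_hessian j Ux.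
have Q1 := hessian_christoffel i Ux; have Q2 := hessian_christoffel j Ux.
move: R0 P1 P2 C1 C2 Q1 Q2; rewrite F.
exact: flat_algebra.
Qed.

End HessianCurvature.

(** * Contracting the flatness equation *)

Section FlatContraction.
Variables (R : realType) (n : nat).
Local Notation V := 'rV[R]_n.
Implicit Types (x y u v w e : V).

Lemma dotp_mxE u v : dotp u v = (u *m v^T) 0 0.
Proof. by rewrite mxE; apply: eq_bigr => i _; rewrite mxE. Qed.

Lemma dotp_mulmx u v (A : 'M[R]_n) : dotp (u *m A) v = dotp u (v *m A^T).
Proof. by rewrite !dotp_mxE trmx_mul trmxK mulmxA. Qed.

Lemma mulmx_row_entry v (A : 'M[R]_n) l : (v *m A) 0 l = \sum_k v 0 k * A k l.
Proof. by rewrite mxE. Qed.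

Lemma mulmx3_scale_comm (A B H : 'M[R]_n) (a b : R) : A *m H *m B = B *m H *m A ->
  (a *: A) *m H *m (b *: B) = (b *: B) *m H *m (a *: A).
Proof. by move=> AB; rewrite -!scalemxAl -!scalemxAr AB !scalerA mulrC. Qed.

Lemma dotp_inj u v : (forall w, dotp u w = dotp v w) -> u = v.
Proof.
move=> H; apply/eqP; rewrite -subr_eq0 -dotp_eq0; apply/eqP.
by rewrite dotpBl H subrr.
Qed.

Variables (U : set V) (oU : open U) (f : V -> R) (sf : smooth_on U f).
Hypothesis uH : forall y, U y -> hessian f y \in unitmx.

Lemma hessian_tr x : U x -> (hessian f x)^T = hessian f x.
Proof.
move=> Ux; apply/matrixP => i j.
have E k l : hessian f x k l = pderive k (pderive l f) x by rewrite mxE.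
have T : (hessian f x)^T i j = hessian f x j i by rewrite mxE.
by apply: (eq_trans T); apply: (eq_trans (E _ _)); apply: eq_trans (esym (E _ _));
  exact: (pderiveC j i oU sf Ux).
Qed.

Lemma dotp_hessian x v w : dotp (v *m hessian f x) w = diff2 f x w v.
Proof.
rewrite diff2E exchange_big /=; rewrite dotp_mxE -mulmxA mxE; apply: eq_bigr => i _.
rewrite mxE mulr_sumr; apply: eq_bigr => j _.
have E k l : hessian f x k l = pderive k (pderive l f) x by rewrite mxE.
by rewrite E mxE; ring.
Qed.

Definition cubic x u : 'M[R]_n := \sum_i u 0 i *: third f i x.

Lemma thirdE i x k l : third f i x k l = pderive i (pderive k (pderive l f)) x.
Proof. by rewrite mxE. Qed.

Lemma third_diff3 i k l x : U x ->
  pderive l (pderive k (pderive i f)) x = third f i x k l.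
Proof.
move=> Ux.
have A2 : pderive k (pderive l (pderive i f)) x = pderive k (pderive i (pderive l f)) x.
  have /matrixP/(_ i l) := third_sym oU sf k Ux; rewrite [_^T _ _]mxE => A2.
  by apply: (eq_trans (esym (thirdE k x l i))); apply: eq_trans (thirdE k x i l).
have A3 := pderive3_rot oU sf i k l Ux.
have A4 := pderive3_rot oU sf k l i Ux.
apply: eq_trans (esym (thirdE i x k l)).
exact: (eq_trans A4 (eq_trans A2 A3)).
Qed.

Lemma dotp_cubic x u v w : U x -> dotp (v *m cubic x u) w = diff3 f x u v w.
Proof.
move=> Ux; rewrite /cubic mulmx_sumr /dotp.
have E i : diff2 (pderive i f) x v w = dotp (v *m third f i x) w.
  rewrite diff2E exchange_big; apply: eq_bigr => l _; rewrite mulmx_row_entry mulr_suml.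
  apply: eq_bigr => k _; exact: (congr1 (fun z => v 0 k * z * w 0 l) (third_diff3 i k l Ux)).
rewrite /diff3; under [RHS]eq_bigr do rewrite E mulrC -dotpZl.
under [RHS]eq_bigr do rewrite scalemxAr.
by rewrite /dotp exchange_big; apply: eq_bigr => l _; rewrite summxE mulr_suml.
Qed.

Lemma flat_cubic_comm x u v : U x -> flat_on U (hessian f) ->
  cubic x u *m invmx (hessian f x) *m cubic x v
  = cubic x v *m invmx (hessian f x) *m cubic x u.
Proof.
move=> Ux flat; rewrite /cubic !mulmx_suml.
under eq_bigr do rewrite mulmx_sumr.
under [RHS]eq_bigr do rewrite mulmx_sumr.
rewrite exchange_big; apply: eq_bigr => j _; apply: eq_bigr => i _.
exact: (mulmx3_scale_comm _ _ (flat_third_comm oU sf uH i j Ux flat)).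
Qed.

(** The commutation of the cubic forms of [v] and [e], contracted with [e] and [v]:
    by the hypotheses [e] and [v] are eigenvectors of the form of [v], and the
    inverse Hessian sends them to multiples of [e] and [w]. *)
Lemma flat_contraction x e w v (lam G l1 kp : R) : U x -> flat_on U (hessian f) ->
  lam != 0 -> G != 0 ->
  (forall z, diff2 f x e z = lam * dotp e z) ->
  (forall z, diff2 f x w z = G * dotp v z) ->
  (forall z, diff3 f x v e z = l1 * dotp e z) ->
  (forall z, diff3 f x v v z = kp * dotp v z) ->
  l1 / lam * diff3 f x e e v = kp / G * diff3 f x e e w.
Proof.
move=> Ux flat l0 G0 He Hw Te Tv; have uHx := uH Ux.
have eH : e *m hessian f x = lam *: e.
  by apply: dotp_inj => z; rewrite dotp_hessian (diff2C oU _ _ sf Ux) He dotpZl.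
have wH : w *m hessian f x = G *: v.
  by apply: dotp_inj => z; rewrite dotp_hessian (diff2C oU _ _ sf Ux) Hw dotpZl.
have eT : e *m cubic x v = l1 *: e by apply: dotp_inj => z; rewrite dotp_cubic // Te dotpZl.
have vT : v *m cubic x v = kp *: v by apply: dotp_inj => z; rewrite dotp_cubic // Tv dotpZl.
have eHi : e *m invmx (hessian f x) = lam^-1 *: e.
  by rewrite -[X in X *m _](scalerK l0) -eH -scalemxAl mulmxK.
have vHi : v *m invmx (hessian f x) = G^-1 *: w.
  by rewrite -[X in X *m _](scalerK G0) -wH -scalemxAl mulmxK.
have HiT : (invmx (hessian f x))^T = invmx (hessian f x).
  by rewrite trmx_inv hessian_tr.
have cT : (cubic x v)^T = cubic x v.
  rewrite /cubic linear_sum; apply: eq_bigr => i _ /=; rewrite linearZ /=.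
  by rewrite (third_sym oU sf i Ux).
have := congr1 (fun A => dotp (e *m A) v) (flat_cubic_comm v e Ux flat).
rewrite /= !mulmxA eT -!scalemxAl eHi -!scalemxAl scalerA dotpZl dotp_cubic // => ->.
rewrite -mulmxA dotp_mulmx trmx_mul cT HiT mulmxA vT -scalemxAl vHi scalerA dotpZr.
by rewrite dotp_cubic.
Qed.

End FlatContraction.

(** * The differential equation of the profile *)

Section ProfileODE.
Variable R : realType.
Implicit Types (s t u : R).

Lemma scale_mulE (a b : R) : a *: b = a * b.
Proof. by []. Qed.

Lemma right_zero_derive (g : R -> R) (l r : R) : is_derive (0 : R) 1 g l -> 0 < r ->
  (forall s, 0 < s < r -> g s = 0) -> g 0 = 0 /\ l = 0.
Proof.
move=> dg r0 g0.
have bd (e : R) : 0 < e -> exists2 m : R, 0 < m & forall s, 0 < s < m -> `|g 0 + l * s| <= e * s.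
  move=> e0; have [r1 r10 H] := is_derive_bound dg e0.
  exists (Num.min r r1); first by rewrite lt_min r0.
  move=> s /andP[s0]; rewrite lt_min => /andP[sr sr1].
  have := H s; rewrite add0r g0 ?s0 // gtr0_norm // => /(_ sr1).
  by rewrite -normrN; congr (`|_| <= _); ring.
have gz : g 0 = 0.
  apply/eqP; rewrite -normr_le0; apply/ler_addgt0Pl => e e0; rewrite addr0.
  have [m m0 H] := bd 1 ltr01.
  have l1 : 0 < `|l| + 1 by rewrite ltr_wpDl.
  pose s := Num.min (m / 2) (e / (`|l| + 1)).
  have s0 : 0 < s by rewrite lt_min !divr_gt0.
  have sm : s < m by rewrite gt_min; apply/orP; left; lra.
  have se : s <= e / (`|l| + 1) by rewrite ge_min lexx orbT.
  have := H s; rewrite s0 sm mul1r => /(_ isT) H1.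
  rewrite (_ : g 0 = (g 0 + l * s) - l * s); last ring.
  apply: le_trans (ler_normB _ _) _; rewrite normrM (gtr0_norm s0).
  apply: (@le_trans _ _ (s + `|l| * s)); first by rewrite lerD2r.
  have : s * (`|l| + 1) <= e by rewrite -ler_pdivlMr.
  by rewrite mulrDr mulr1 addrC mulrC.
split => //; apply/eqP; rewrite -normr_le0; apply/ler_addgt0Pl => e e0; rewrite addr0.
have [m m0 H] := bd e e0.
have m2 : 0 < m / 2 by rewrite divr_gt0.
have m2m : m / 2 < m by lra.
have := H (m / 2); rewrite m2 m2m gz add0r normrM (gtr0_norm m2) => /(_ isT).
by rewrite ler_pM2r.
Qed.

Lemma derive0_itv_const (g : R -> R) (dg : R -> R) (a b : R) :
  (forall s, is_derive s 1 g (dg s)) -> (forall s, a < s < b -> dg s = 0) ->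
  a <= b -> g a = g b.
Proof.
move=> Dg dg0; rewrite le_eqVlt => /orP[/eqP -> //|ab].
have cg : {within `[a, b], continuous g}.
  by apply: derivable_within_continuous => s _; have [] := Dg s.
have [c + E] := @MVT R g dg a b ab (fun s _ => Dg s) cg.
rewrite in_itv /= => /dg0 dc; move: E; rewrite dc mul0r => /eqP; rewrite subr_eq0 => /eqP //.
Qed.

(** In the application [h] is the energy along the arc, [lam] the Hessian in a
    direction focusing at the start of the arc, and [G] the squared length of the
    part of the velocity that is orthogonal to the position, all for the Hessian
    metric; [flatE] is what flatness says. *)
Section Profile.
Variables (h h1 h2 kp lam lam1 : R -> R) (t1 : R).
Hypothesis t1pi : 0 < t1 <= pi.
Hypothesis dh : forall u, is_derive u 1 h (h1 u).
Hypothesis dh1 : forall u, is_derive u 1 h1 (h2 u).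
Hypothesis dh2 : forall u, is_derive u 1 h2 (kp u - 4 * h1 u).
Hypothesis dlam : forall u, is_derive u 1 lam (lam1 u).
Hypothesis h_gt0 : forall u, 0 < h u.
Hypothesis lam_gt0 : forall u, 0 < lam u.
Let G u := 2 * h u + h2 u - h1 u ^+ 2 / (2 * h u).
Hypothesis G_gt0 : forall u, 0 < G u.
Hypothesis lamE : forall u, 0 < u < t1 -> lam u * sin u = 2 * h u * sin u + h1 u * cos u.
Hypothesis flatE : forall u, 0 < u < t1 -> lam1 u / lam u * lam1 u = kp u / G u * lam1 u.

Let m u := h1 u * sin u + (2 * h u + h2 u - lam u) * cos u.
Let dm u := (3 * h1 u + (kp u - 4 * h1 u) - lam1 u) * cos u + (lam u - 2 * h u) * sin u.

Let is_derive_m u : is_derive u 1 m (dm u).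
Proof.
have D1 := is_deriveM (dh1 u) (is_derive_sin u).
have D2 := is_deriveB (is_deriveD (is_deriveZ 2 (dh u)) (dh2 u)) (dlam u).
have D3 := is_deriveD D1 (is_deriveM D2 (is_derive_cos u)).
apply: (@is_derive_eq _ _ _ _ _ _ _ _ D3).
rewrite (_ : (2 \*: h + h2 - lam) u = 2 * h u + h2 u - lam u) // !scale_mulE /dm; ring.
Qed.

Let sin_gt0 u : 0 < u < t1 -> 0 < sin u.
Proof.
case/andP: t1pi => _ t1p /andP[u0 ut]; rewrite sin_gt0_pi // u0.
exact: lt_le_trans t1p.
Qed.

Let psi u := lam u * sin u - (2 * h u * sin u + h1 u * cos u).
Let is_derive_psi u : is_derive u 1 psi (lam1 u * sin u - m u).
Proof.
have D1 := is_deriveM (dlam u) (is_derive_sin u).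
have D2 := is_deriveM (is_deriveZ 2 (dh u)) (is_derive_sin u).
have D3 := is_deriveM (dh1 u) (is_derive_cos u).
have D4 := is_deriveB D1 (is_deriveD D2 D3).
apply: (@is_derive_eq _ _ _ _ _ _ _ _ D4).
rewrite (_ : (2 \*: h) u = 2 * h u) // !scale_mulE /m; ring.
Qed.

Let psi0 u : 0 < u < t1 -> psi u = 0.
Proof. by move=> /lamE H; rewrite /psi H subrr. Qed.

Let m_lam1 u : 0 < u < t1 -> m u = lam1 u * sin u.
Proof.
move=> ut; apply/esym/eqP; rewrite -subr_eq0; apply/eqP.
apply: near_is_derive_eq (is_derive_psi u) (is_derive_cst (0 : R) u (1 : R)) _.
by apply: filterS (near_between ut) => s /psi0.
Qed.

Let m_at0 : m 0 = 0.
Proof.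
have [_] := right_zero_derive (is_derive_psi 0) (proj1 (andP t1pi)) psi0.
by rewrite sin0 mulr0 sub0r => /eqP; rewrite oppr_eq0 => /eqP.
Qed.

Let K u := m u ^+ 2 / (lam u * G u).

Let is_derive_G u : is_derive u 1 G (kp u - G u * h1 u / h u).
Proof.
have hu : h u != 0 by rewrite gt_eqF.
have h2u : (2 *: h) u != 0 by rewrite mulf_neq0 // pnatr_eq0.
have D1 := is_deriveD (is_deriveZ 2 (dh u)) (dh2 u).
have D2 := is_deriveM (dh1 u) (dh1 u).
have D3 := is_deriveV h2u (is_deriveZ 2 (dh u)).
have D4 := is_deriveB D1 (is_deriveM D2 D3).
apply: (@is_derive_eq _ _ _ _ _ _ _ _ D4).
rewrite (_ : (2 *: h) u = 2 * h u) // (_ : (h1 * h1) u = h1 u * h1 u) //.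
by rewrite !scale_mulE /G; field.
Qed.

Let is_derive_K u : is_derive u 1 K
  ((2 * m u * dm u * (lam u * G u) - m u ^+ 2 * (lam1 u * G u + lam u * (kp u - G u * h1 u / h u)))
    / (lam u * G u) ^+ 2).
Proof.
have l0 : lam u != 0 by rewrite gt_eqF.
have G0 : G u != 0 by rewrite gt_eqF.
have hu : h u != 0 by rewrite gt_eqF.
have lG : (lam * G) u != 0 by rewrite mulf_neq0.
have D1 := is_deriveM (is_derive_m u) (is_derive_m u).
have D2 := is_deriveV lG (is_deriveM (dlam u) (is_derive_G u)).
have D3 := is_deriveM D1 D2.
apply: (@is_derive_eq _ _ _ _ _ _ _ _ D3).
rewrite (_ : (m * m) u = m u * m u) // (_ : (lam * G) u = lam u * G u) // !scale_mulE.
by move: (G u) G0 => g g0; field; rewrite ?l0 ?hu ?g0.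
Qed.

(** By [flatE], [K] is a first integral.  As [m] vanishes at the focal point
    while [lam] and [G] do not, [K] is zero, and so is [m = lam1 * sin]. *)
Let lam1_eq0 u : 0 < u < t1 -> lam1 u = 0.
Proof.
have dK0 s : 0 < s < t1 ->
    (2 * m s * dm s * (lam s * G s) - m s ^+ 2 * (lam1 s * G s + lam s * (kp s - G s * h1 s / h s)))
    / (lam s * G s) ^+ 2 = 0.
  move=> st; have mE := m_lam1 st; have [l10|l10] := eqVneq (lam1 s) 0.
    by rewrite mE l10; ring.
  have l0 : lam s != 0 by rewrite gt_eqF.
  have G0 : G s != 0 by rewrite gt_eqF.
  have hs : h s != 0 by rewrite gt_eqF.
  have kE : kp s * lam s = lam1 s * G s.
    have := flatE st => /(mulIf l10) E.
    by apply/eqP; rewrite -eqr_div // E eqxx.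
  have kpE : kp s = lam1 s * G s / lam s by rewrite -kE mulfK.
  have dmE : dm s = (kp s - lam1 s) * cos s.
    rewrite /dm (_ : (lam s - 2 * h s) * sin s = h1 s * cos s); first ring.
    by rewrite mulrBl lamE //; ring.
  have B : 2 * cos s * (G s - lam s) - (2 * m s - lam s * sin s * h1 s / h s) = 0.
    by rewrite lamE // /m /G; field.
  suff -> : 2 * m s * dm s * (lam s * G s) - m s ^+ 2 * (lam1 s * G s + lam s * (kp s - G s * h1 s / h s))
     = m s * G s * lam1 s * (2 * cos s * (G s - lam s) - (2 * m s - lam s * sin s * h1 s / h s)).
    by rewrite B mulr0 mul0r.
  rewrite dmE kpE; transitivity (m s * G s * (2 * (lam1 s * G s / lam s - lam1 s) * cos s * lam s
     - (2 * m s * lam1 s - m s * (lam s * h1 s / h s)))).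
    by move: (G s) => g; field; rewrite hs l0.
  by rewrite [in X in _ - (_ - X)]mE; move: (G s) => g; field; rewrite hs l0.
move=> ut; have /andP[u0 ut1] := ut.
have Kc s : 0 < s -> s <= u -> K s = K u.
  move=> s0 su; apply: (derive0_itv_const is_derive_K) su => r /andP[sr ru]; apply: dK0.
  by rewrite (lt_trans s0 sr) (lt_trans ru).
(* [K] without its denominator, to let [s] tend to [0] *)
pose phi s := m s * m s - K u * (lam s * G s).
have dphi s : is_derive s 1 phi (2 * m s * dm s - K u * (lam1 s * G s + lam s * (kp s - G s * h1 s / h s))).
  have D1 := is_deriveM (is_derive_m s) (is_derive_m s).
  have D2 := is_deriveZ (K u) (is_deriveM (dlam s) (is_derive_G s)).
  apply: (@is_derive_eq _ _ _ _ _ _ _ _ (is_deriveB D1 D2)).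
  rewrite !scale_mulE; ring.
have [phi0 _] : phi 0 = 0 /\ 2 * m 0 * dm 0 - K u * (lam1 0 * G 0 + lam 0 * (kp 0 - G 0 * h1 0 / h 0)) = 0.
  apply: (right_zero_derive (dphi 0) u0) => s /andP[s0 su].
  rewrite /phi -(Kc s s0 (ltW su)) /K divfK ?expr2 ?subrr //.
  by rewrite mulf_neq0 ?gt_eqF.
have Ku : K u = 0.
  move/eqP: phi0; rewrite /phi m_at0 mul0r sub0r oppr_eq0 mulf_eq0 => /orP[/eqP //|].
  by rewrite mulf_eq0 !gt_eqF.
have := m_lam1 ut; have : m u = 0.
  have lg : lam u * G u != 0 by rewrite mulf_neq0 ?gt_eqF.
  by move/eqP: Ku; rewrite /K mulf_eq0 invr_eq0 (negbTE lg) orbF sqrf_eq0 => /eqP.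
move=> -> /esym/eqP; rewrite mulf_eq0 (gt_eqF (sin_gt0 ut)) orbF => /eqP //.
Qed.

(** With [lam] constant, [lamE] is a linear equation of order one for [h], whose
    solutions are [lam / 2 + c * cos ^+ 2]; [al] is the constant [c], in a form that
    remains meaningful where the cosine vanishes. *)
Lemma profile_ode u : 0 < u < t1 ->
  h u = h 0 + h2 0 / 2 - h2 0 / 2 * cos u ^+ 2.
Proof.
move=> ut; have /andP[u0 ut1] := ut.
have lam0 s : 0 <= s -> s <= u -> lam s = lam 0.
  move=> s0 su; apply/esym; apply: (derive0_itv_const dlam _ s0) => r /andP[r0 rs].
  by apply: lam1_eq0; rewrite r0 (lt_trans rs) // (le_lt_trans su).
have m_eq0 s : 0 < s < t1 -> m s = 0 by move=> st; rewrite m_lam1 // lam1_eq0 // mul0r.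
pose B := lam 0 / 2.
pose al s := 2 * (h s - B) + h2 s / 2.
have dal s : is_derive s 1 al (kp s / 2).
  have D1 := is_deriveZ 2 (is_deriveB (dh s) (is_derive_cst B s (1 : R))).
  have D2 := is_deriveM (dh2 s) (is_derive_cst (2^-1 : R) s (1 : R)).
  apply: (@is_derive_eq _ _ _ _ _ _ _ _ (is_deriveD D1 D2)).
  by rewrite !scale_mulE /cst; field.
have kp0 s : 0 < s < t1 -> cos s != 0 -> kp s = 0.
  move=> st cs; have : dm s = 0.
    apply: near_is_derive_eq (is_derive_m s) (is_derive_cst (0 : R) s (1 : R)) _.
    by apply: filterS (near_between st) => r /m_eq0.
  move=> H; have : kp s * cos s = 0.
    rewrite -H /dm (lam1_eq0 st).
    transitivity ((kp s - h1 s) * cos s + (2 * h s * sin s + h1 s * cos s - 2 * h s * sin s)); first ring.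
    by rewrite -(lamE st); ring.
  by move/eqP; rewrite mulf_eq0 (negbTE cs) orbF => /eqP.
have al_const : al u = al 0.
  have pi0 := @pi_gt0 R; case/andP: t1pi => _ t1p.
  have c1 s : 0 < s < u -> s < pi / 2 -> kp s / 2 = 0.
    move=> /andP[s0 su] sp; rewrite kp0 ?mul0r ?s0 ?(lt_trans su) // gt_eqF // cos_gt0_pihalf // sp andbT.
    by apply: lt_trans s0; rewrite oppr_lt0 divr_gt0.
  (* [dm] says nothing on [kp] at [pi / 2], so the interval is cut there *)
  have [up|up] := leP u (pi / 2).
    apply/esym; apply: (derive0_itv_const dal _ (ltW u0)) => s /andP[s0 su].
    by apply: c1; rewrite ?s0 // (lt_le_trans su).
  have E1 : al 0 = al (pi / 2).
    apply: (derive0_itv_const dal); last by rewrite divr_ge0 // ltW.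
    by move=> s /andP[s0 su]; apply: c1; rewrite ?s0 // (lt_trans su).
  rewrite E1; apply/esym; apply: (derive0_itv_const dal _ (ltW up)) => s /andP[s0 su].
  have s00 : 0 < s by apply: lt_trans s0; rewrite divr_gt0.
  rewrite kp0 ?mul0r ?s00 ?(lt_trans su) //.
  rewrite -(subrK (pi / 2) s) cosDpihalf oppr_eq0 gt_eqF // sin_gt0_pi // subr_gt0 s0 /=.
  have sp : s < pi := lt_trans su (lt_le_trans ut1 t1p).
  by rewrite ltrBlDr (lt_trans sp) // ltrDl divr_gt0.
have hB : h u - B = al u * cos u ^+ 2.
  have lu : lam u = 2 * B by rewrite (lam0 u (ltW u0) (lexx u)) /B; field.
  have e1 : m u = 0 by exact: m_eq0.
  have e2 := lamE ut; rewrite lu in e2.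
  rewrite /m lu in e1.
  have e3 : h1 u * cos u = - (2 * (h u - B) * sin u).
    by apply/eqP; rewrite -subr_eq0; apply/eqP;
      transitivity (2 * h u * sin u + h1 u * cos u - 2 * B * sin u); [ring|rewrite -e2; ring].
  have e4 : h2 u * cos u * cos u = - (h1 u * cos u * sin u) - 2 * (h u - B) * cos u * cos u.
    transitivity ((h1 u * sin u + (2 * h u + h2 u - 2 * B) * cos u) * cos u
      - (h1 u * cos u * sin u) - 2 * (h u - B) * cos u * cos u); first ring.
    by rewrite e1; ring.
  have e5 := cos2Dsin2 u.
  rewrite /al; transitivity ((h u - B) * (cos u ^+ 2 + sin u ^+ 2)); first by rewrite e5 mulr1.
  transitivity (2 * (h u - B) * cos u ^+ 2 + (h2 u * cos u * cos u) / 2); last by field.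
  by rewrite e4 e3; field.
have lam_at0 : lam 0 = 2 * h 0 + h2 0.
  by have := m_at0; rewrite /m sin0 cos0 mulr0 add0r mulr1 => /eqP; rewrite subr_eq0 => /eqP.
have : h u = B + al 0 * cos u ^+ 2 by rewrite -al_const -hB; ring.
by rewrite /al /B lam_at0 => ->; field.
Qed.
End Profile.
End ProfileODE.

(** * Euler relations for the energy *)

Section Euler.
Variables (R : realType) (n : nat).
Local Notation V := 'rV[R]_n.
Implicit Types (x y u v w a b e : V) (s t r k : R).

Lemma open_punctured : open (punctured R n).
Proof.
rewrite (_ : punctured R n = ~` [set 0]).
  apply: closed_openC; apply: accessible_closed_set1.
  by apply: hausdorff_accessible; exact: norm_hausdorff.
by apply/seteqP; split => x /= /eqP.
Qed.

Lemma usphere_punctured : @usphere R n `<=` punctured R n.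
Proof. exact: usphere_neq0. Qed.

Variables (E : V -> R) (Es : smooth_on (punctured R n) E).
Hypothesis E2 : forall k x, 0 <= k -> E (k *: x) = k ^+ 2 * E x.

Lemma euler1 x : x != 0 -> diff1 E x x = 2 * E x.
Proof.
move=> x0; have P1 : punctured R n (0 + 1 *: x) by rewrite /punctured /= add0r scale1r.
have D1 := is_derive_comp_curve open_punctured Es P1 (is_derive_line 0 x 1).
have D2 := is_deriveM (is_deriveM (is_derive_id (1 : R) (1 : R)) (is_derive_id (1 : R) (1 : R)))
  (is_derive_cst (E x) (1 : R) (1 : R)).
rewrite scale1r add0r in D1.
rewrite (near_is_derive_eq D1 D2 _).
  by rewrite scaler0 add0r /cst !scale_mulE; ring.
have N : \forall s \near (1 : R), 0 < s < 2 by apply: near_between; rewrite ltr01 ltr1n.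
by apply: filterS N => s /andP[s0 _]; rewrite add0r E2 ?ltW.
Qed.

Lemma near_line_punctured x v : x != 0 -> \forall s \near (0 : R), x + s *: v != 0.
Proof.
move=> x0; have P1 : punctured R n (x + 0 *: v) by rewrite /punctured /= scale0r addr0.
have cc : {for (0 : R), continuous (fun s : R => x + s *: v)}.
  by apply: differentiable_continuous; apply/derivable1_diffP; have [] := is_derive_line x v 0.
have oUx : nbhs (x + 0 *: v) (punctured R n).
  by apply: open_nbhs_nbhs; split; [exact: open_punctured|exact: P1].
exact: cc oUx.
Qed.

Lemma euler2 x v : x != 0 -> diff2 E x x v = diff1 E x v.
Proof.
move=> x0; have P1 : punctured R n (x + 0 *: v) by rewrite /punctured /= scale0r addr0.
have Dc := is_derive_line x v 0.
have D1 := is_derive_diff1 open_punctured Es P1 Dc Dc.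
have D2 := is_deriveZ 2 (is_derive_comp_curve open_punctured Es P1 Dc).
have N : \forall s \near (0 : R), diff1 E (x + s *: v) (x + s *: v) = (2 *: (fun s => E (x + s *: v))) s.
  by apply: filterS (near_line_punctured v x0) => s /euler1.
have := near_is_derive_eq D1 D2 N; rewrite scale0r addr0 scale_mulE => H.
by apply/eqP; rewrite -(subr_eq0 _ _); apply/eqP; lra.
Qed.

Lemma euler3 x v w : x != 0 -> diff3 E x x w v = 0.
Proof.
move=> x0; have P1 : punctured R n (x + 0 *: v) by rewrite /punctured /= scale0r addr0.
have Dc := is_derive_line x v 0; have Dw := is_derive_cst w (0 : R) (1 : R).
have D1 := is_derive_diff2 open_punctured Es P1 Dc Dc Dw.
have D2 := is_derive_diff1 open_punctured Es P1 Dc Dw.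
have N : \forall s \near (0 : R), diff2 E (x + s *: v) (x + s *: v) (cst w s) = diff1 E (x + s *: v) (cst w s).
  by apply: filterS (near_line_punctured v x0) => s /euler2.
have := near_is_derive_eq D1 D2 N; rewrite scale0r addr0 /cst.
have -> : diff2 E x x 0 = 0 by rewrite -(scale0r x) diff2Zr mul0r.
have -> : diff1 E x 0 = 0 by rewrite -(scale0r x) diff1Z mul0r.
rewrite !addr0 (diff2C open_punctured w v Es x0) => H.
by apply/eqP; rewrite -(subr_eq0 _ _); apply/eqP; lra.
Qed.

End Euler.

(** * The Hessian metric along the reference arc *)

Section FlatProfile.
Variables (R : realType) (n : nat).
Local Notation V := 'rV[R]_n.
Implicit Types (x y u v w a b e : V) (s t r k : R).
Variables (tau : V -> R) (L : R) (dl : distance_like tau L).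
Variables (a0 b0 : V) (m0 : minimal_arc tau a0 b0 L).
Variables (p : V -> R) (sp : smooth_on setT p).
Hypothesis ptau : forall x y, usphere x -> usphere y -> tau x = tau y -> p x = p y.
Hypothesis preg : forall x, usphere x -> 0 < tau x < L -> sphere_grad p x != 0.
Variables (sg : R) (sg1 : sg = 1 \/ sg = -1).
Hypothesis sgdq : forall t, 0 < t < L -> 0 < sg * diff1 p (arc a0 b0 t) (arc b0 (- a0) t).
Variables (E : V -> R) (Es : smooth_on (punctured R n) E).
Hypothesis E2 : forall k x, 0 <= k -> E (k *: x) = k ^+ 2 * E x.
Hypothesis E_gt0 : forall x, x != 0 -> 0 < E x.
Hypothesis Epd : forall x, x != 0 -> posdef_mx (hessian E x).
Hypothesis Eflat : flat_on (punctured R n) (hessian E).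
Hypothesis Etau : forall x y, usphere x -> usphere y -> tau x = tau y -> E x = E y.

Let oP := @open_punctured R n.
Let g t := arc a0 b0 t.
Let nu t := arc b0 (- a0) t.
Let gS t : usphere (g t). Proof. exact: arc_usphere m0.1. Qed.
Let g0 t : g t != 0. Proof. exact: usphere_neq0. Qed.

Lemma hessian_unit y : y != 0 -> hessian E y \in unitmx.
Proof.
move=> y0; rewrite unitmxE unitfE; apply/negP => /det0P [v v0 vH].
by have := Epd y0 v0; rewrite vH mul0mx mxE ltxx.
Qed.

Lemma diff2_pos y v : y != 0 -> v != 0 -> 0 < diff2 E y v v.
Proof. by move=> y0 v0; have := Epd y0 v0; rewrite -dotp_mxE dotp_hessian. Qed.

Let h t := E (g t).
Let h1 t := diff1 E (g t) (nu t).
Let h2 t := diff2 E (g t) (nu t) (nu t) - 2 * h t.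
Let kp t := diff3 E (g t) (nu t) (nu t) (nu t).

Let dg t : is_derive t 1 g (nu t). Proof. exact: is_derive_arc. Qed.
Let dnu t : is_derive t 1 nu (- g t).
Proof. by rewrite -[- g t]arcN; exact: is_derive_arc. Qed.

Lemma is_derive_h t : is_derive t 1 h (h1 t).
Proof. exact: (is_derive_comp_curve oP Es (g0 t) (dg t)). Qed.

Lemma is_derive_h1 t : is_derive t 1 h1 (h2 t).
Proof.
apply: is_derive_eq; first exact: (is_derive_diff1 oP Es (g0 t) (dg t) (dnu t)).
by rewrite diff1N (euler1 Es E2) // /h2.
Qed.

Lemma is_derive_h2 t : is_derive t 1 h2 (kp t - 4 * h1 t).
Proof.
have D1 := is_derive_diff2 oP Es (g0 t) (dg t) (dnu t) (dnu t).
have D2 := is_deriveZ 2 (is_derive_h t).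
apply: (@is_derive_eq _ _ _ _ _ _ _ _ (is_deriveB D1 D2)).
rewrite diff2Nl diff2Nr (diff2C oP _ (g t) Es (g0 t)) (euler2 Es E2) // scale_mulE /kp /h1; ring.
Qed.

Variable e : V.
Hypothesis ee : dotp e e = 1.
Hypothesis ae : dotp a0 e = 0.
Hypothesis be : dotp b0 e = 0.
Variable t1 : R.
Hypothesis t1L : 0 < t1 < L.
Hypothesis de : douter_normal p sg (g t1) e = (cos t1 / sin t1) *: e.

Let ge t : dotp (g t) e = 0. Proof. by rewrite /g /arc dotpDl !dotpZl ae be !mulr0 addr0. Qed.
Let nue t : dotp (nu t) e = 0.
Proof. by rewrite /nu /arc dotpDl !dotpZl dotpNl ae be oppr0 !mulr0 addr0. Qed.
Let mg t : t <= L -> minimal_arc tau a0 b0 t. Proof. by move=> tL; exact: minimal_arc_le m0. Qed.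
Let e0 : e != 0. Proof. by rewrite -dotp_eq0 ee oner_neq0. Qed.

Let lam t := diff2 E (g t) e e.
Let lam1 t := diff3 E (g t) e e (nu t).

Lemma is_derive_lam t : is_derive t 1 lam (lam1 t).
Proof.
have De := is_derive_cst e t (1 : R).
apply: is_derive_eq; first exact: (is_derive_diff2 oP Es (g0 t) (dg t) De De).
by rewrite /cst -(scale0r e) diff2Zl diff2Zr !mul0r !addr0.
Qed.

Lemma sin_gt0_L t : 0 < t -> t < L -> 0 < sin t.
Proof. by move=> t0 tL; rewrite sin_gt0_pi // t0 (lt_le_trans tL) // (dl_lepi dl). Qed.

(** A direction focusing at the focal set, seen from the distance [t1], does so
    from every smaller distance. *)
Lemma douter_normal_focusing t : 0 < t -> t <= t1 -> douter_normal p sg (g t) e = (cos t / sin t) *: e.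
Proof.
move=> t0 tt1; have /andP[t10 t1L'] := t1L.
have st1 := sin_gt0_L t10 t1L'; have st := sin_gt0_L t0 (le_lt_trans tt1 t1L').
have s0 : 0 <= t1 - t by rewrite subr_ge0.
have st' : t1 - t < t1 by rewrite gtrBl.
have := douter_normal_flow dl m0 sp ptau preg sg1 sgdq (mg (ltW t1L')) t10 t1L' s0 st' ee (ge t1) de.
rewrite (_ : t1 - (t1 - t) = t) -/(g t) => [H|]; last ring.
have c1 : cos (t1 - t) - cos t1 / sin t1 * sin (t1 - t) = sin t / sin t1.
  rewrite cosB sinB; have := cos2Dsin2 t1 => C; apply: (mulIf (lt0r_neq0 st1)).
  rewrite divfK ?gt_eqF // -[RHS]mulr1 -C; field; exact: lt0r_neq0.
have c2 : cos t1 / sin t1 * cos (t1 - t) + sin (t1 - t) = cos t / sin t1.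
  rewrite cosB sinB; have := cos2Dsin2 t1 => C; apply: (mulIf (lt0r_neq0 st1)).
  rewrite divfK ?gt_eqF // -[RHS]mulr1 -C; field; exact: lt0r_neq0.
rewrite c1 c2 in H.
have k0 : sin t / sin t1 != 0 by rewrite mulf_neq0 ?invr_eq0 ?lt0r_neq0.
rewrite -[LHS](scalerK k0) H scalerA; congr (_ *: _).
by field; rewrite !lt0r_neq0.
Qed.

Lemma diff1_g_split t v : 0 < t -> t < L ->
  diff1 E (g t) v = 2 * h t * dotp (g t) v + h1 t * dotp (nu t) v.
Proof.
move=> t0 tL.
have := diff1_split dl m0 oP (@usphere_punctured R n) Es Etau v (mg (ltW tL)) t0 tL.
by rewrite -/(g t) (euler1 Es E2).
Qed.

(** The splitting of the gradient, differentiated along the arc. *)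
Lemma diff2_nu t v : 0 < t -> t < L ->
  diff2 E (g t) (nu t) v = h1 t * dotp (g t) v + (2 * h t + h2 t) * dotp (nu t) v.
Proof.
move=> t0 tL; have Dv := is_derive_cst v t (1 : R).
have D1 := is_derive_diff1 oP Es (g0 t) (dg t) Dv.
have Pg := is_derive_dotp (dg t) Dv; have Pn := is_derive_dotp (dnu t) Dv.
have D2 := is_deriveD (is_deriveM (is_deriveZ 2 (is_derive_h t)) Pg) (is_deriveM (is_derive_h1 t) Pn).
have N : \forall s \near t, diff1 E (g s) (cst v s) =
   (((2 *: h) * (fun s => dotp (g s) (cst v s))) + (h1 * (fun s => dotp (nu s) (cst v s)))) s.
  have tb : 0 < t < L by rewrite t0.
  by apply: filterS (near_between tb) => s /andP[s0 sL]; rewrite /cst diff1_g_split.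
have := near_is_derive_eq D1 D2 N; rewrite /cst.
have z w : dotp w 0 = 0 by rewrite -(scale0r w) dotpZr mul0r.
rewrite !z (_ : diff1 E (g t) 0 = 0) ?addr0; last exact: z.
rewrite (diff2C oP v (nu t) Es (g0 t)) !scale_mulE dotpNl => ->.
by rewrite (_ : (2 \*: h) t = 2 * h t) //; ring.
Qed.

(** The formula [diff2_nu], differentiated along the arc. *)
Lemma diff3_nu t v : 0 < t -> t < L ->
  diff3 E (g t) (nu t) (nu t) v = kp t * dotp (nu t) v.
Proof.
move=> t0 tL; have Dv := is_derive_cst v t (1 : R).
have D1 := is_derive_diff2 oP Es (g0 t) (dg t) (dnu t) Dv.
have Pg := is_derive_dotp (dg t) Dv; have Pn := is_derive_dotp (dnu t) Dv.
have D2 := is_deriveD (is_deriveM (is_derive_h1 t) Pg)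
  (is_deriveM (is_deriveD (is_deriveZ 2 (is_derive_h t)) (is_derive_h2 t)) Pn).
have N : \forall s \near t, diff2 E (g s) (nu s) (cst v s) =
   ((h1 * (fun s => dotp (g s) (cst v s))) + ((2 *: h + h2) * (fun s => dotp (nu s) (cst v s)))) s.
  have tb : 0 < t < L by rewrite t0.
  by apply: filterS (near_between tb) => s /andP[s0 sL]; rewrite /cst diff2_nu.
have := near_is_derive_eq D1 D2 N; rewrite /cst.
have z w : dotp w 0 = 0 by rewrite -(scale0r w) dotpZr mul0r.
rewrite !z (_ : diff2 E (g t) (nu t) 0 = 0) ?addr0; last by rewrite -(scale0r v) diff2Zr mul0r.
rewrite diff2Nl (euler2 Es E2) // diff1_g_split // !scale_mulE dotpNl.
rewrite (diff3C23 oP _ _ _ Es (g0 t)) (_ : (2 *: h + h2) t = 2 * h t + h2 t) // => H.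
rewrite -[LHS](subrK (2 * h t * dotp (g t) v + h1 t * dotp (nu t) v)) H.
by ring.
Qed.

Lemma diff2_e t v : 0 < t -> t < t1 -> diff2 E (g t) e v = lam t * dotp e v.
Proof.
move=> t0 tt1; have tL : t < L by apply: lt_trans tt1 _; case/andP: t1L.
have := diff2_principal dl m0 sp ptau preg sg1 sgdq oP (@usphere_punctured R n) Es Etau.
move=> /(_ a0 b0 t e (cos t / sin t) _ (mg (ltW tL)) t0 tL ee (ge t) (nue t)).
move=> /(_ _ (douter_normal_focusing t0 (ltW tt1))) H.
have ge' := ge t; have nue' := nue t.
have Z1 : diff2 E (g t) (g t) e = 0.
  by rewrite (euler2 Es E2) // diff1_g_split // ge' nue' !mulr0 addr0.
have Z2 : diff2 E (g t) (nu t) e = 0 by rewrite diff2_nu // ge' nue' !mulr0 addr0.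
have Hv := H v; have He := H e; rewrite /= -/(g t) -/(nu t) Z1 Z2 !mul0r !add0r in Hv He.
by rewrite (diff2C oP e v Es (g0 t)) Hv /lam He ee mulr1.
Qed.

Lemma lam_sin t : 0 < t < t1 -> lam t * sin t = 2 * h t * sin t + h1 t * cos t.
Proof.
move=> /andP[t0 tt1]; have tL : t < L by apply: lt_trans tt1 _; case/andP: t1L.
have := diff2_principal dl m0 sp ptau preg sg1 sgdq oP (@usphere_punctured R n) Es Etau.
move=> /(_ a0 b0 t e (cos t / sin t) e (mg (ltW tL)) t0 tL ee (ge t) (nue t)).
move=> /(_ (douter_normal_focusing t0 (ltW tt1))) /=.
rewrite -/(g t) -/(nu t) ge nue !mulr0 !add0r ee mulr1 (euler1 Es E2) // -/(lam t) => ->.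
rewrite -/(h t) -/(h1 t); field; exact: lt0r_neq0 (sin_gt0_L t0 tL).
Qed.

Lemma diff3_e t v : 0 < t -> t < t1 -> diff3 E (g t) (nu t) e v = lam1 t * dotp e v.
Proof.
move=> t0 tt1; have Dv := is_derive_cst v t (1 : R); have De := is_derive_cst e t (1 : R).
have D1 := is_derive_diff2 oP Es (g0 t) (dg t) De Dv.
have D2 := is_deriveM (is_derive_lam t) (is_derive_cst (dotp e v) t (1 : R)).
have N : \forall s \near t, diff2 E (g s) (cst e s) (cst v s) = (lam * cst (dotp e v)) s.
  have tb : 0 < t < t1 by rewrite t0.
  by apply: filterS (near_between tb) => s /andP[s0 sL]; rewrite /cst diff2_e.
have := near_is_derive_eq D1 D2 N; rewrite /cst.
have -> : diff2 E (g t) 0 v = 0 by rewrite -(scale0r v) diff2Zl mul0r.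
have -> : diff2 E (g t) e 0 = 0 by rewrite -(scale0r v) diff2Zr mul0r.
rewrite !addr0 scaler0 add0r scale_mulE mulrC => <-.
by rewrite (diff3C12 oP _ _ _ Es (g0 t)) (diff3C23 oP _ _ _ Es (g0 t)).
Qed.

(* [w] is the part of [nu] orthogonal to [g] for the Hessian metric *)
Let G t := 2 * h t + h2 t - h1 t ^+ 2 / (2 * h t).
Let w t := nu t - (h1 t / (2 * h t)) *: g t.
Let h_gt0 t : 0 < h t. Proof. exact: E_gt0. Qed.

Let diff2_quad x u z k : diff2 E x (u + k *: z) (u + k *: z)
  = diff2 E x u u + k * diff2 E x u z + (k * diff2 E x z u + k * (k * diff2 E x z z)).
Proof. by rewrite !(diff2Dl, diff2Dr, diff2Zl, diff2Zr). Qed.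

Lemma diff2_w t : diff2 E (g t) (w t) (w t) = G t.
Proof.
have hn : h t != 0 by rewrite lt0r_neq0.
rewrite /w -scaleNr diff2_quad.
rewrite (diff2C oP (nu t) (g t) Es (g0 t)) !(euler2 Es E2) // (euler1 Es E2) // -/(h t) -/(h1 t).
rewrite /G /h2; field; exact: hn.
Qed.

Lemma G_gt0 t : 0 < G t.
Proof.
rewrite -diff2_w; apply: diff2_pos => //.
have [_ nn xn] := ortho2_arc t m0.1; have : dotp (nu t) (w t) = 1.
  by rewrite /w dotpBr dotpZr nn (dotpC (nu t)) xn mulr0 subr0.
by apply: contra_eq_neq => ->; rewrite -(scale0r e) dotpZr mul0r eq_sym oner_neq0.
Qed.

(** The vanishing of the sectional curvature of the plane of [nu] and [e]. *)
Lemma flatness_equation t : 0 < t < t1 -> lam1 t / lam t * lam1 t = kp t / G t * lam1 t.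
Proof.
move=> /andP[t0 tt1]; have tL : t < L by apply: lt_trans tt1 _; case/andP: t1L.
have hn : h t != 0 by rewrite lt0r_neq0.
have l0 : lam t != 0 by rewrite lt0r_neq0 // diff2_pos.
have G0 : G t != 0 by rewrite lt0r_neq0 // G_gt0.
have Hw z : diff2 E (g t) (w t) z = G t * dotp (nu t) z.
  rewrite /w -scaleNr diff2Dl diff2Zl diff2_nu // (euler2 Es E2) // diff1_g_split // /G.
  by field.
have := flat_contraction oP Es hessian_unit (g0 t) Eflat l0 G0
  (fun z => diff2_e z t0 tt1) Hw (fun z => diff3_e z t0 tt1) (fun z => diff3_nu z t0 tL).
rewrite /w -scaleNr.
have Dr u z k : diff3 E (g t) e e (u + k *: z) = diff3 E (g t) e e u + k * diff3 E (g t) e e z.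
  by rewrite /diff3 mulr_sumr -big_split /=; apply: eq_bigr => i _; rewrite diff2Dr diff2Zr mulrDl mulrA.
have Zg : diff3 E (g t) e e (g t) = 0.
  by rewrite (diff3C23 oP _ _ _ Es (g0 t)) (diff3C12 oP _ _ _ Es (g0 t)) (euler3 Es E2).
by rewrite (Dr (nu t) (g t)) Zg mulr0 addr0 -/(lam1 t).
Qed.

(** Flatness leaves only the profiles that ellipsoids have. *)
Lemma flat_profile t : 0 < t < t1 -> h t = h 0 + h2 0 / 2 - h2 0 / 2 * cos t ^+ 2.
Proof.
have t1pi : 0 < t1 <= pi.
  by case/andP: t1L => -> tL; rewrite (le_trans (ltW tL)) // (dl_lepi dl).
apply: (profile_ode t1pi is_derive_h is_derive_h1 is_derive_h2 is_derive_lam) => // s.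
- by apply: diff2_pos.
- exact: G_gt0.
- exact: lam_sin.
- exact: flatness_equation.
Qed.

End FlatProfile.

(** * Quadratic energies *)

Section QuadraticNorms.
Variables (R : realType) (n : nat).
Local Notation V := 'rV[R]_n.
Implicit Types (x y u v : V).

Lemma eq_is_derive_unique (g h : R -> R) (t l1 l2 : R) : (forall s, g s = h s) ->
  is_derive t 1 g l1 -> is_derive t 1 h l2 -> l1 = l2.
Proof. by move=> /funext -> [_ <-] [_ <-]. Qed.

Lemma euclidean_of_quadratic (F : V -> R) (Q : 'M[R]_n) : Q^T = Q ->
  (forall x, 0 <= F x) -> (forall x, x != 0 -> 0 < F x) ->
  (forall x, F x ^+ 2 = dotp (x *m Q) x) -> euclidean_norm F.
Proof.
move=> QT F0 Fp FQ.
pose ip u v := dotp (u *m Q) v.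
have bl : @isBilinear R V V R *%R (idfun \; *%R) ip.
  split.
  - by move=> u' x y; rewrite /ip mulmxBl dotpBl.
  - by move=> u x y; rewrite /ip dotpBr.
  - by move=> u' k x; rewrite /ip -scalemxAl dotpZl.
  - by move=> u k x; rewrite /ip dotpZr.
have hm : @isHermitianSesquilinear R V false idfun ip.
  by split => x y; rewrite expr0 mul1r /= /ip dotp_mulmx QT dotpC.
have dt : @isDotProduct R V ip.
  by split => u u0; rewrite /ip -FQ exprn_gt0 // Fp.
pose D : {dot V for idfun} := HB.pack ip bl hm dt.
have DE x : D x x = F x ^+ 2 by rewrite FQ.
by exists D => x; rewrite DE sqrtr_sqr ger0_norm.
Qed.

Lemma quadratic_of_sphere (E : V -> R) (Q : 'M[R]_n) :
  (forall k x, 0 <= k -> E (k *: x) = k ^+ 2 * E x) ->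
  (forall x, usphere x -> E x = dotp (x *m Q) x) -> forall x, E x = dotp (x *m Q) x.
Proof.
move=> E2 EQ x; have [->|x0] := eqVneq x 0.
  by rewrite -(scale0r (0 : V)) E2 // expr0n mul0r scale0r mul0mx -(scale0r (0 : V)) dotpZr mul0r.
have xx := dotp_gt0 x0; set m := dotp x x in xx.
have sm0 : Num.sqrt m != 0 by rewrite gt_eqF ?sqrtr_gt0.
pose u := (Num.sqrt m)^-1 *: x.
have uS : usphere u by exact: dotp_normalize.
have xE : x = Num.sqrt m *: u by rewrite scalerA divff // scale1r.
have QE : dotp (x *m Q) x = Num.sqrt m ^+ 2 * dotp (u *m Q) u.
  move: (Num.sqrt m) (u) xE => k v ->.
  by rewrite -scalemxAl dotpZl dotpZr mulrA expr2.
rewrite QE -EQ // -E2 ?sqrtr_ge0 //; congr E; exact: xE.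
Qed.

End QuadraticNorms.

(** * The energy of a norm induced by the foliation *)

Section FoliationNorm.
Variables (R : realType) (n : nat).
Local Notation V := 'rV[R]_n.
Implicit Types (x y u v w a b e : V) (s t r k : R).
Variables (tau : V -> R) (L : R) (dl : distance_like tau L).
Variables (a0 b0 : V) (m0 : minimal_arc tau a0 b0 L).
Variables (d : nat) (p : V -> R) (hp : homogeneous_poly d p).
Let sp : smooth_on setT p := @polyfun_smooth R n p setT (homogeneous_polyfun hp).
Hypothesis ptau : forall x y, usphere x -> usphere y -> tau x = tau y -> p x = p y.
Hypothesis preg : forall x, usphere x -> 0 < tau x < L -> sphere_grad p x != 0.
Hypothesis prange : forall x, usphere x -> -1 <= p x <= 1.
Hypothesis pa : p (arc a0 b0 0) = 1 \/ p (arc a0 b0 0) = -1.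
Hypothesis pL : p (arc a0 b0 L) = - p (arc a0 b0 0).
Hypothesis pcurv : forall x, usphere x -> 0 < tau x < L ->
  ([set k | principal_curvature p x k] #= `I_d)%card.
Variables (E : V -> R) (Es : smooth_on (punctured R n) E).
Hypothesis E2 : forall k x, 0 <= k -> E (k *: x) = k ^+ 2 * E x.
Hypothesis E_gt0 : forall x, x != 0 -> 0 < E x.
Hypothesis Epd : forall x, x != 0 -> posdef_mx (hessian E x).
Hypothesis Eflat : flat_on (punctured R n) (hessian E).
Hypothesis Etau : forall x y, usphere x -> usphere y -> tau x = tau y -> E x = E y.

Let g t := arc a0 b0 t.
Let nu t := arc b0 (- a0) t.
Let dq t := diff1 p (g t) (nu t).
Let L0 : 0 < L := dl_gt0 dl.

Lemma dp_arc t : is_derive t 1 (fun s => p (g s)) (dq t).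
Proof. exact: (is_derive_comp_curve openT sp I (is_derive_arc a0 b0 t)). Qed.

Lemma dq_extremal t : p (g t) = 1 \/ p (g t) = -1 -> dq t = 0.
Proof.
have gS s : usphere (g s) by exact: arc_usphere m0.1.
have tI : t \in `]t - 1, t + 1[ by rewrite in_itv /= gtrBl ltrDl ltr01.
have le1 : t - 1 <= t + 1 by rewrite lerD2l; lra.
move=> [pt|pt].
  have dd s : s \in `]t - 1, t + 1[ -> derivable (fun s => p (g s)) s 1 by have [] := dp_arc s.
  apply: is_derive_unique (dp_arc t) (derive1_at_max le1 dd tI _) => s _.
  by rewrite pt; case/andP: (prange (gS s)).
have dd s : s \in `]t - 1, t + 1[ -> derivable (fun s => p (g s)) s 1 by have [] := dp_arc s.
apply: is_derive_unique (dp_arc t) (derive1_at_min le1 dd tI _) => s _.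
by rewrite pt; case/andP: (prange (gS s)).
Qed.

Let dq0 : dq 0 = 0. Proof. exact: dq_extremal. Qed.
Let dqL : dq L = 0.
Proof. by apply: dq_extremal; case: pa => pa0; rewrite /g pL pa0 ?opprK; [right|left]. Qed.

(** The derivative of [p] along the arc vanishes at both ends, so the cotangents of
    the distances to the ends are roots of [rot_poly], hence principal curvatures. *)
Lemma focusing_directions sg t : (sg = 1 \/ sg = -1) ->
  (forall t, 0 < t < L -> 0 < sg * dq t) -> 0 < t < L ->
  (exists e, principal_direction a0 b0 p sg t (cos t / sin t) e) /\
  (exists e, principal_direction a0 b0 p sg t (cos (t - L) / sin (t - L)) e).
Proof.
move=> sg1 sgdq tL; have /andP[t0 tL'] := tL.
have [f1 f1s f1E] := homogeneous_poly_line (g t) (- nu t) hp.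
have tt : tau (g t) = t by rewrite m0.2 // !ltW.
have card := pcurv (arc_usphere t m0.1); rewrite -/(g t) tt in card.
have Lpi := dl_lepi dl.
have st : 0 < sin t by rewrite sin_gt0_pi // t0 (lt_le_trans tL').
have stL : 0 < sin (L - t) by rewrite sin_gt0_pi // subr_gt0 tL' (lt_le_trans _ Lpi) // gtrBl.
have stL' : sin (t - L) != 0 by rewrite -opprB sinN oppr_eq0 gt_eqF.
have R0 s : sin s != 0 -> dq (t - s) = 0 -> root (rot_poly d f1) (cos s / sin s).
  move=> ss; rewrite /dq /g /nu (dq_rot_poly hp f1E ss) => /eqP.
  by rewrite mulf_eq0 expf_eq0 (negbTE ss) andbF.
split; apply: (realized_root dl m0 hp ptau preg sg1 sgdq tL f1s f1E (card tL)); apply: R0 => //.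
- by rewrite gt_eqF.
- by rewrite subrr.
- by rewrite opprB addrC subrK.
Qed.

Let h t := E (g t).
Let h1 t := diff1 E (g t) (nu t).
Let c0 := diff2 E (g 0) (nu 0) (nu 0) - 2 * h 0.
Let A := - (c0 / 2).
Let B := h 0 + c0 / 2.

Let dh t : is_derive t 1 h (h1 t). Proof. exact: (is_derive_h m0 Es). Qed.

Lemma profile_interior t : 0 < t < L -> h t = B + A * cos t ^+ 2.
Proof.
move=> /andP[t0 tL].
have [sg [sg1 sgdq]] := dq_sign dl m0 sp ptau preg.
pose t1 := (t + L) / 2.
have t1L : 0 < t1 < L by rewrite /t1; apply/andP; split; lra.
have tt1 : 0 < t < t1 by rewrite /t1; apply/andP; split; lra.
have [[e [ee xe ne de]] _] := focusing_directions sg1 sgdq t1L.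
have ae : dotp a0 e = 0.
  have := arc_back a0 b0 t1 t1; rewrite subrr arc0 => ->.
  by rewrite dotpBl !dotpZl xe ne !mulr0 subrr.
have be : dotp b0 e = 0.
  have := arc_back_tangent a0 b0 t1 t1; rewrite subrr arc0 => ->.
  by rewrite dotpDl !dotpZl xe ne !mulr0 addr0.
have := flat_profile dl m0 sp ptau preg sg1 sgdq Es E2 E_gt0 Epd Eflat Etau ee ae be t1L de tt1.
by move=> H; rewrite /h /g H /B /A /c0 /h /g /nu; ring.
Qed.

Let psi t := h t - (B + A * cos t ^+ 2).
Let dpsi t : is_derive t 1 psi (h1 t + A * (2 * cos t * sin t)).
Proof.
have D1 := is_deriveM (is_derive_cos t) (is_derive_cos t).
have D2 := is_deriveB (dh t) (is_deriveD (is_derive_cst B t (1 : R)) (is_deriveZ A D1)).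
apply: (@is_derive_eq _ _ _ _ _ _ _ _ D2).
by rewrite !scale_mulE; ring.
Qed.

(** Values and derivatives at [L] are determined by the values to the left of [L]. *)
Lemma profile_end : psi L = 0 /\ h1 L = - (A * (2 * cos L * sin L)).
Proof.
have pz t : 0 < t < L -> psi t = 0 by move=> tL; rewrite /psi profile_interior // subrr.
have dz t : 0 < t < L -> h1 t + A * (2 * cos t * sin t) = 0.
  move=> tL; apply: near_is_derive_eq (dpsi t) (is_derive_cst (0 : R) t (1 : R)) _.
  by apply: filterS (near_between tL) => s /pz.
have L2 : 0 < L / 2 by rewrite divr_gt0.
have L2L : L / 2 < L by lra.
have pL0 : psi L = 0.
  rewrite -(derive0_itv_const dpsi (a := L / 2) (b := L)) ?pz ?L2 //; last exact: ltW.
  by move=> s /andP[s0 sL]; apply: dz; rewrite sL (lt_trans L2).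
split => //; apply/eqP; rewrite -addr_eq0; apply/eqP.
apply: left_eq_derive (dpsi L) (is_derive_cst (0 : R) L (1 : R)) _.
exists (L / 2) => // s /andP[s0]; rewrite le_eqVlt => /orP[/eqP ->|sL] //.
by apply: pz; rewrite sL andbT (lt_le_trans _ s0) //; lra.
Qed.

Lemma profile_closed t : 0 <= t <= L -> h t = B + A * cos t ^+ 2.
Proof.
move=> /andP[]; rewrite le_eqVlt => /orP[/eqP <- _|t0].
  by rewrite cos0 /B /A; ring.
rewrite le_eqVlt => /orP[/eqP ->|tL]; last by apply: profile_interior; rewrite t0.
by apply/eqP; rewrite -subr_eq0; apply/eqP; exact: profile_end.1.
Qed.

Lemma energy_sphere x : usphere x -> E x = B + A * cos (tau x) ^+ 2.
Proof.
move=> xS; have tx := dl_range dl xS.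
rewrite -profile_closed //; apply: Etau => //; first exact: arc_usphere m0.1.
by rewrite m0.2.
Qed.

Lemma p_sphere x : usphere x -> p x = p (g (tau x)).
Proof.
move=> xS; have tx := dl_range dl xS.
by apply: ptau => //; [exact: arc_usphere m0.1|rewrite m0.2].
Qed.

Lemma abs_coord_le1 e i : dotp e e = 1 -> `|e 0 i| <= 1.
Proof. by move=> ee; rewrite ler_norml; exact: usphere_bounded. Qed.

(** In a direction focusing at the far end, the Hessian of the energy is
    [2 * h + h1 * cot (t - L)]; it stays bounded as [t] tends to [L]. *)
Lemma profile_critical_end : h1 L = 0.
Proof.
have [sg [sg1 sgdq]] := dq_sign dl m0 sp ptau preg.
(* the Hessian in that direction, times the sine *)
pose phi t := 2 * h t * sin (t - L) + h1 t * cos (t - L).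
have phiE t : 0 < t < L -> exists2 e, dotp e e = 1 & phi t = sin (t - L) * diff2 E (g t) e e.
  move=> tL; have /andP[t0 tL'] := tL.
  have [_ [e [ee xe ne de]]] := focusing_directions sg1 sgdq tL.
  exists e => //.
  have mt : minimal_arc tau a0 b0 t by apply: minimal_arc_le m0; exact: ltW.
  have := diff2_principal dl m0 sp ptau preg sg1 sgdq
    (@open_punctured R n) (@usphere_punctured R n) Es Etau e mt t0 tL' ee xe ne de.
  rewrite /= xe ne !mulr0 !add0r ee mulr1 (euler1 Es E2); last exact: usphere_neq0 (arc_usphere t m0.1).
  move=> ->; rewrite /phi /h /h1 /g /nu; field.
  have stL : 0 < sin (L - t).
    by rewrite sin_gt0_pi // subr_gt0 tL' (lt_le_trans _ (dl_lepi dl)) // gtrBl.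
  by rewrite -opprB sinN oppr_eq0 gt_eqF.
(* the direction [e] varies with [t], so the bound comes from the entries *)
pose c i j t := pderive j (pderive i E) (g t).
pose C := \sum_i \sum_j (`|c i j L| + 1).
have cC : \forall t \near L, forall i j, `|c i j t| <= `|c i j L| + 1.
  suff H : forall ij : 'I_n * 'I_n, \forall t \near L, `|c ij.1 ij.2 t| <= `|c ij.1 ij.2 L| + 1.
    have := filter_forall (nbhs_filter L) H.
    by apply: filterS => t {}H i j; exact: (H (i, j)).
  move=> [i j] /=.
  have gL : punctured R n (g L) by exact: usphere_neq0 (arc_usphere L m0.1).
  have [dc _] := is_derive_comp_curve (@open_punctured R n)
     (smooth_pderive j (smooth_pderive i Es)) gL (is_derive_arc a0 b0 L).
  have cc : {for L, continuous (c i j)} by apply: differentiable_continuous; apply/derivable1_diffP.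
  move: cc => /cvgrPdist_le /(_ 1 ltr01); apply: filterS => t ct.
  rewrite -[c i j t](subKr (c i j L)); apply: le_trans (ler_normB _ _) _.
  by rewrite lerD2l.
have bound t e : dotp e e = 1 -> (forall i j, `|c i j t| <= `|c i j L| + 1) ->
    `|diff2 E (g t) e e| <= C.
  move=> ee ct; rewrite diff2E; apply: le_trans (ler_norm_sum _ _ _) _.
  apply: ler_sum => i _; apply: le_trans (ler_norm_sum _ _ _) _; apply: ler_sum => j _.
  have bi := abs_coord_le1 i ee; have bj := abs_coord_le1 j ee.
  rewrite !normrM; apply: le_trans (ct i j).
  apply: (@le_trans _ _ (`|e 0 i| * `|pderive j (pderive i E) (g t)|)); first exact: ler_piMr.
  exact: ler_piMl.
have [r r0 br] : exists2 r : R, 0 < r & forall t, `|L - t| < r -> forall i j, `|c i j t| <= `|c i j L| + 1.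
  by move: cC => /nbhs_ballP [r /= r0 br]; exists r => // t tr; apply: br.
have dsin : is_derive L 1 (fun s => sin (s - L)) 1.
  rewrite (_ : (fun s => _) = (fun s => cos L * sin s - sin L * cos s)); last first.
    by apply: funext => s; rewrite sinB; ring.
  have D := is_deriveB (is_deriveZ (cos L) (is_derive_sin L)) (is_deriveZ (sin L) (is_derive_cos L)).
  apply: (@is_derive_eq _ _ _ _ _ _ _ _ D).
  by rewrite !scale_mulE -[RHS](cos2Dsin2 L); ring.
have dcos : is_derive L 1 (fun s => cos (s - L)) 0.
  rewrite (_ : (fun s => _) = (fun s => cos L * cos s + sin L * sin s)); last first.
    by apply: funext => s; rewrite cosB; ring.
  have D := is_deriveD (is_deriveZ (cos L) (is_derive_cos L)) (is_deriveZ (sin L) (is_derive_sin L)).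
  apply: (@is_derive_eq _ _ _ _ _ _ _ _ D).
  by rewrite !scale_mulE; ring.
have D1 := is_deriveM (is_deriveZ 2 (dh L)) dsin.
have D2 := is_deriveM (is_derive_h1 m0 Es E2 L) dcos.
have dphi := is_deriveD D1 D2; set l := (X in is_derive _ _ _ X) in dphi.
have [r1 r10 H1] := is_derive_bound dphi ltr01.
have [r2 r20 H2] := is_derive_bound dsin ltr01.
have C0 : 0 <= C by apply: sumr_ge0 => i _; apply: sumr_ge0 => j _; rewrite addr_ge0.
have phiL : phi L = h1 L by rewrite /phi subrr sin0 cos0; ring.
(* [phi L = h1 L], and [phi (L - s)] is of order [s] *)
pose m := Num.min L (Num.min r (Num.min r1 r2)).
have mpos : 0 < m by rewrite !lt_min L0 r0 r10.
suff H s : 0 < s -> s < m -> `|h1 L| <= (2 * C + `|l| + 1) * s.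
  apply/eqP; rewrite -normr_le0; apply/ler_addgt0Pl => eps eps0; rewrite addr0.
  have K0 : 0 < 2 * C + `|l| + 1 by rewrite ltr_wpDl // addr_ge0 // mulr_ge0.
  pose s := Num.min (m / 2) (eps / (2 * C + `|l| + 1)).
  have s0 : 0 < s by rewrite lt_min !divr_gt0.
  have sm : s < m by rewrite gt_min; apply/orP; left; lra.
  apply: le_trans (H s s0 sm) _; rewrite mulrC -ler_pdivlMr // ge_min lexx orbT //.
move=> s0; rewrite !lt_min => /and4P[sL sr s1 s2].
have sN : `|- s| = s by rewrite normrN gtr0_norm.
have LsL : 0 < L - s < L by rewrite subr_gt0 sL gtrBl.
have [e ee pe] := phiE _ LsL.
have bC := bound (L - s) e ee (br _ _).
have {}bC : `|diff2 E (g (L - s)) e e| <= C by apply: bC; rewrite opprB addrC subrK gtr0_norm.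
have B1 := H1 (- s); rewrite sN mul1r in B1; have {}B1 := B1 s1.
have B2 := H2 (- s); rewrite sN mul1r subrr sin0 subr0 mul1r in B2; have {}B2 := B2 s2.
have S2 : `|sin (L - s - L)| <= 2 * s.
  rewrite -[sin _](subrK (- s)); apply: le_trans (ler_normD _ _) _.
  by rewrite sN; lra.
have P2 : `|phi (L - s)| <= 2 * s * C.
  by rewrite pe normrM; apply: ler_pM.
rewrite -phiL (_ : phi L = phi (L - s) - l * (- s) - (phi (L - s) - phi L - l * (- s))); last ring.
apply: le_trans (ler_normB _ _) _.
apply: (@le_trans _ _ (2 * s * C + `|l| * s + s)); last by rewrite !mulrDl mul1r lerD2r lerD2r; lra.
apply: lerD => //; apply: le_trans (ler_normB _ _) _; apply: lerD => //.
by rewrite normrM sN.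
Qed.

Hypothesis LE : L = pi / d%:R.
Hypothesis dE : d \in [:: 1; 2; 3; 4; 6]%N.

Let p_line y s : p (0 + s *: y) = s ^+ d * p y.
Proof. by rewrite add0r (homogeneous_polyZ s y hp). Qed.

Lemma linear_p : d = 1%N -> forall y, p y = dotp (gradient p 0) y.
Proof.
move=> d1 y; have D1 := is_derive_comp_curve openT sp I (is_derive_line 0 y 0).
have D2 := is_deriveM (is_derive_id (0 : R) (1 : R)) (is_derive_cst (p y) (0 : R) (1 : R)).
rewrite scale0r addr0 in D1; rewrite -[RHS]/(diff1 p 0 y) (near_is_derive_eq D1 D2 _).
  by rewrite /cst !scale_mulE; ring.
by near=> s; rewrite p_line d1 expr1.
Unshelve. all: by end_near. Qed.

Lemma quadratic_p : d = 2%N -> forall y, p y = 2^-1 * diff2 p 0 y y.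
Proof.
move=> d2 y.
have G s : diff1 p (0 + s *: y) y = 2 * s * p y.
  have D1 := is_derive_comp_curve openT sp I (is_derive_line 0 y s).
  have D2 := is_deriveM (is_deriveM (is_derive_id s (1 : R)) (is_derive_id s (1 : R)))
    (is_derive_cst (p y) s (1 : R)).
  rewrite (near_is_derive_eq D1 D2 _); first by rewrite /cst !scale_mulE; ring.
  by near=> r; rewrite p_line d2 expr2.
have D1 := is_derive_diff1 openT sp I (is_derive_line 0 y 0) (is_derive_cst y (0 : R) (1 : R)).
have D2 := is_deriveZ 2 (is_deriveM (is_derive_id (0 : R) (1 : R)) (is_derive_cst (p y) (0 : R) (1 : R))).
rewrite scale0r addr0 in D1.
have := near_is_derive_eq D1 D2 _; rewrite (_ : diff1 p 0 0 = 0) ?addr0; last first.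
  by rewrite -(scale0r (0 : V)) diff1Z mul0r.
rewrite /cst => ->; first by rewrite !scale_mulE; field.
by near=> s; rewrite G -mulrA.
Unshelve. all: by end_near. Qed.

Let g_at0 : g 0 = a0. Proof. exact: arc0. Qed.
Let pa_sq : p a0 * p a0 = 1.
Proof. by case: pa; rewrite -/(g 0) g_at0 => ->; rewrite ?mulr1 // mulrNN mulr1. Qed.

(** Along the arc [p] is a combination of cosine and sine, critical at [0]. *)
Lemma cos2_linear x : d = 1%N -> usphere x -> cos (tau x) ^+ 2 = p x ^+ 2.
Proof.
move=> d1 xS; have pl := linear_p d1.
have pg t : p (g t) = p a0 * cos t + p b0 * sin t.
  by rewrite !pl /g /arc dotpDr !dotpZr; ring.
have pb : p b0 = 0.
  have D : is_derive (0 : R) 1 (fun t => p a0 * cos t + p b0 * sin t)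
      (p a0 * - sin 0 + p b0 * cos 0).
    exact: is_deriveD (is_deriveZ (p a0) (is_derive_cos (0 : R)))
      (is_deriveZ (p b0) (is_derive_sin (0 : R))).
  have H := eq_is_derive_unique pg (dp_arc 0) D.
  by rewrite dq0 sin0 cos0 in H; rewrite [RHS]H; ring.
rewrite (p_sphere xS) pg pb mul0r addr0 exprMn [p a0 ^+ 2]expr2 pa_sq mul1r //.
Qed.

(** Along the arc [p] is a quadratic form in cosine and sine, critical at [0], with
    opposite values at [0] and at [L = pi / 2]. *)
Lemma cos2_quadratic x : d = 2%N -> usphere x ->
  cos (tau x) ^+ 2 = (1 + p a0 * p x) / 2.
Proof.
move=> d2 xS; have pl := quadratic_p d2.
have pg t : p (g t) = p a0 * (cos t * cos t) + diff2 p 0 a0 b0 * (cos t * sin t) + p b0 * (sin t * sin t).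
  rewrite !pl /g /arc !(diff2Dl, diff2Dr, diff2Zl, diff2Zr).
  rewrite (diff2C openT b0 a0 sp I).
  by field.
have pab : diff2 p 0 a0 b0 = 0.
  have Dc := is_derive_cos (0 : R); have Ds := is_derive_sin (0 : R).
  have D : is_derive (0 : R) 1
      (fun t => p a0 * (cos t * cos t) + diff2 p 0 a0 b0 * (cos t * sin t) + p b0 * (sin t * sin t))
      (p a0 * (cos 0 * - sin 0 + cos 0 * - sin 0) + diff2 p 0 a0 b0 * (cos 0 * cos 0 + sin 0 * - sin 0)
       + p b0 * (sin 0 * cos 0 + sin 0 * cos 0)).
    exact: is_deriveD (is_deriveD (is_deriveZ (p a0) (is_deriveM Dc Dc))
      (is_deriveZ (diff2 p 0 a0 b0) (is_deriveM Dc Ds))) (is_deriveZ (p b0) (is_deriveM Ds Ds)).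
  have H := eq_is_derive_unique pg (dp_arc 0) D.
  rewrite dq0 sin0 cos0 in H; rewrite [RHS]H; ring.
have pb : p b0 = - p a0.
  have := pL; rewrite -/(g L) -/(g 0) g_at0 => <-.
  by rewrite pg LE d2 cos_pihalf sin_pihalf; ring.
rewrite (p_sphere xS) pg pab pb.
rewrite (_ : 1 + _ = 1 + p a0 * p a0 * (cos (tau x) ^+ 2 - sin (tau x) ^+ 2)); last ring.
by rewrite pa_sq sin2cos2; field.
Qed.

(** For [L < pi / 2] the profile is critical at [L] only if it is constant. *)
Lemma profile_round : (2 < d)%N -> A = 0.
Proof.
move=> d2; have := profile_end.2; rewrite profile_critical_end => /esym/eqP.
have d3 : 3 <= d%:R :> R by rewrite (ler_nat R 3 d).
have L2 : L < pi / 2.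
  rewrite LE ltr_pM2l ?pi_gt0 // ltf_pV2 ?posrE //; last by lra.
  by lra.
have cL : 0 < cos L by rewrite cos_gt0_pihalf // L2 andbT (lt_trans _ L0) // oppr_lt0 divr_gt0 // pi_gt0.
have sL : 0 < sin L by rewrite sin_gt0_pihalf // L0.
by rewrite oppr_eq0 mulf_eq0 => /orP[/eqP //|]; rewrite !mulf_eq0 !gt_eqF // pnatr_eq0.
Qed.

Theorem energy_quadratic : exists2 Q : 'M[R]_n, Q^T = Q & forall x, E x = dotp (x *m Q) x.
Proof.
have bM x : dotp (x *m B%:M) x = B * dotp x x by rewrite mul_mx_scalar dotpZl.
have [d2|] := ltnP 2 d.
  exists B%:M; first exact: tr_scalar_mx.
  apply: (quadratic_of_sphere E2) => x xS.
  by rewrite bM energy_sphere // profile_round // mul0r addr0 xS mulr1.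
rewrite leq_eqVlt => /orP[/eqP d2|].
  pose Q := (B + A / 2)%:M + (A * p a0 / 4) *: hessian p 0.
  exists Q.
    by rewrite /Q linearD linearZ /= tr_scalar_mx (hessian_tr openT sp I).
  apply: (quadratic_of_sphere E2) => x xS.
  rewrite energy_sphere // cos2_quadratic // /Q mulmxDr dotpDl mul_mx_scalar dotpZl xS.
  rewrite -scalemxAr dotpZl dotp_hessian (quadratic_p d2 x).
  by field.
rewrite ltnS leq_eqVlt => /orP[/eqP d1|]; last first.
  by rewrite ltnS leqn0 => /eqP d0; move: dE; rewrite d0.
pose v := gradient p 0.
exists (B%:M + A *: (v^T *m v)).
  by rewrite linearD linearZ /= tr_scalar_mx trmx_mul trmxK.
apply: (quadratic_of_sphere E2) => x xS.
rewrite mulmxDr dotpDl bM xS mulr1 energy_sphere // cos2_linear // linear_p // -/v.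
rewrite -scalemxAr dotpZl mulmxA; congr (_ + _ * _).
suff -> : x *m v^T = (dotp v x)%:M by rewrite mul_scalar_mx dotpZl.
by apply/matrixP => i j; rewrite !ord1 !mxE eqxx mulr1n; apply: eq_bigr => k _; rewrite !mxE mulrC.
Qed.

End FoliationNorm.

(** * From the foliation to the distance to its focal set *)

Theorem theoremC (R : realType) (n : nat) (hn : (2 < n)%N)
  (d : nat) (M : R -> set 'rV[R]_n) (F : 'rV[R]_n -> R)
  (hM : isoparametric_foliation d M)
  (hF : minkowski_norm F)
  (hFM : induced_by F d M)
  (hflat : flat_on (punctured R n) (hessian_metric F)) :
  euclidean_norm F.
Proof.
case: hM => dE [p [[hp _ prange pcrit plev] Mlev M0L Mdist]].
set L := pi / d%:R in Mlev M0L Mdist.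
have d1 : (0 < d)%N by move: dE; clear; case: d.
have L0 : 0 < L by rewrite divr_gt0 ?pi_gt0 // ltr0n.
have Lpi : L <= pi by rewrite ler_pdivrMr ?ltr0n // ler_peMr ?pi_ge0 // ler1n.
have i0 : 0 \in `[0, L] by rewrite in_itv /= lexx ltW.
have iL : L \in `[0, L] by rewrite in_itv /= lexx ltW.
have MS t : t \in `[0, L] -> (exists2 x, usphere x & p x = p x /\ M t = level_set p (p x)).
  move=> tL; have : [set M t | t in `[0, L]] (M t) by exists t.
  by rewrite Mlev => -[_ [x xS <-] <-]; exists x.
have MSu t : t \in `[0, L] -> M t `<=` @usphere R n.
  by move=> /MS[x _ [_ ->]] y [].
have Mne t : t \in `[0, L] -> M t !=set0.
  by move=> /MS[x xS [_ ->]]; exists x.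
pose tau := sphere_dist_to (M 0).
(* the leaves exhaust the sphere, so the leaf through [x] is [M (tau x)] *)
have leaf x : usphere x -> tau x \in `[0, L] /\ M (tau x) = level_set p (p x).
  move=> xS; have : [set level_set p s | s in p @` usphere (n:=n)] (level_set p (p x)).
    by exists (p x) => //; exists x.
  rewrite -Mlev => -[t tL Mt].
  by rewrite /tau (Mdist t x tL) // Mt.
have ptau x y : usphere x -> usphere y -> tau x = tau y -> p x = p y.
  move=> xS yS xy; have [_ Mx] := leaf x xS; have [_ My] := leaf y yS.
  have : level_set p (p x) y by rewrite -Mx xy My.
  by case.
have Ftau x y : usphere x -> usphere y -> tau x = tau y -> F x = F y.
  move=> xS yS xy; have [tx Mx] := leaf x xS; have [_ My] := leaf y yS.
  by apply: (hFM _ tx); [rewrite Mx|rewrite xy My].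
have M0c : compact (M 0).
  have cp := polyfun_continuous (homogeneous_polyfun hp).
  by case: M0L => -[-> _]; exact: compact_level_set.
have dl : distance_like tau L.
  split => // [x xS|x y xS yS|x xS tx].
  - by have [] := leaf x xS.
  - exact: (sphere_dist_to_lip (Mne _ i0) (MSu _ i0) M0c).
  - have [a [b [ab _ xE m]]] := sphere_dist_to_arc (Mne _ i0) (MSu _ i0) M0c (ltnW hn) xS tx.
    by exists a, b.
have [xL MxL] := Mne _ iL.
have xLS := MSu _ iL _ MxL.
have txL : tau xL = L := Mdist _ _ iL MxL.
have [a0 [b0 [ab0 xLE mm]]] : exists a b, [/\ ortho2 a b, arc a b (tau xL) = xL &
    forall s, 0 <= s <= tau xL -> tau (arc a b s) = s].
  by apply: (dl_arc dl xLS); rewrite txL.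
rewrite txL in xLE mm.
have m0 : minimal_arc tau a0 b0 L by [].
have gS t := arc_usphere t ab0.
have tauM t x : usphere x -> t \in `[0, L] -> tau x = t -> M t x.
  by move=> xS _ <-; have [_ ->] := leaf x xS.
have g0M : M 0 (arc a0 b0 0) by apply: tauM => //; rewrite mm // lexx ltW.
have gLM : M L (arc a0 b0 L) by rewrite xLE.
have ends : (p (arc a0 b0 0) = 1 \/ p (arc a0 b0 0) = -1) /\ p (arc a0 b0 L) = - p (arc a0 b0 0).
  case: M0L => -[H0 HL]; move: g0M gLM; rewrite H0 HL => -[_ ->] [_ ->]; split => //;
    rewrite ?opprK //; [by left|by right].
(* so [p] is regular off the focal sets, having no critical values but [1] and [-1] *)
have inner x : usphere x -> 0 < tau x < L -> p x <> 1 /\ p x <> -1.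
  move=> xS /andP[t0 tL].
  have N0 : ~ M 0 x by move=> /(Mdist _ _ i0) t0'; move: t0; rewrite /tau t0' ltxx.
  have NL : ~ M L x by move=> /(Mdist _ _ iL) t0'; move: tL; rewrite /tau t0' ltxx.
  by split=> px; case: M0L => -[H0 HL]; first [by apply: N0; rewrite H0|by apply: NL; rewrite HL].
have preg x : usphere x -> 0 < tau x < L -> sphere_grad p x != 0.
  move=> xS tx; have [n1 nN1] := inner x xS tx; apply/eqP => g0.
  have : (p @` sphere_critical p) (p x) by exists x.
  by rewrite pcrit => -[].
have pcurv x : usphere x -> 0 < tau x < L -> ([set k | principal_curvature p x k] #= `I_d)%card.
  move=> xS tx; have [n1 nN1] := inner x xS tx; have /andP[pl pu] := prange x xS.
  have [|_ _ H] := plev (p x); last exact: H.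
  by rewrite !lt_neqAle pl pu !andbT; apply/andP; split; apply/eqP => // /esym.
have Es : smooth_on (punctured R n) (energy F).
  have oP := @open_punctured R n; have Fk := mink_smooth hF.
  by move=> k; exact: (CkM oP (Ck_cst k _ _) (CkM oP (Fk k) (Fk k))).
have E2 k x : 0 <= k -> energy F (k *: x) = k ^+ 2 * energy F x.
  by move=> k0; rewrite /energy (mink_homog hF) // exprMn mulrCA.
have E0 x : x != 0 -> 0 < energy F x.
  by move=> x0; rewrite /energy mulr_gt0 ?invr_gt0 // exprn_gt0 // (mink_gt0 hF).
have Etau x y : usphere x -> usphere y -> tau x = tau y -> energy F x = energy F y.
  by move=> xS yS xy; rewrite /energy (Ftau x y).
have [Q QT QE] := energy_quadratic dl m0 hp ptau preg prange ends.1 ends.2 pcurv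
  Es E2 E0 (mink_posdef hF) hflat Etau erefl dE.
apply: (@euclidean_of_quadratic R n F (2 *: Q)).
- by rewrite linearZ /= QT.
- exact: (mink_ge0 hF).
- exact: (mink_gt0 hF).
- by move=> x; rewrite -scalemxAr dotpZl -QE /energy mulrA divff ?mul1r // pnatr_eq0.
Qed.
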